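(* Let $d \in \{3\} \cup \{n \in \mathbb{N} : n \geq 5\}$. Then there exists a finite functorial semi-norm on $H_d(\,\cdot\,;\mathbb{R})$ that is not carried by the $\ell^1$-semi-norm.
   Context: $H_d(\,\cdot\,;\mathbb{R})$ denotes singular homology in degree $d$ with real coefficients, viewed as a functor from topological spaces (and continuous maps) to real vector spaces. Semi-norms are allowed to take values in $\mathbb{R}_{\geq 0} \cup \{\infty\}$, with the conventions $a + \infty = \infty$ and $b \cdot \infty = \infty$ for all $a \in \mathbb{R}_{\geq 0}$ and $b \in \mathbb{R}_{>0}$. A functorial semi-norm on $H_d(\,\cdot\,;\mathbb{R})$ consists of a choice of a semi-norm $|\cdot|$ on $H_d(X;\mathbb{R})$ for every topological space $X$ such that for every continuous map $f \colon X \to Y$ and every $\alpha \in H_d(X;\mathbb{R})$ one has $|H_d(f;\mathbb{R})(\alpha)| \leq |\alpha|$. It is called finite if $|\alpha| < \infty$ for all topological spaces $X$ and all $\alpha \in H_d(X;\mathbb{R})$. The $\ell^1$-semi-norm: for a topological space $X$ and a singular chain $c = \sum_{j=1}^m a_j \cdot \sigma_j \in C_d(X;\mathbb{R})$ in reduced form (pairwise distinct singular simplices $\sigma_j$), set $|c|_1 := \sum_{j=1}^m |a_j|$. The $\ell^1$-semi-norm $\|\cdot\|_1$ on $H_d(X;\mathbb{R})$ is the semi-norm induced by $|\cdot|_1$, i.e. $\|\alpha\|_1 = \inf\{ |c|_1 : c \in C_d(X;\mathbb{R}) \text{ is a cycle representing } \alpha \}$. This is a finite functorial semi-norm on $H_d(\,\cdot\,;\mathbb{R})$.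 A functorial semi-norm $|\cdot|$ on $H_d(\,\cdot\,;\mathbb{R})$ carries a functorial semi-norm $|\cdot|'$ on $H_d(\,\cdot\,;\mathbb{R})$ if for all topological spaces $X$ and all $\alpha \in H_d(X;\mathbb{R})$: $|\alpha| = 0$ implies $|\alpha|' = 0$. *)

(* Defs.v *)
From HB Require Import structures.
From mathcomp Require Import all_boot all_order all_algebra.
From mathcomp Require Import all_classical all_reals topology normedtype ereal.
From mathcomp.multinomials Require Import freeg.
Set Implicit Arguments.
Unset Strict Implicit.
Unset Printing Implicit Defensive.
Import Order.TTheory GRing.Theory Num.Theory.
Import numFieldNormedType.Exports.
Local Open Scope classical_set_scope.
Local Open Scope quotient_scope.
Local Open Scope ereal_scope.
Local Open Scope ring_scope.

Section FgliftLinear.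
Context (R : nzRingType) (M : lmodType R) (K : choiceType) (f : K -> M).

Lemma fglift_is_linear : linear (fglift f).
Proof.
have addf : zmod_morphism (fglift f) := @lift_is_additive R K M f.
have fD x y : fglift f (x + y) = fglift f x + fglift f y.
  have f0 : fglift f 0 = 0 by rewrite -(subrr 0) addf subrr.
  have fN z : fglift f (- z) = - fglift f z by rewrite -sub0r addf f0 sub0r.
  by rewrite -{1}[y]opprK addf fN opprK.
have f0 : fglift f 0 = 0 by rewrite -(subrr 0) addf subrr.
move=> a x y; rewrite fD; congr (_ + _).
have sumf (s : seq K) (F : K -> {freeg K / R}) :
    fglift f (\sum_(k <- s) F k) = \sum_(k <- s) fglift f (F k).
  by elim: s => [|k s IH]; rewrite ?big_nil // !big_cons fD IH.
rewrite -{2}[x]freeg_sumE sumf scaler_sumr.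
rewrite [a *: x]/(fgscale a x) /fgscale sumf.
by apply: eq_bigr => k _; rewrite !liftU scalerA.
Qed.

HB.instance Definition _ :=
  GRing.isLinear.Build R {freeg K / R} M _ (fglift f) fglift_is_linear.

End FgliftLinear.

Lemma mx_continuous (R X : topologicalType) m n (f : X -> 'M[R]_(m, n)) :
  (forall i j, continuous (fun x => f x i j)) -> continuous f.
Proof.
move=> fc x A [P fxP sPA]; rewrite nbhs_simpl /=.
suff: \forall y \near x, forall a b, P a b (f y a b).
  by apply: filterS => y Py; exact: sPA.
apply: filter_forall => a; apply: filter_forall => b.
exact: fc (fxP a b).
Qed.

Section StandardSimplex.
Context {R : realType}.

Definition std_simplex (n : nat) : set 'rV[R]_n.+1 :=
  [set t | (forall i, 0 <= t 0 i) /\ \sum_i t 0 i = 1].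
Arguments std_simplex n : clear implicits.

(* The affine map inserting the coordinate 0 at position i, i.e. sending the
   vertices of the n-simplex in increasing order to the vertices other than i. *)
Definition face_row n (i : 'I_n.+2) (t : 'rV[R]_n.+1) : 'rV[R]_n.+2 :=
  \row_j (if unlift i j is Some k then t 0 k else 0).

Lemma face_row_simplex n (i : 'I_n.+2) (t : std_simplex n) :
  face_row i (val t) \in std_simplex n.+1.
Proof.
have [t0 t1] := set_valP t; apply/mem_set; split=> [j|].
  by rewrite mxE; case: unlift.
rewrite -[RHS]t1 (bigD1_ord i) //= mxE unlift_none add0r.
by apply: eq_bigr => k _; rewrite mxE liftK.
Qed.

Definition face n (i : 'I_n.+2) (t : std_simplex n) : std_simplex n.+1 :=
  exist _ (face_row i (val t)) (face_row_simplex i t).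

Lemma face_continuous n (i : 'I_n.+2) : continuous (@face n i).
Proof.
apply: continuous_comp_initial; apply: mx_continuous => a b t.
have -> : (fun x : std_simplex n => (set_val \o face i) x a b) =
    (fun x => if unlift i b is Some k then set_val x 0 k else 0).
  by apply/funext => x; rewrite mxE.
case: unlift => [k|]; last by apply: cst_continuous.
apply: (@continuous_comp _ _ _ set_val (fun s : 'rV[R]_n.+1 => s 0 k)).
  exact: initial_continuous.
exact: coord_continuous.
Qed.

HB.instance Definition _ n i :=
  isContinuous.Build _ _ (@face n i) (@face_continuous n i).

End StandardSimplex.
Arguments std_simplex R n : clear implicits.

Section SingularHomology.
Context (R : realType).
Implicit Types X Y : topologicalType.

Definition sing_simplex n X := continuousType (std_simplex R n) X.
HB.instance Definition _ n X := Choice.on (sing_simplex n X).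

Definition sing_chain n X := {freeg (sing_simplex n X) / R}.
HB.instance Definition _ n X := GRing.Lmodule.on (sing_chain n X).

Definition face_sing n X (i : 'I_n.+2) (s : sing_simplex n.+1 X) :
  sing_simplex n X := s \o face i.

Definition sing_boundary n X : sing_chain n.+1 X -> sing_chain n X :=
  fglift (fun s => \sum_(i < n.+2) (-1) ^+ i *: << face_sing i s >>).
HB.instance Definition _ n X := GRing.Linear.on (@sing_boundary n X).

(* The differential in every degree, with the convention that there are no
   nonzero chains in degree -1. *)
Definition bd n X : sing_chain n X -> sing_chain n.-1 X :=
  if n is m.+1 then @sing_boundary m X else fun=> 0.

Lemma bd_is_linear n X : linear (@bd n X).
Proof.
case: n => [|n] a c e; first by rewrite /bd scaler0 addr0.
exact: linearP.
Qed.
HB.instance Definition _ n X :=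
  GRing.isLinear.Build R (sing_chain n X) (sing_chain n.-1 X) _
    (@bd n X) (@bd_is_linear n X).

Definition is_cycle n X : {pred sing_chain n X} := [pred c | bd c == 0].

Lemma is_cycle_submod n X : submod_closed (@is_cycle n X).
Proof.
split=> [|a c e]; rewrite !inE ?linear0 // => /eqP c0 /eqP e0.
by rewrite bd_is_linear c0 e0 scaler0 addr0.
Qed.
HB.instance Definition _ n X :=
  GRing.isSubmodClosed.Build R (sing_chain n X)
    (@is_cycle n X) (@is_cycle_submod n X).

Record sing_cycle n X := SingCycle {
  sing_cycle_val :> sing_chain n X;
  _ : sing_cycle_val \in @is_cycle n X }.
HB.instance Definition _ n X := [isSub for @sing_cycle_val n X].
HB.instance Definition _ n X := [Choice of sing_cycle n X by <:].
HB.instance Definition _ n X :=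
  [SubChoice_isSubLmodule of sing_cycle n X by <:].

Definition is_boundary n X : {pred sing_cycle n X} :=
  [pred z : sing_cycle n X |
    `[< exists c : sing_chain n.+1 X, val z = bd c >] ].

Lemma is_boundaryP n X (z : sing_cycle n X) :
  reflect (exists c : sing_chain n.+1 X, val z = bd c) (z \in @is_boundary n X).
Proof. exact: asboolP. Qed.

Lemma is_boundary_submod n X : submod_closed (@is_boundary n X).
Proof.
split=> [|a z w]; first by apply/is_boundaryP; exists 0;
  rewrite (linear0 (@bd n.+1 X)).
move=> /is_boundaryP[c zc] /is_boundaryP[e we]; apply/is_boundaryP.
by exists (a *: c + e); rewrite bd_is_linear -zc -we.
Qed.
HB.instance Definition _ n X :=
  GRing.isSubmodClosed.Build R (sing_cycle n X)
    (@is_boundary n X) (@is_boundary_submod n X).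

Definition homology n X := Quotient.quot (@is_boundary n X).
HB.instance Definition _ n X := GRing.Zmodule.on (homology n X).
HB.instance Definition _ n X := EqQuotient.on (homology n X).
HB.instance Definition _ n X := ZmodQuotient.on (homology n X).

Definition hclass n X (z : sing_cycle n X) : homology n X :=
  \pi_(homology n X) z.

Lemma bdZ n X a (c : sing_chain n X) : bd (a *: c) = a *: bd c.
Proof. exact: linearZ. Qed.

Lemma hclass_eq n X (z w : sing_cycle n X) :
  hclass z = hclass w <-> exists c : sing_chain n.+1 X, val z - val w = bd c.
Proof.
rewrite (rwP eqP) -(@Quotient.idealrBE _ (@is_boundary n X)).
exact: (iff_sym (rwP (is_boundaryP (z - w)))).
Qed.

Lemma hclass_repr n X (h : homology n X) : hclass (repr h) = h.
Proof. exact: reprK. Qed.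

Lemma hclassB n X : zmod_morphism (@hclass n X).
Proof. exact: pi_is_zmod_morphism. Qed.
HB.instance Definition _ n X :=
  GRing.isZmodMorphism.Build _ _ (@hclass n X) (@hclassB n X).

Definition hscale n X (a : R) (h : homology n X) : homology n X :=
  hclass (a *: repr h).

Lemma hscale_hclass n X (a : R) (z : sing_cycle n X) :
  hscale a (hclass z) = hclass (a *: z).
Proof.
have /hclass_eq[c cE] := hclass_repr (hclass z).
by apply/hclass_eq; exists (a *: c); rewrite bdZ -cE scalerBr.
Qed.

Fact hscaleA n X (a b : R) (h : homology n X) :
  hscale a (hscale b h) = hscale (a * b) h.
Proof. by rewrite -[h]hclass_repr !hscale_hclass scalerA. Qed.
Fact hscale1 n X : left_id 1 (@hscale n X).
Proof. by move=> h; rewrite -[h]hclass_repr !hscale_hclass scale1r. Qed.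
Fact hscaleDr n X : right_distributive (@hscale n X) +%R.
Proof.
move=> a g h; rewrite -[g]hclass_repr -[h]hclass_repr -raddfD !hscale_hclass.
by rewrite scalerDr raddfD.
Qed.
Fact hscaleDl n X (h : homology n X) : {morph (@hscale n X)^~ h : a b / a + b}.
Proof.
by move=> a b; rewrite -[h]hclass_repr !hscale_hclass scalerDl raddfD.
Qed.
HB.instance Definition _ n X := GRing.Zmodule_isLmodule.Build R (homology n X)
  (@hscaleA n X) (@hscale1 n X) (@hscaleDr n X) (@hscaleDl n X).

Lemma hclassZ n X : scalable (@hclass n X).
Proof. by move=> a z; rewrite -hscale_hclass. Qed.
HB.instance Definition _ n X :=
  GRing.isScalable.Build R (sing_cycle n X) (homology n X) _
    (@hclass n X) (@hclassZ n X).

Section Functor.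
Context (X Y : topologicalType) (f : continuousType X Y) (n : nat).

Definition chain_map : sing_chain n X -> sing_chain n Y :=
  fglift (fun s : sing_simplex n X => << (f \o s : sing_simplex n Y) >>).
HB.instance Definition _ := GRing.Linear.on chain_map.
End Functor.

Lemma chain_linear_ext (V : lmodType R) n X
    (g h : {linear sing_chain n X -> V}) :
  (forall s, g << s >> = h << s >>) -> g =1 h.
Proof.
move=> gh c; rewrite -[c]freeg_sumE !linear_sum; apply: eq_bigr => s _.
have -> : << coeff s c *g s >> = coeff s c *: << s >>.
  by apply/eqP/freeg_eqP => t; rewrite coeffZ !coeffU mul1r.
by rewrite !linearZ gh.
Qed.

Lemma chain_map_bd X Y (f : continuousType X Y) n (c : sing_chain n X) :
  bd (chain_map f c) = chain_map f (bd c).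
Proof.
case: n c => [|n] c; first by rewrite linear0.
apply: (chain_linear_ext (g := @sing_boundary n Y \o @chain_map X Y f n.+1)
  (h := @chain_map X Y f n \o @sing_boundary n X)) => s /=.
rewrite /chain_map /sing_boundary !liftU !scale1r liftU !scale1r linear_sum.
apply: eq_bigr => i _; rewrite linearZ /= liftU scale1r; congr (_ *: << _ >>).
exact/continuousEP.
Qed.

Lemma cycle_map_subproof X Y (f : continuousType X Y) n (z : sing_cycle n X) :
  chain_map f z \in @is_cycle n Y.
Proof.
by have := valP z; rewrite !inE chain_map_bd => /eqP ->; rewrite linear0.
Qed.
Definition cycle_map X Y (f : continuousType X Y) n (z : sing_cycle n X) :
  sing_cycle n Y := SingCycle (cycle_map_subproof f z).

Definition homology_map X Y (f : continuousType X Y) n (h : homology n X) :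
  homology n Y := hclass (cycle_map f (repr h)).

Lemma homology_map_hclass X Y (f : continuousType X Y) n (z : sing_cycle n X) :
  homology_map f (hclass z) = hclass (cycle_map f z).
Proof.
have /hclass_eq[c cE] := hclass_repr (hclass z).
apply/hclass_eq; exists (chain_map f c).
by rewrite chain_map_bd -cE linearB.
Qed.

Lemma homology_map_linear X Y (f : continuousType X Y) n :
  linear (@homology_map X Y f n).
Proof.
move=> a g h; rewrite -[g]hclass_repr -[h]hclass_repr -linearP.
rewrite !homology_map_hclass -linearP; congr hclass; apply: val_inj.
exact: linearP.
Qed.
HB.instance Definition _ X Y f n := GRing.isLinear.Build R _ _ _
  (@homology_map X Y f n) (@homology_map_linear X Y f n).

(* [dom c] lists the simplices of the reduced form of [c], without repetition. *)
Definition l1_chain n X (c : sing_chain n X) : R :=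
  \sum_(s <- dom c) `|coeff s c|.

Lemma l1_chain_sub n X (c : sing_chain n X) (S : seq (sing_simplex n X)) :
  uniq S -> {subset dom c <= S} -> l1_chain c = \sum_(s <- S) `|coeff s c|.
Proof.
move=> uS dS; rewrite [RHS](bigID [in dom c]) /= [X in _ + X]big1 ?addr0.
  rewrite -big_filter; apply: perm_big; apply: uniq_perm.
  - exact: uniq_dom.
  - exact: filter_uniq.
  - by move=> s; rewrite mem_filter; case: (boolP (s \in dom c)) => // /dS ->.
by move=> s /coeff_outdom ->; rewrite normr0.
Qed.

Lemma l1_chainD n X (c e : sing_chain n X) :
  l1_chain (c + e) <= l1_chain c + l1_chain e.
Proof.
pose S := undup (dom c ++ dom e).
have uS : uniq S := undup_uniq _.
have sc : {subset dom c <= S} by move=> s sc; rewrite mem_undup mem_cat sc.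
have se : {subset dom e <= S}.
  by move=> s se; rewrite mem_undup mem_cat se orbT.
have sce : {subset dom (c + e) <= S}.
  by move=> s /domD_subset; rewrite mem_undup.
rewrite (l1_chain_sub uS sc) (l1_chain_sub uS se) (l1_chain_sub uS sce).
rewrite -big_split /=.
by apply: ler_sum => s _; rewrite coeffD ler_normD.
Qed.

Lemma l1_chainZ n X a (c : sing_chain n X) :
  l1_chain (a *: c) = `|a| * l1_chain c.
Proof.
rewrite (@l1_chain_sub _ _ _ (dom c)) ?uniq_dom //; last exact: domZ_subset.
by rewrite mulr_sumr; apply: eq_bigr => s _; rewrite coeffZ normrM.
Qed.

Lemma l1_chain_map X Y (f : continuousType X Y) n (c : sing_chain n X) :
  l1_chain (chain_map f c) <= l1_chain c.
Proof.
rewrite -{1}[c]freeg_sumE linear_sum /l1_chain.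
elim: (dom c) => [|s S IH]; first by rewrite !big_nil dom0 big_nil.
rewrite !big_cons; apply: le_trans (l1_chainD _ _) _; apply: lerD => //.
rewrite /= (liftU _ (coeff s c) s : chain_map f _ = _) l1_chainZ /l1_chain.
rewrite domU1 big_seq1 coeffU eqxx.
by rewrite mulr1 normr1 mulr1.
Qed.

Lemma l1_chain_ge0 n X (c : sing_chain n X) : 0 <= l1_chain c.
Proof. by apply: sumr_ge0. Qed.

End SingularHomology.

(* Since [0 * +oo = 0] in [\bar R], [fsn_scale] with r = 0 says that the
   semi-norm vanishes at 0, even though infinite values are allowed. *)
Record functorial_seminorm (R : realType) (d : nat) := FunctorialSeminorm {
  fsn :> forall X : topologicalType, homology R d X -> \bar R;
  fsn_ge0 : forall X (a : homology R d X), (0 <= fsn a)%E;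
  fsn_scale : forall X (r : R) (a : homology R d X),
    fsn (r *: a) = (`|r|%:E * fsn a)%E;
  fsn_triangle : forall X (a b : homology R d X),
    (fsn (a + b)%R <= fsn a + fsn b)%E;
  fsn_functorial : forall (X Y : topologicalType) (f : continuousType X Y)
    (a : homology R d X), (fsn (homology_map f a) <= fsn a)%E }.

Definition finite_fsn (R : realType) d (N : functorial_seminorm R d) :=
  forall X (a : homology R d X), (N X a < +oo)%E.

Definition carries (R : realType) d (N N' : functorial_seminorm R d) :=
  forall X (a : homology R d X), N X a = 0%E -> N' X a = 0%E.

Section L1.
Context (R : realType) (d : nat).
Implicit Types X Y : topologicalType.

Definition l1 X (a : homology R d X) : \bar R :=
  ereal_inf [set (l1_chain (z : sing_chain R d X))%:E
            | z in [set z : sing_cycle R d X | hclass z = a]].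

Lemma l1_le X (z : sing_cycle R d X) : (l1 (hclass z) <= (l1_chain z)%:E)%E.
Proof. by apply: ereal_inf_lbound; exists z. Qed.

Lemma l1_ge0 X (a : homology R d X) : (0 <= l1 a)%E.
Proof.
by apply: le_ereal_inf_tmp => _ [z _ <-]; rewrite lee_fin l1_chain_ge0.
Qed.

Lemma l1_fin X (a : homology R d X) : (l1 a < +oo)%E.
Proof. by rewrite -[a]hclass_repr (le_lt_trans (l1_le _)) ?ltry. Qed.

Lemma l1_scale X r (a : homology R d X) : l1 (r *: a) = (`|r|%:E * l1 a)%E.
Proof.
have le s b : s != 0 -> (l1 (s *: b : homology R d X) <= `|s|%:E * l1 b)%E.
  move=> s0; rewrite -[leRHS]ereal_inf_pZl ?normr_gt0 //.
  apply: le_ereal_inf_tmp => _ [_ [z <- <-] <-].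
  rewrite -linearZ -EFinM -l1_chainZ; exact: l1_le.
have [->|r0] := eqVneq r 0.
  rewrite scale0r normr0 mul0e; apply/eqP; rewrite eq_le l1_ge0 andbT.
  have := l1_le (0 : sing_cycle R d X); rewrite linear0; congr (_ <= _%:E)%E.
  by rewrite /l1_chain /= dom0 big_nil.
apply/eqP; rewrite eq_le le //=.
have rn0 : 0 < `|r| by rewrite normr_gt0.
rewrite -lee_pdivlMl // -normfV.
by rewrite -{1}[a](scalerK r0) le ?invr_eq0.
Qed.

Lemma l1_triangle X (a b : homology R d X) : (l1 (a + b)%R <= l1 a + l1 b)%E.
Proof.
have fin c : l1 (c : homology R d X) \is a fin_num.
  by rewrite ge0_fin_numE ?l1_ge0 ?l1_fin.
apply/lee_addgt0Pr => e e0; have e20 : 0 < e / 2 by rewrite divr_gt0.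
have [_ [z za <-] zl] := lb_ereal_inf_adherent e20 (fin a).
have [_ [w wb <-] wl] := lb_ereal_inf_adherent e20 (fin b).
rewrite -za -wb -linearD (le_trans (l1_le _)) //.
have le1 : ((l1_chain (z + w : sing_chain R d X))%:E <=
  (l1_chain (z : sing_chain R d X))%:E + (l1_chain (w : sing_chain R d X))%:E)%E.
  by rewrite -EFinD lee_fin l1_chainD.
apply: (le_trans le1); rewrite za wb [e]splitr EFinD addeACA.
by apply: leeD; exact: ltW.
Qed.

Lemma l1_functorial X Y (f : continuousType X Y) (a : homology R d X) :
  (l1 (homology_map f a) <= l1 a)%E.
Proof.
apply: le_ereal_inf_tmp => _ [z <- <-]; rewrite homology_map_hclass.
by rewrite (le_trans (l1_le _)) // lee_fin l1_chain_map.
Qed.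

Definition l1_seminorm : functorial_seminorm R d :=
  FunctorialSeminorm l1_ge0 l1_scale l1_triangle l1_functorial.
End L1.

(* Main.v *)
(* A labelling of the singular simplices of a space by a group G is a simplicial map
   to the classifying space of G. Pairing a homology class with an invariant cocycle F
   on G along a labelling gives a number, and the supremum of its absolute values over
   all labellings is a functorial semi-norm. It is finite if on every finite set of
   simplices F is bounded modulo coboundaries, uniformly in the labelling. Bounded
   cocycles have this property, cross products inherit it, and so does the secondary
   class theta1 dtheta2 - kappa if dtheta1, dtheta2 and kappa are bounded; no bound on
   theta1 and theta2 is needed.

   Let K be the field of rational functions, ordered at infinity. The bounded cocycles
   Te and To on SL2(K) are the orientations of ideal triangles in the Bruhat-Tits tree
   of K whose centre is an even, respectively odd, vertex. An even and an odd centre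
   are different vertices of a planar tree, which makes the product of Te and To the
   coboundary of a bounded kappa. In the central extension of SL2(K) by two copies of R
   with these classes, Te and To become coboundaries of theta1 and theta2, which gives
   a cocycle Phi in degree 3.

   If z1 and z2 lie in the first and second central copy of R and bound rational
   chains c1 and c2, then [z1] x c2 + c1 x [z2] is a 3-cycle, on which Phi takes the
   value z1 z2. Replacing z1 and z2 by their k-th powers multiplies the class by k^2, but
   multiplies the norm of the cycle only by a multiple of k, hence the class has l1-norm
   0. Cross products with the class dual to Te and with a second copy of the 3-cycle
   reach the odd degrees from 5 on and the even degrees from 6 on. *)
From HB Require Import structures.
Require Import Defs.
From mathcomp Require Import all_boot all_order all_algebra.
From mathcomp Require Import ring lra zify.
From mathcomp Require Import all_classical all_reals topology normedtype ereal.
From mathcomp.multinomials Require Import freeg.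
Set Implicit Arguments.
Unset Strict Implicit.
Unset Printing Implicit Defensive.
Import Order.TTheory GRing.Theory Num.Theory.
Import numFieldNormedType.Exports.
Local Open Scope ring_scope.

(** * Coboundaries, chains and shuffles *)

(** A bounded cocycle cannot detect a class of l1-norm 0, so the semi-norm must come from an
    unbounded one. What keeps the supremum finite for [Phi] is that, on finitely many simplices,
    [theta1] and [theta2] can be replaced by bounded primitives of the same coboundaries at the cost
    of a coboundary only. This needs two bounded classes whose product is trivial through a bounded
    [kappa], and a tree with two colours of vertices provides them.

    The chains [c1] and [c2] come from one computation in SL2. For positive [s] the upper and lower
    unipotents with entries [s] and [-1/s] have a product of order 6, and conjugation by diag(2,
    1/2) or its inverse turns each into its fourth power. Hence they vanish in real first homology,
    and the sixth power of a lift of the product bounds a rational chain. This power is central,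
    equal to -4 in the even or the odd copy of the reals according to the parity of the degree of
    [s]; [s = 1] and [s = X] give both.

    Spaces enter through a model of the classifying space with very few open sets, whose singular
    simplices are labelled by a monodromy argument. *)

Section Coboundary.
Variables (T : Type).

(** The alternating sum over the faces of [s], as a recursion, so that [cob_cob] and the product
    formulas become inductions without indices; [cob_sum] recovers the signed sum. *)
Fixpoint cob (V : zmodType) (f : seq T -> V) (s : seq T) : V :=
  if s is x :: s' then f s' - cob (fun w => f (x :: w)) s' else 0.

(** On a single vertex [cob f] is the augmentation value [f [::]]. With it the product formula for
    shuffles would fail on a pair of vertices. *)
Definition cob1 (V : zmodType) (f : seq T -> V) (s : seq T) : V :=
  if (size s <= 1)%N then 0 else cob f s.

Lemma cob1E (V : zmodType) (f : seq T -> V) s :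
  (1 < size s)%N -> cob1 f s = cob f s.
Proof. by rewrite /cob1 ltnNge => /negPf ->. Qed.

Lemma cob_eq_size (V : zmodType) (f g : seq T -> V) s :
  (forall w, (size w).+1 = size s -> f w = g w) -> cob f s = cob g s.
Proof.
elim: s f g => //= x s IH f g fg; rewrite fg //; congr (_ - _).
by apply: IH => w ws; apply: fg => /=; rewrite ws.
Qed.

Lemma eq_cob (V : zmodType) (f g : seq T -> V) : f =1 g -> cob f =1 cob g.
Proof. by move=> fg s; apply: cob_eq_size => w _; exact: fg. Qed.

Lemma cobD (V : zmodType) (f g : seq T -> V) s :
  cob (fun w => f w + g w) s = cob f s + cob g s.
Proof.
elim: s f g => [|x s IH] f g /=; first by rewrite addr0.
by rewrite IH opprD addrACA.
Qed.

Lemma cobN (V : zmodType) (f : seq T -> V) s :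
  cob (fun w => - f w) s = - cob f s.
Proof.
elim: s f => [|x s IH] f /=; first by rewrite oppr0.
by rewrite IH opprD.
Qed.

Lemma cobB (V : zmodType) (f g : seq T -> V) s :
  cob (fun w => f w - g w) s = cob f s - cob g s.
Proof. by rewrite cobD cobN. Qed.

Lemma cob0 (V : zmodType) (s : seq T) : cob (fun=> 0 : V) s = 0.
Proof. by elim: s => //= x s ->; rewrite subrr. Qed.

Lemma cobZ (R : nzRingType) (V : lmodType R) (a : R) (f : seq T -> V) s :
  cob (fun w => a *: f w) s = a *: cob f s.
Proof.
elim: s f => [|x s IH] f /=; first by rewrite scaler0.
by rewrite IH scalerBr.
Qed.

Lemma cob_cob (V : zmodType) (f : seq T -> V) s : cob (cob f) s = 0.
Proof.
elim: s f => [|x s IH] f //=.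
by rewrite cobB IH subr0 subrr.
Qed.

Definition del i (s : seq T) := take i s ++ drop i.+1 s.

Lemma size_del i s : (i < size s)%N -> size (del i s) = (size s).-1.
Proof.
by move=> iltn; rewrite size_cat size_takel 1?ltnW // size_drop; lia.
Qed.

Lemma nth_del x0 i s k : nth x0 (del i s) k = nth x0 s (bump i k).
Proof.
rewrite nth_cat size_take /bump; have [is_|si] := ltnP i (size s).
  have [ki|ik] := ltnP k i; first by rewrite nth_take // add0n.
  by rewrite nth_drop; congr nth; lia.
have [ks|sk] := ltnP k (size s).
  by rewrite nth_take ?(leq_trans ks) // leqNgt (leq_trans ks) // add0n.
by rewrite (drop_oversize (leqW si)) nth_nil nth_default //; lia.
Qed.

Lemma cob_sum (R : nzRingType) (V : lmodType R) (f : seq T -> V) s :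
  cob f s = \sum_(i < size s) (-1) ^+ i *: f (del i s).
Proof.
elim: s f => [|x s IH] f /=; first by rewrite big_ord0.
rewrite big_ord_recl expr0 scale1r {1}/del take0 drop1 /=; congr (_ + _).
rewrite IH -sumrN; apply: eq_bigr => i _.
by rewrite /del /= /bump /= add1n exprS mulN1r scaleNr.
Qed.

End Coboundary.

Lemma cob_map (A B : Type) (h : A -> B) (V : zmodType) (f : seq B -> V) s :
  cob f (map h s) = cob (fun w => f (map h w)) s.
Proof. by elim: s f => //= x s IH f; rewrite IH. Qed.

Lemma cob_linear (T : Type) (R : nzRingType) (V W : lmodType R)
  (h : {linear V -> W}) (f : seq T -> V) s : h (cob f s) = cob (h \o f) s.
Proof.
elim: s f => [|x s IH] f /=; first by rewrite linear0.
by rewrite linearB IH.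
Qed.

Section Cup.
Variables (T : Type) (R : comNzRingType).
Implicit Types f g : seq T -> R.

Definition cup p f g (s : seq T) : R := f (take p.+1 s) * g (drop p s).

Lemma cob_cup p f g (s : seq T) : (p.+2 <= size s)%N ->
  cob (cup p f g) s = cup p.+1 (cob f) g s + (-1) ^+ p * cup p f (cob g) s.
Proof.
elim: p f s => [|p IH] f [|x s] //=; rewrite ltnS => ps.
  case: s ps => // y s _.
  rewrite /cup /= !take0 /= (_ : cob _ s = f [:: x] * cob (fun w => g [:: x, y & w]) s).
    ring.
  have := @cobZ T R R^o (f [:: x]) (fun w => g [:: x, y & w]) s.
  by rewrite /GRing.scale /= => <-; apply: eq_cob => w; rewrite ?take0.
rewrite (@eq_cob _ _ _ (cup p (fun w => f (x :: w)) g)) //.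
by rewrite IH // /cup /= exprS; ring.
Qed.

End Cup.

Section Chains.
Variable R : realFieldType.

(** Chains are never reduced. They are compared only through [ev], against cochains with values in
    arbitrary modules, and [cnorm] is an upper bound for the l1-norm of the reduced form. *)
Definition chain (A : Type) := seq (R * A).

Definition ev (A : Type) (V : lmodType R) (f : A -> V) (l : chain A) : V :=
  \sum_(w <- l) w.1 *: f w.2.

Definition cnorm (A : Type) (l : chain A) : R := \sum_(w <- l) `|w.1|.

Definition cscale (A : Type) (a : R) (l : chain A) : chain A :=
  [seq (a * w.1, w.2) | w <- l].

Definition of_size (A : Type) n (l : chain (seq A)) :=
  all (fun w => size w.2 == n) l.

Section Ev.
Variables (A : Type) (V : lmodType R).
Implicit Types (f g : A -> V) (l : chain A).

Lemma ev_nil f : ev f [::] = 0. Proof. by rewrite /ev big_nil. Qed.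

Lemma ev_cons f w l : ev f (w :: l) = w.1 *: f w.2 + ev f l.
Proof. by rewrite /ev big_cons. Qed.

Lemma ev_cat f l l' : ev f (l ++ l') = ev f l + ev f l'.
Proof. by rewrite /ev big_cat. Qed.

Lemma ev_seq1 f a x : ev f [:: (a, x)] = a *: f x.
Proof. by rewrite /ev big_seq1. Qed.

Lemma ev_scale f a l : ev f (cscale a l) = a *: ev f l.
Proof.
rewrite /ev /cscale big_map scaler_sumr; apply: eq_bigr => w _.
by rewrite scalerA.
Qed.

Lemma eq_ev f g l : f =1 g -> ev f l = ev g l.
Proof. by move=> fg; apply: eq_bigr => w _; rewrite fg. Qed.

Lemma evD f g l : ev (fun x => f x + g x) l = ev f l + ev g l.
Proof. by rewrite /ev -big_split; apply: eq_bigr => w _; rewrite scalerDr. Qed.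

Lemma evZ a f l : ev (fun x => a *: f x) l = a *: ev f l.
Proof.
rewrite /ev scaler_sumr; apply: eq_bigr => w _.
by rewrite !scalerA mulrC.
Qed.

Lemma evN f l : ev (fun x => - f x) l = - ev f l.
Proof. by rewrite /ev -sumrN; apply: eq_bigr => w _; rewrite scalerN. Qed.

Lemma evB f g l : ev (fun x => f x - g x) l = ev f l - ev g l.
Proof. by rewrite evD evN. Qed.

End Ev.

Lemma ev_eq0 (A : Type) (V : lmodType R) (f : A -> V) (l : chain A) :
  (forall x, f x = 0) -> ev f l = 0.
Proof. by move=> f0; rewrite /ev big1 // => w _; rewrite f0 scaler0. Qed.

Lemma eq_ev_size (A : Type) (V : lmodType R) (f g : seq A -> V) n
    (l : chain (seq A)) :
  of_size n l -> (forall s, size s = n -> f s = g s) -> ev f l = ev g l.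
Proof.
move=> + fg; elim: l => [|w l IH] /=; first by rewrite !ev_nil.
by case/andP => /eqP /fg wn /IH E; rewrite !ev_cons wn E.
Qed.

Lemma ev_map (A B : Type) (h : A -> B) (V : lmodType R) (f : B -> V)
    (l : chain A) :
  ev f [seq (w.1, h w.2) | w <- l] = ev (f \o h) l.
Proof. by rewrite /ev big_map. Qed.

Lemma ev_linear (A : Type) (V W : lmodType R) (h : {linear V -> W}) (f : A -> V)
    (l : chain A) : h (ev f l) = ev (h \o f) l.
Proof. by rewrite /ev linear_sum; apply: eq_bigr => w _; rewrite linearZ. Qed.

Lemma cob_ev (A B : Type) (V : lmodType R) (f : seq A -> B -> V) (l : chain B) s :
  cob (fun w => ev (f w) l) s = ev (fun b => cob (f^~ b) s) l.
Proof.
elim: s f => [|x s IH] f /=; first by rewrite ev_eq0.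
by rewrite IH -evB.
Qed.

Lemma cnorm_cat (A : Type) (l l' : chain A) :
  cnorm (l ++ l') = cnorm l + cnorm l'.
Proof. by rewrite /cnorm big_cat. Qed.

Lemma cnorm_scale (A : Type) a (l : chain A) :
  cnorm (cscale a l) = `|a| * cnorm l.
Proof.
by rewrite /cnorm /cscale big_map mulr_sumr; apply: eq_bigr => w _; rewrite normrM.
Qed.

Lemma cnorm_ge0 (A : Type) (l : chain A) : 0 <= cnorm l.
Proof. by apply: sumr_ge0. Qed.

Lemma of_size_cat (A : Type) n (l l' : chain (seq A)) :
  of_size n (l ++ l') = of_size n l && of_size n l'.
Proof. exact: all_cat. Qed.

Lemma of_size_scale (A : Type) n a (l : chain (seq A)) :
  of_size n (cscale a l) = of_size n l.
Proof. by rewrite /of_size /cscale all_map. Qed.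

Lemma of_size_map (A B : Type) n (h : A -> B) (l : chain (seq A)) :
  of_size n [seq (w.1, map h w.2) | w <- l] = of_size n l.
Proof. by rewrite /of_size all_map; apply: eq_all => w /=; rewrite size_map. Qed.

Lemma cnorm_map (A B : Type) (h : A -> B) (l : chain A) :
  cnorm [seq (w.1, h w.2) | w <- l] = cnorm l.
Proof. by rewrite /cnorm big_map. Qed.

(* The Eilenberg-Zilber shuffle product. *)
Section Shuffle.
Variables A B : Type.

Definition cone (a : R) (P : A * B) (l : chain (seq (A * B))) :
    chain (seq (A * B)) :=
  [seq (a * w.1, P :: w.2) | w <- l].

(** The sum over grid paths from [(x0, y0)]. A first step in the second direction costs the sign of
    moving it past the [size x'] steps of the first; a direction that is exhausted contributes the
    empty chain. *)
Fixpoint shuffle (x : seq A) : seq B -> chain (seq (A * B)) :=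
  if x is x0 :: x' then
    fix shuffle_x (y : seq B) :=
      if y is y0 :: y' then
        if nilp x' && nilp y' then [:: (1, [:: (x0, y0)])]
        else cone 1 (x0, y0) (shuffle x' y) ++
             cone ((-1) ^+ size x') (x0, y0) (shuffle_x y')
      else [::]
  else fun=> [::].

Definition shuf (V : lmodType R) (f : seq (A * B) -> V) x y : V :=
  ev f (shuffle x y).

Lemma ev_cone (V : lmodType R) (f : seq (A * B) -> V) a P l :
  ev f (cone a P l) = a *: ev (fun w => f (P :: w)) l.
Proof.
rewrite /ev /cone big_map scaler_sumr; apply: eq_bigr => w _.
by rewrite scalerA.
Qed.

Lemma shuf_nill (V : lmodType R) (f : seq (A * B) -> V) y : shuf f [::] y = 0.
Proof. by rewrite /shuf ev_nil. Qed.

Lemma shuf_nilr (V : lmodType R) (f : seq (A * B) -> V) x : shuf f x [::] = 0.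
Proof. by rewrite /shuf; case: x => [|x0 x] /=; rewrite ev_nil. Qed.

Lemma shuf_rec (V : lmodType R) (f : seq (A * B) -> V) x0 x y0 y :
  ~~ (nilp x && nilp y) ->
  shuf f (x0 :: x) (y0 :: y) =
  shuf (fun w => f ((x0, y0) :: w)) x (y0 :: y) +
  (-1) ^+ size x *: shuf (fun w => f ((x0, y0) :: w)) (x0 :: x) y.
Proof. by rewrite /shuf /= => /negPf ->; rewrite ev_cat !ev_cone scale1r. Qed.

Lemma size_shuffle x y : of_size (size x + size y).-1 (shuffle x y).
Proof.
elim: x y => [|x0 x IHx] //; elim=> [|y0 y IHy] //=.
case: ifP => [|nn].
  by case/andP => /nilP -> /nilP -> /=.
rewrite of_size_cat; apply/andP; split; rewrite /of_size /cone all_map.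
  apply: sub_all (IHx (y0 :: y)) => w /= /eqP ->; apply/eqP.
  by move: nn; rewrite /nilp; lia.
apply: sub_all IHy => w /= /eqP ->; apply/eqP.
by move: nn; rewrite /nilp; lia.
Qed.

Lemma cnorm_shuffle x y : cnorm (shuffle x y) <= 2 ^+ (size x + size y).
Proof.
have coneE a P l : cnorm (cone a P l) = `|a| * cnorm l.
  rewrite /cnorm /cone big_map mulr_sumr; apply: eq_bigr => w _.
  by rewrite normrM.
elim: x y => [|x0 x IHx] /=; first by move=> y; rewrite /cnorm big_nil exprn_ge0.
elim=> [|y0 y IHy]; first by rewrite /cnorm big_nil exprn_ge0.
case: ifP => nn.
  by rewrite /cnorm big_seq1 normr1; apply: exprn_ege1; lra.
rewrite cnorm_cat !coneE normr1 normrX normrN1 expr1n !mul1r.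
apply: le_trans (lerD (IHx _) IHy) _ => /=.
rewrite -addSnnS /= !exprD !exprS; lra.
Qed.

Lemma shuf1l (V : lmodType R) (f : seq (A * B) -> V) x0 y0 y :
  shuf f [:: x0] (y0 :: y) = f (map (pair x0) (y0 :: y)).
Proof.
elim: y y0 f => [|y1 y IH] y0 f; first by rewrite /shuf /= ev_seq1 scale1r.
by rewrite shuf_rec // {1}/shuf /= ev_nil add0r scale1r IH.
Qed.

Lemma shuf1r (V : lmodType R) (f : seq (A * B) -> V) x0 x y0 :
  shuf f (x0 :: x) [:: y0] = f (map (fun a => (a, y0)) (x0 :: x)).
Proof.
elim: x x0 f => [|x1 x IH] x0 f; first by rewrite /shuf /= ev_seq1 scale1r.
by rewrite shuf_rec // shuf_nilr scaler0 addr0 IH.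
Qed.

(** The Leibniz rule for the boundary of a shuffle product, in dual form. All shuffles start at
    [(x0, y0)]: split off the face that drops this vertex and apply induction to [F], which is [f]
    with this vertex put in front. *)
Lemma shuf_cob1 (V : lmodType R) (f : seq (A * B) -> V) x y :
  (0 < size x)%N -> (0 < size y)%N ->
  shuf (cob1 f) x y =
    cob1 (fun w => shuf f w y) x + (-1) ^+ (size x).-1 *: cob1 (shuf f x) y.
Proof.
have [n] := ubnP (size x + size y)%N.
elim: n f x y => // n IH f [|x0 x] // [|y0 y] // + _ _.
case: x => [|x1 x].
  case: y => [|y1 y] _.
    by rewrite shuf1l /cob1 /= scaler0 addr0.
  rewrite shuf1l (cob1E f) ?size_map // cob_map /cob1 /= add0r scale1r.
  congr (_ - (_ - _)); rewrite ?shuf1l //.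
  by apply: cob_eq_size => w _; rewrite shuf1l.
case: y => [|y1 y] szn.
  rewrite shuf1r (cob1E f) ?size_map // cob_map /cob1 /= scaler0 addr0.
  congr (_ - (_ - _)); rewrite ?shuf1r //.
  by apply: cob_eq_size => w _; rewrite shuf1r.
have [X EX] : exists X, X = x1 :: x by eexists.
have [Y EY] : exists Y, Y = y1 :: y by eexists.
have X0 : (0 < size X)%N by rewrite EX.
have Y0 : (0 < size Y)%N by rewrite EY.
rewrite -EX -EY in szn *; move: {x y x1 y1 EX EY} X0 Y0 szn => X0 Y0 szn.
pose F w := f ((x0, y0) :: w).
have cF (U : seq A) (W : seq B) : (2 < size U + size W)%N ->
    shuf (fun w => cob1 f ((x0, y0) :: w)) U W = shuf f U W - shuf (cob1 F) U W.
  move=> UW; rewrite -evB; apply: (eq_ev_size (size_shuffle U W)) => s sz.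
  by rewrite !cob1E //= sz; lia.
have XY0 : ~~ (nilp X && nilp Y) by rewrite /nilp; lia.
rewrite shuf_rec // !cF; [|move=> /= in szn *; lia..].
rewrite !IH //; [|move=> /= in szn *; lia..].
have cX W : cob1 (fun w => shuf F w W) X = cob (fun w => shuf F w W) X.
  by rewrite /cob1; case: X {cF XY0 szn} X0 => [|a [|b X]] //= _; rewrite shuf_nill subr0.
have cY W : cob1 (shuf F W) Y = cob (shuf F W) Y.
  by rewrite /cob1; case: Y {cF XY0 szn cX} Y0 => [|a [|b Y]] //= _; rewrite shuf_nilr subr0.
have xE : cob1 (fun w => shuf f w (y0 :: Y)) (x0 :: X) = shuf f X (y0 :: Y) -
    (cob1 (fun w => shuf F w (y0 :: Y)) X +
     (-1) ^+ (size X).-1 *: cob (fun w => shuf F (x0 :: w) Y) X).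
  rewrite cob1E // cX -cobZ -cobD; congr (_ - _).
  apply: (@cob_eq_size _ _ _ _ X) => w sz.
  by rewrite -sz shuf_rec // /nilp; lia.
have yE : cob1 (shuf f (x0 :: X)) (y0 :: Y) = shuf f (x0 :: X) Y -
    (cob (fun w => shuf F X (y0 :: w)) Y +
     (-1) ^+ size X *: cob1 (shuf F (x0 :: X)) Y).
  rewrite cob1E // cY -cobZ -cobD; congr (_ - _).
  apply: (@cob_eq_size _ _ _ _ Y) => w sz.
  by rewrite shuf_rec // /nilp; lia.
(* The two copies of [shuf F X Y] stem from interior faces that cut off the first corner of a grid
   path. They come with opposite signs and cancel. *)
have x1E : cob1 (fun w => shuf F w Y) (x0 :: X) =
    shuf F X Y - cob (fun w => shuf F (x0 :: w) Y) X by rewrite cob1E.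
have y1E : cob1 (shuf F X) (y0 :: Y) =
    shuf F X Y - cob (fun w => shuf F X (y0 :: w)) Y by rewrite cob1E.
rewrite xE yE x1E y1E /= -[size X]prednK // exprS mulN1r /=.
set e := (-1) ^+ _; have e2 : e * e = 1 by rewrite /e -expr2 sqrr_sign.
rewrite !(scalerDr, scalerN, scalerBr, scalerA, mulNr, mulrN, e2, scaleNr,
  opprD, opprK, opprB, scale1r).
rewrite !addrA [LHS](ACl (1*2*7*5*4*8*3*6)) /= subrK.
by [].
Qed.

Lemma shuf_head0 (V : lmodType R) (f : seq (A * B) -> V) x0 x y0 y :
  (forall w, f ((x0, y0) :: w) = 0) -> shuf f (x0 :: x) (y0 :: y) = 0.
Proof.
move=> f0; rewrite /shuf /=; case: ifP => _; first by rewrite ev_seq1 f0 scaler0.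
by rewrite ev_cat !ev_cone !(ev_eq0 _ f0) !scaler0 addr0.
Qed.

Definition cross p (F : seq A -> R) (G : seq B -> R) (s : seq (A * B)) : R :=
  F (map fst (take p.+1 s)) * G (map snd (drop p s)).

End Shuffle.

Definition normalized (A : Type) (F : seq A -> R) :=
  forall s1 a s2, F (s1 ++ [:: a, a & s2]) = 0.

(** A path that moves in the second direction before it has used up [x] repeats a vertex of [x] in
    its front face, where the normalized [F] vanishes. Only the path running through all of [x]
    first survives. *)
Lemma shuf_cross (A B : Type) p (F : seq A -> R) (G : seq B -> R) x y :
  normalized F -> size x = p.+1 -> (0 < size y)%N ->
  shuf (cross p F G : _ -> R^o) x y = F x * G y.
Proof.
case: y => // y0 y + + _; elim: p F x => [|p IH] F [|x0 x] // nF [] szx.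
  case: x szx => // _.
  rewrite shuf1l /cross /= take0 /= -!map_comp; congr (_ * G (_ :: _)).
  exact: map_id.
rewrite shuf_rec ?andbF; last first.
  by rewrite /nilp szx.
rewrite [X in _ + _ *: X](_ : _ = 0) ?scaler0 ?addr0.
  rewrite -(IH (fun w => F (x0 :: w))) //.
  by move=> s1 a s2; exact: (nF (x0 :: s1)).
case: y {IH} => [|y1 y]; first by rewrite shuf_nilr.
apply: shuf_head0 => w; rewrite /cross /= (nF [::] x0); exact: mul0r.
Qed.

End Chains.

(** * Labellings and bounded patterns *)

Lemma cob_eq_sub (T : eqType) (V : zmodType) (f g : seq T -> V) s :
  (forall w, (size w).+1 = size s -> {subset w <= s} -> f w = g w) ->
  cob f s = cob g s.
Proof.
elim: s f g => //= x s IH f g fg; rewrite fg //.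
  congr (_ - _); apply: IH => w ws sw; apply: fg => /=; first by rewrite ws.
  by move=> y; rewrite !inE => /orP[->//|/sw ->]; rewrite orbT.
by move=> y ys; rewrite inE ys orbT.
Qed.

Section BoundedPrimitive.
Variables (R : realFieldType) (T : eqType).

Lemma sum_indicator (E : seq T) (t : T -> R) a : uniq E -> a \in E ->
  \sum_(e <- E) t e * (e == a)%:R = t a.
Proof.
move=> uE aE; rewrite (bigD1_seq a) //= eqxx mulr1 big1 ?addr0 //.
by move=> e /negPf ->; rewrite mulr0.
Qed.

(** Taking coboundaries is multiplication by a fixed finite matrix [D]. Its generalized inverse
    depends only on [E] and [Q] and sends every coboundary bounded by 1 to a primitive bounded by
    the sum of the absolute values of its entries. *)
Lemma bounded_primitive (E : seq T) (Q : seq (T * T * T)) : uniq E ->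
    (forall q, q \in Q -> [/\ q.1.1 \in E, q.1.2 \in E & q.2 \in E]) ->
  exists C : R, forall t : T -> R,
    (forall q, q \in Q -> `|t q.1.1 - t q.1.2 + t q.2| <= 1) ->
    exists h : T -> R, (forall e, `|h e| <= C) /\
      forall q, q \in Q -> h q.1.1 - h q.1.2 + h q.2 = t q.1.1 - t q.1.2 + t q.2.
Proof.
move=> uE; case: E uE => [|e0 E'].
  move=> _ QE; exists 0 => t _; exists (fun=> 0); split=> [e|q /QE[]//].
  by rewrite normr0.
move defE: (e0 :: E') => E uE QE.
case: Q QE => [|q0 Q'].
  by move=> _; exists 0 => t _; exists (fun=> 0); split=> // e; rewrite normr0.
move defQ: (q0 :: Q') => Q QE.
pose D := \matrix_(e < size E, k < size Q) (let q := nth q0 Q k in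
  let x := nth e0 E e in (x == q.1.1)%:R - (x == q.1.2)%:R + (x == q.2)%:R : R).
pose row (t : T -> R) := \row_(e < size E) t (nth e0 E e).
have DE t (k : 'I_(size Q)) : (row t *m D) 0 k =
    let q := nth q0 Q k in t q.1.1 - t q.1.2 + t q.2.
  rewrite mxE; have [a b c] := QE _ (mem_nth q0 (ltn_ord k)).
  rewrite /= -(sum_indicator t uE a) -(sum_indicator t uE b).
  rewrite -(sum_indicator t uE c) -sumrB -big_split /=.
  rewrite (big_nth e0) big_mkord; apply: eq_bigr => e _.
  by rewrite !mxE /=; ring.
pose P := pinvmx D.
exists (\sum_(k < size Q) \sum_(e < size E) `|P k e|) => t tQ.
pose y := row t *m D *m P.
pose h x := if x \in E then
    if insub (index x E) is Some i then y 0 i else 0 else 0.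
have rowh : row h = y.
  apply/rowP => i; rewrite mxE /h mem_nth // index_uniq //.
  by rewrite valK.
have hD q : q \in Q -> h q.1.1 - h q.1.2 + h q.2 = t q.1.1 - t q.1.2 + t q.2.
  move=> qQ; have qi : (index q Q < size Q)%N by rewrite index_mem.
  have := DE h (Ordinal qi); have := DE t (Ordinal qi).
  rewrite /= nth_index // => <- <-; rewrite rowh /y mulmxKpV //.
  exact: submxMl.
exists h; split=> // e.
rewrite /h; case: ifP => _; last by rewrite normr0 !sumr_ge0 // => k _; exact: sumr_ge0.
case: insub => [i|]; last by rewrite normr0 !sumr_ge0 // => k _; exact: sumr_ge0.
rewrite /y mxE (le_trans (ler_norm_sum _ _ _)) // ler_sum // => k _.
rewrite normrM (bigD1 i) //= ler_wpDr ?sumr_ge0 //.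
rewrite ler_piMl // DE; apply: tQ; exact: mem_nth.
Qed.

End BoundedPrimitive.

(** What is needed of the singular simplices of a space. The vertex map [u] need be neither
    injective nor monotone, so degenerate and reordered faces are included. *)
Record simplices := Simplices {
  sx :> eqType;
  sdim : sx -> nat;
  (* the simplex spanned by the vertices u 0, ..., u m; the values of u
     beyond m are junk *)
  ssub : sx -> nat -> (nat -> nat) -> sx;
  sdim_sub : forall s m u, sdim (ssub s m u) = m;
  ssub_sub : forall s m u m' u', (forall k, (k <= m')%N -> (u' k <= m)%N) ->
    ssub (ssub s m u) m' u' = ssub s m' (u \o u');
  eq_ssub : forall s m u u', (forall k, (k <= m)%N -> u k = u' k) ->
    ssub s m u = ssub s m u';
  ssub_id : forall s, ssub s (sdim s) id = s }.

Section PatternCochains.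
Variables (R : realFieldType) (U : simplices).
Implicit Types (a b : U -> R) (s : U) (w : seq nat).

Definition restr a s w : R := a (ssub s (size w).-1 (nth 0%N w)).

Definition scob a s : R := cob (restr a s) (iota 0 (sdim s).+1).

Definition scup p a b s : R :=
  cup p (restr a s) (restr b s) (iota 0 (sdim s).+1).

Lemma restr_sub a s m u w : (0 < size w)%N -> all (fun k => k <= m)%N w ->
  restr a (ssub s m u) w = restr a s (map u w).
Proof.
move=> w0 /allP wm; rewrite /restr ssub_sub => [|k kw].
  rewrite size_map; congr a; apply: eq_ssub => k kw.
  by rewrite /= (nth_map 0%N) //; lia.
by apply/wm/mem_nth; rewrite -ltnS prednK in kw.
Qed.

Lemma restr_scob a s w : (1 < size w)%N ->
  restr (scob a) s w = cob (restr a s) w.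
Proof.
move=> w1; rewrite {1}/restr /scob sdim_sub prednK 1?ltnW //.
have mw : map (nth 0%N w) (iota 0 (size w)) = w by rewrite map_nth_iota0 ?take_size.
rewrite -[in RHS]mw cob_map; apply: cob_eq_sub => v; rewrite size_iota => sv vw.
rewrite restr_sub //; first by rewrite -ltnS sv.
by apply/allP => k /vw; rewrite mem_iota; lia.
Qed.

Lemma restr_scup p a b s w : (p < size w)%N ->
  restr (scup p a b) s w = cup p (restr a s) (restr b s) w.
Proof.
move=> pw; rewrite {1}/restr /scup sdim_sub prednK; last by case: w pw.
have mw : map (nth 0%N w) (iota 0 (size w)) = w by rewrite map_nth_iota0 ?take_size.
rewrite /cup !restr_sub ?map_take ?map_drop ?mw //.
- by rewrite size_drop size_iota subn_gt0.
- by apply/allP => k /mem_drop; rewrite mem_iota; lia.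
- by rewrite size_take size_iota; case: ifP => // _; case: w pw mw.
- by apply/allP => k /mem_take; rewrite mem_iota; lia.
Qed.

Definition face_in (S : seq U) (t : U) := exists2 s, s \in S &
  exists m u, (forall k, (k <= m)%N -> (u k <= sdim s)%N) /\ t = ssub s m u.

Lemma face_in_sub S t m u : face_in S t ->
  (forall k, (k <= m)%N -> (u k <= sdim t)%N) -> face_in S (ssub t m u).
Proof.
case=> s sS [m' [u' [u'm ->]]]; rewrite sdim_sub => um; exists s => //.
exists m, (u' \o u); split; last exact: ssub_sub.
by move=> k /um /u'm.
Qed.

Lemma face_in_self S t : t \in S -> face_in S t.
Proof. by move=> tS; exists t => //; exists (sdim t), id; rewrite ssub_id. Qed.

Definition edge (s : U) i j := ssub s 1 (nth 0%N [:: i; j]).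

Lemma scob_triangle a s u : scob a (ssub s 2 u) =
  a (edge s (u 1%N) (u 2%N)) - a (edge s (u 0%N) (u 2%N))
  + a (edge s (u 0%N) (u 1%N)).
Proof.
rewrite /scob sdim_sub /= subr0 opprB addrA [in RHS]addrAC.
by rewrite !restr_sub.
Qed.

(** A triangle that is a face of a simplex in [S] is given by three of its vertices, so the finite
    lists [E] of edges and [Q] of triangles capture all of them. *)
Lemma scob_primitive (S : seq U) : exists C : R, forall t : U -> R,
  (forall s, face_in S s -> sdim s = 2 -> `|scob t s| <= 1) ->
  exists h : U -> R, (forall s, `|h s| <= C) /\
    forall s, face_in S s -> sdim s = 2 -> scob h s = scob t s.
Proof.
pose I (s : U) := iota 0 (sdim s).+1.
pose I2 s := [seq (i, j) | i <- I s, j <- I s].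
pose I3 s := [seq (ij, k) | ij <- I2 s, k <- I s].
pose E := undup [seq edge s ij.1 ij.2 | s <- S, ij <- I2 s].
pose Q := [seq (edge s x.1.2 x.2, edge s x.1.1 x.2, edge s x.1.1 x.1.2)
  | s <- S, x <- I3 s].
have inI s i : (i \in I s) = (i <= sdim s)%N by rewrite mem_iota.
have inE s i j : s \in S -> i \in I s -> j \in I s -> edge s i j \in E.
  move=> sS iI jI; rewrite mem_undup; apply/allpairsPdep; exists s, (i, j).
  by split=> //; apply/allpairsP; exists (i, j).
have QP q : q \in Q -> exists2 s, s \in S & exists i j k,
    [/\ i \in I s, j \in I s, k \in I s &
    q = (edge s j k, edge s i k, edge s i j)].
  case/allpairsPdep => s [[ij k] [sS /allpairsP[[ij' k'] [/allpairsP[[i j]]]]]].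
  move=> /= [iI jI ->] kI [-> ->] ->.
  by exists s => //; exists i, j, k'.
have [|q /QP[s sS [i [j [k [iI jI kI ->]]]]]|C CP] := @bounded_primitive R U E Q.
- exact: undup_uniq.
- by split; exact: inE.
have QF s i j k : i \in I s -> j \in I s -> k \in I s -> s \in S ->
    face_in S (ssub s 2 (nth 0%N [:: i; j; k])).
  move=> iI jI kI sS; exists s => //; exists 2, (nth 0%N [:: i; j; k]); split=> //.
  by rewrite !inI in iI jI kI; case=> [|[|[|]]].
exists C => t tF; case: (CP t) => [q /QP[s sS [i [j [k [iI jI kI ->]]]]]|h [hC hQ]].
  have := tF _ (QF _ _ _ _ iI jI kI sS); rewrite sdim_sub => /(_ erefl).
  by rewrite scob_triangle.
exists h; split=> // s [s' s'S [m [u [um ->]]]]; rewrite sdim_sub => m2.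
rewrite {m}m2 in um *; rewrite !scob_triangle.
apply: (hQ (_, _, _)); apply/allpairsPdep; exists s', (u 0%N, u 1%N, u 2%N).
split=> //; apply/allpairsP; exists (u 0%N, u 1%N, u 2%N); split=> //=.
  by apply/allpairsP; exists (u 0%N, u 1%N); split=> //=; rewrite inI um.
by rewrite inI um.
Qed.

End PatternCochains.

Section PatternBounded.
Variables (R : realFieldType).

Definition invariant (G : groupType) (V : Type) (f : seq G -> V) :=
  forall g s, f [seq (g * x)%g | x <- s] = f s.

(* A simplicial map to the classifying space of G: the labels of the vertices
   of a simplex matter only up to a common left factor. *)
Definition labelling (G : groupType) (U : simplices) (V : U -> seq G) :=
  (forall s, size (V s) = (sdim s).+1) /\
  forall s m u, (forall k, (k <= m)%N -> (u k <= sdim s)%N) -> exists g : G,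
    V (ssub s m u) = [seq (g * nth 1%g (V s) (u k))%g | k <- iota 0 m.+1].

(* Over finitely many simplices, F becomes uniformly bounded after subtracting a
   coboundary that may depend on the labelling. *)
Definition pattern_bounded (G : groupType) p (F : seq G -> R) :=
  forall (U : simplices) (S : seq U), exists C : R, forall V : U -> seq G,
  labelling V -> exists psi chi : U -> R, forall s, face_in S s -> sdim s = p ->
  `|psi s| <= C /\ F (V s) = psi s + scob chi s.

Lemma bounded_pattern_bounded (G : groupType) p (F : seq G -> R) C :
  (forall s, `|F s| <= C) -> pattern_bounded p F.
Proof.
move=> FC U S; exists C => V _; exists (F \o V), (fun=> 0) => s _ _.
split=> //=; rewrite /scob (@cob_eq_sub _ _ _ (fun=> 0)) ?cob0 ?addr0 //.
Qed.

Lemma restr_label (G : groupType) (U : simplices) (V : U -> seq G)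
    (F : seq G -> R) s w :
  labelling V -> invariant F -> (0 < size w)%N ->
  all (fun k => k <= sdim s)%N w ->
  restr (F \o V) s w = F (map (nth 1%g (V s)) w).
Proof.
move=> [_ lV] iF w0 /allP ws; rewrite /restr /=.
case: (lV s (size w).-1 (nth 0%N w)) => [k kw|g ->].
  by apply/ws/mem_nth; rewrite -ltnS prednK in kw.
rewrite (map_comp (fun k => g * nth 1%g (V s) k)%g) map_comp iF.
by rewrite prednK // map_nth_iota0 ?take_size.
Qed.

Lemma restr_label_cob (G : groupType) (U : simplices) (V : U -> seq G)
    (F : seq G -> R) s w :
  labelling V -> invariant F -> (1 < size w)%N ->
  all (fun k => k <= sdim s)%N w ->
  cob (restr (F \o V) s) w = cob F (map (nth 1%g (V s)) w).
Proof.
move=> lV iF w1 /allP ws; rewrite cob_map; apply: cob_eq_sub => v vw sv.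
by rewrite restr_label //; [rewrite -ltnS vw | apply/allP => k /sv /ws].
Qed.

Lemma labelling_fst (G H : groupType) (U : simplices)
    (V : U -> seq (G * H)%type) :
  labelling V -> labelling (fun s => map fst (V s)).
Proof.
move=> [V1 V2]; split=> [s|s m u um]; first by rewrite size_map.
case: (V2 s m u um) => g ->; exists g.1; rewrite -map_comp.
apply/eq_in_map => k; rewrite mem_iota => km /=.
by rewrite (nth_map 1%g) // V1 ltnS um.
Qed.

Lemma labelling_snd (G H : groupType) (U : simplices)
    (V : U -> seq (G * H)%type) :
  labelling V -> labelling (fun s => map snd (V s)).
Proof.
move=> [V1 V2]; split=> [s|s m u um]; first by rewrite size_map.
case: (V2 s m u um) => g ->; exists g.2; rewrite -map_comp.
apply/eq_in_map => k; rewrite mem_iota => km /=.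
by rewrite (nth_map 1%g) // V1 ltnS um.
Qed.

Definition cocycle (A : Type) p (F : seq A -> R) :=
  forall s, size s = p.+2 -> cob F s = 0.

(** Write F = x + dc and E = y + de with x and y bounded. Since E is a cocycle and dx = 0, the cup
    product F E is x y plus the coboundary of c E + (-1)^p x e, and x y is bounded by [C * D]. *)
Lemma cross_pattern_bounded (G H : groupType) p q (F : seq G -> R)
    (E : seq H -> R) :
  (0 < p)%N -> (0 < q)%N -> invariant F -> invariant E ->
  cocycle p F -> cocycle q E -> pattern_bounded p F -> pattern_bounded q E ->
  pattern_bounded (p + q) (cross p F E).
Proof.
move=> p0 q0 iF iE cF cE bF bE U S.
have [C CF] := bF U S; have [D DE] := bE U S; exists (C * D) => V lV.
have lV1 := labelling_fst lV; have lV2 := labelling_snd lV.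
have [x [c xc]] := CF _ lV1; have [y [e ye]] := DE _ lV2.
pose f1 : U -> R := F \o (fun s => map fst (V s)).
pose f2 : U -> R := E \o (fun s => map snd (V s)).
exists (scup p x y), (fun s => scup p.-1 c f2 s + (-1) ^+ p * scup p x e s).
move=> s sS sd; set w := iota 0 (sdim s).+1.
have szw : size w = (p + q).+1 by rewrite size_iota sd.
have sw v : {subset v <= w} -> all (fun k => k <= sdim s)%N v.
  by move=> vw; apply/allP => k /vw; rewrite mem_iota.
have fv v n : size v = n.+1 -> {subset v <= w} ->
    face_in S (ssub s (size v).-1 (nth 0%N v)).
  move=> sv /sw /allP vw; apply: face_in_sub => // k; rewrite sv => kp.
  by apply/vw/mem_nth; rewrite sv ltnS.
have xE v : size v = p.+1 -> {subset v <= w} ->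
    restr f1 s v = restr x s v + cob (restr c s) v.
  move=> sv vw; rewrite -restr_scob ?sv //.
  by apply: (xc _ (fv _ _ sv vw) _).2; rewrite sdim_sub sv.
have yE v : size v = q.+1 -> {subset v <= w} ->
    restr f2 s v = restr y s v + cob (restr e s) v.
  move=> sv vw; rewrite -restr_scob ?sv //.
  by apply: (ye _ (fv _ _ sv vw) _).2; rewrite sdim_sub sv.
have st : size (take p.+1 w) = p.+1 by rewrite size_takel // szw ltnS leq_addr.
have sr : size (drop p w) = q.+1 by rewrite size_drop szw -addnS addKn.
have tw n : {subset take n w <= w} by move=> k /mem_take.
have dw n : {subset drop n w <= w} by move=> k /mem_drop.
split.
  rewrite /scup /cup normrM -/w; apply: ler_pM => //.
    by apply: (xc _ (fv _ _ st (tw _)) _).1; rewrite sdim_sub st.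
  by apply: (ye _ (fv _ _ sr (dw _)) _).1; rewrite sdim_sub sr.
have mV1 : map (nth 1%g (map fst (V s))) w = map fst (V s).
  by rewrite map_nth_iota0 ?size_map ?lV.1 // -lV.1 -(size_map fst) take_size.
have mV2 : map (nth 1%g (map snd (V s))) w = map snd (V s).
  by rewrite map_nth_iota0 ?size_map ?lV.1 // -lV.1 -(size_map snd) take_size.
have -> : cross p F E (V s) = cup p (restr f1 s) (restr f2 s) w.
  rewrite /cross /cup restr_label ?st ?(sw _ (tw _)) //.
  rewrite restr_label ?sr ?(sw _ (dw _)) //.
  by congr (F _ * E _); [rewrite !map_take mV1 | rewrite !map_drop mV2].
rewrite /scob -/w (@cob_eq_sub _ _ _ (fun v => cup p.-1 (restr c s) (restr f2 s) v +
    (-1) ^+ p * cup p (restr x s) (restr e s) v)); last first.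
  move=> v; rewrite szw => -[sv] vw.
  by rewrite -!restr_scup ?sv //; lia.
transitivity (scup p x y s + (cob (cup p.-1 (restr c s) (restr f2 s)) w +
    (-1) ^+ p * cob (cup p (restr x s) (restr e s)) w)); last first.
  by rewrite cobD; congr (_ + (_ + _)); rewrite (@cobZ _ R R^o).
rewrite !cob_cup ?szw; [|lia..].
have c0 : cob (restr f2 s) (drop p.-1 w) = 0.
  rewrite restr_label_cob // ?size_drop ?szw; [|lia|exact: sw (dw _)].
  by apply: cE; rewrite size_map size_drop szw; lia.
have x0 : cob (restr x s) (take p.+2 w) = 0.
  have st2 : size (take p.+2 w) = p.+2 by rewrite size_takel // szw; lia.
  rewrite (@cob_eq_sub _ _ _ (fun v => restr f1 s v - cob (restr c s) v)).
    rewrite cobB cob_cob subr0 restr_label_cob ?st2 ?(sw _ (tw _)) //.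
    by rewrite cF // size_map.
  by move=> v; rewrite st2 => -[sv] vw; rewrite xE // ?addrK // => k /vw /tw.
rewrite prednK // /cup c0 x0 xE // yE //.
have s1 : (-1) ^+ p * (-1) ^+ p = 1 :> R by rewrite -expr2 sqrr_sign.
rewrite mulr0 mul0r mulr0 addr0 add0r mulrA s1 mul1r /scup /cup -/w; ring.
Qed.

(** Choose bounded h1 and h2 with dh1 = dt1 and dh2 = dt2 on [S]. Then t1 dt2 = h1 dh2 + (t1 - h1)
    dh2, where the first term is bounded and the second is minus the coboundary of (t1 - h1) h2,
    because t1 - h1 is closed. *)
Lemma secondary_pattern_bounded (G : groupType) (t1 t2 K : seq G -> R) C :
  invariant t1 -> invariant t2 ->
  (forall s, size s = 3 -> `|cob t1 s| <= 1) ->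
  (forall s, size s = 3 -> `|cob t2 s| <= 1) ->
  (forall s, `|K s| <= C) ->
  pattern_bounded 3 (fun s => cup 1 t1 (cob t2) s - K s).
Proof.
move=> i1 i2 b1 b2 bK U S; have [D hD] := scob_primitive R S.
exists (D + C) => V lV.
pose f1 : U -> R := t1 \o V; pose f2 : U -> R := t2 \o V.
have prim (t : seq G -> R) : invariant t ->
    (forall s, size s = 3 -> `|cob t s| <= 1) ->
    exists h : U -> R, (forall s, `|h s| <= D) /\ forall s, face_in S s ->
      sdim s = 2 -> scob h s = scob (t \o V) s.
  move=> it bt; apply: hD => s sS s2.
  rewrite /scob restr_label_cob ?s2 //; first exact: bt.

have [h1 [h1D h1E]] := prim _ i1 b1; have [h2 [h2D h2E]] := prim _ i2 b2.
exists (fun s => scup 1 h1 (scob h2) s - K (V s)).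
exists (fun s => - scup 1 (fun s => f1 s - h1 s) h2 s).
move=> s sS sd; set w := iota 0 (sdim s).+1.
have szw : size w = 4 by rewrite size_iota sd.
have sw v : {subset v <= w} -> all (fun k => k <= sdim s)%N v.
  by move=> vw; apply/allP => k /vw; rewrite mem_iota.
have fv v : size v = 3 -> {subset v <= w} ->
    face_in S (ssub s (size v).-1 (nth 0%N v)).
  move=> sv /sw /allP vw; apply: face_in_sub => // k; rewrite sv => kp.
  by apply/vw/mem_nth; rewrite sv ltnS.
have mV : map (nth 1%g (V s)) w = V s.
  by rewrite map_nth_iota0 ?lV.1 // -lV.1 take_size.
have tw n : {subset take n w <= w} by move=> k /mem_take.
have dw n : {subset drop n w <= w} by move=> k /mem_drop.
have sdr : size (drop 1 w) = 3 by rewrite size_drop szw.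
have st : size (take 3 w) = 3 by rewrite size_takel // szw.
have E2 : cob (restr h2 s) (drop 1 w) = cob t2 (drop 1 (V s)).
  rewrite -restr_scob ?sdr //; transitivity (restr (scob f2) s (drop 1 w)).
    by apply: h2E (fv _ sdr (dw _)) _; rewrite sdim_sub sdr.
  by rewrite restr_scob ?sdr // restr_label_cob ?sdr ?(sw _ (dw _)) // map_drop mV.
have E1 : cob (restr (fun s => f1 s - h1 s) s) (take 3 w) = 0.
  rewrite (cobB (restr f1 s) (restr h1 s)) -!restr_scob ?st //.
  apply/eqP; rewrite subr_eq0; apply/eqP/esym.
  by apply: h1E (fv _ st (tw _)) _; rewrite sdim_sub st.
split.
  rewrite (le_trans (ler_normB _ _)) // lerD // /scup /cup -/w normrM.
  rewrite -[D]mulr1 ler_pM //; first exact: h1D.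
  rewrite restr_scob ?sdr // E2 b2 //.
  by rewrite size_drop lV.1 sd.
have -> : scob (fun s => - scup 1 (fun s => f1 s - h1 s) h2 s) s =
    restr (fun s => f1 s - h1 s) s (take 2 w) * cob (restr h2 s) (drop 1 w).
  rewrite /scob -/w; transitivity (cob (fun v =>
      - cup 1 (restr (fun s => f1 s - h1 s) s) (restr h2 s) v) w).
    apply: cob_eq_sub => v; rewrite szw => -[sv] vw.
    by rewrite -restr_scup ?sv.
  by rewrite cobN cob_cup ?szw // /cup E1; ring.
rewrite {1}/cup -E2 /scup /cup -/w restr_scob ?sdr //.
have -> : t1 (take 2 (V s)) = restr f1 s (take 2 w).
  by rewrite restr_label ?(sw _ (tw _)) ?size_takel ?szw // map_take mV.
have -> : restr (fun s => f1 s - h1 s) s (take 2 w) =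
  restr f1 s (take 2 w) - restr h1 s (take 2 w) by [].
ring.
Qed.

End PatternBounded.

(** * Cross products of chains, and classes detected by cocycles *)

Section CrossProduct.
Variable R : realFieldType.

Lemma ev_flatten (A : Type) (V : lmodType R) (f : A -> V) (l : seq (chain R A)) :
  ev f (flatten l) = \sum_(c <- l) ev f c.
Proof.
elim: l => [|c l IH] /=; first by rewrite ev_nil big_nil.
by rewrite ev_cat big_cons IH.
Qed.

Lemma cnorm_flatten (A : Type) (l : seq (chain R A)) :
  cnorm (flatten l) = \sum_(c <- l) cnorm c.
Proof.
elim: l => [|c l IH] /=; first by rewrite /cnorm !big_nil.
by rewrite cnorm_cat big_cons IH.
Qed.

Definition crossc (A B : Type) (a : chain R (seq A)) (b : chain R (seq B)) :
    chain R (seq (A * B)) :=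
  flatten [seq cscale x.1 (flatten [seq cscale y.1 (shuffle R x.2 y.2) | y <- b])
          | x <- a].

Lemma ev_crossc (A B : Type) (V : lmodType R) (f : seq (A * B) -> V) a b :
  ev f (crossc a b) = ev (fun x => ev (shuf f x) b) a.
Proof.
rewrite ev_flatten big_map; apply: eq_bigr => x _; rewrite ev_scale; congr (_ *: _).
by rewrite ev_flatten big_map; apply: eq_bigr => y _; rewrite ev_scale.
Qed.

Lemma ev_swap (A B : Type) (V : lmodType R) (f : A -> B -> V)
    (a : chain R A) (b : chain R B) :
  ev (fun x => ev (f x) b) a = ev (fun y => ev (f^~ y) a) b.
Proof.
rewrite /ev; under eq_bigr do rewrite scaler_sumr.
rewrite exchange_big; apply: eq_bigr => y _; rewrite scaler_sumr.
by apply: eq_bigr => x _; rewrite !scalerA mulrC.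
Qed.

Lemma of_size_crossc (A B : Type) m n (a : chain R (seq A)) (b : chain R (seq B)) :
  of_size m a -> of_size n b -> of_size (m + n).-1 (crossc a b).
Proof.
move=> am bn; rewrite /crossc; elim: a am => [|x a IH] //= /andP[/eqP xm /IH{}IH].
rewrite of_size_cat of_size_scale IH andbT -xm.
elim: b bn {IH} => [|y b IH] //= /andP[/eqP yn /IH{}IH].
by rewrite of_size_cat of_size_scale IH andbT -yn size_shuffle.
Qed.

Lemma cnorm_crossc (A B : Type) m n (a : chain R (seq A)) (b : chain R (seq B)) :
  of_size m a -> of_size n b ->
  cnorm (crossc a b) <= cnorm a * cnorm b * 2 ^+ (m + n).
Proof.
move=> am bn; rewrite /crossc cnorm_flatten big_map [cnorm a]/cnorm -mulrA.
rewrite mulr_suml; elim: a am => [|x a IH] /=; first by rewrite !big_nil.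
case/andP=> /eqP xm /IH{}IH; rewrite !big_cons lerD // cnorm_scale.
rewrite ler_wpM2l // cnorm_flatten big_map mulr_suml -xm.
elim: b bn {IH} => [|y b IH] /=; first by rewrite !big_nil.
case/andP=> /eqP yn /IH{}IH; rewrite !big_cons lerD // cnorm_scale.
by rewrite ler_wpM2l // -yn cnorm_shuffle.
Qed.

Lemma shuf_map (A B C D : Type) (V : lmodType R) (a : A -> C) (b : B -> D)
    (f : seq (C * D) -> V) x y :
  shuf f (map a x) (map b y) = shuf (fun w => f (map (fun z => (a z.1, b z.2)) w)) x y.
Proof.
have [n] := ubnP (size x + size y)%N; elim: n f x y => // n IH f [|x0 x] [|y0 y];
  rewrite ?shuf_nill ?shuf_nilr // => szn.
rewrite [map a _]/= [map b _]/=; have [/andP[/nilP-> /nilP->]|nn] := boolP (nilp x && nilp y).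
  by rewrite !shuf1l.
have nn' : ~~ (nilp (map a x) && nilp (map b y)) by rewrite /nilp !size_map.
rewrite !shuf_rec // size_map -[a x0 :: _]/(map a (x0 :: x)).
by rewrite -[b y0 :: _]/(map b (y0 :: y)) !IH //=; move: szn => /=; lia.
Qed.

Lemma shuf_cob (A B : Type) (V : lmodType R) (f : seq (A * B) -> V) x y :
  (1 < size x)%N -> (1 < size y)%N ->
  shuf (cob f) x y =
    cob (fun w => shuf f w y) x + (-1) ^+ (size x).-1 *: cob (shuf f x) y.
Proof.
move=> x1 y1; rewrite -(cob1E (shuf f x)) // -(cob1E (fun w => shuf f w y)) //.
rewrite -shuf_cob1 ?(ltnW x1) ?(ltnW y1) //.
by apply: (eq_ev_size (size_shuffle R x y)) => s sz; rewrite cob1E // sz; lia.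
Qed.

End CrossProduct.

Section Classes.
Variable R : realFieldType.

(** A cycle in the coinvariants of the bar complex, tested by all invariant functions instead of
    forming the quotient. The test that matters for spaces is [step_chain], with values in singular
    chains. *)
Definition cycle (G : groupType) (a : chain R (seq G)) :=
  forall (V : lmodType R) (f : seq G -> V), invariant f -> ev (cob f) a = 0.

Record detected (G : groupType) p (F : seq G -> R) (a : chain R (seq G)) := {
  detected_inv : invariant F;
  detected_cocycle : cocycle p F;
  detected_norm : normalized F;
  detected_pb : pattern_bounded p F;
  detected_size : of_size p.+1 a;
  detected_cycle : cycle a;
  detected_neq0 : ev (F : _ -> R^o) a != 0 }.

Definition l1_null (G : groupType) p (a : chain R (seq G)) :=
  forall e : R, 0 < e -> exists a' b : chain R (seq G),
  [/\ of_size p.+1 a', of_size p.+2 b, cnorm a' <= e &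
      forall (V : lmodType R) (f : seq G -> V), invariant f ->
        ev f a = ev f a' + ev (cob f) b].

Lemma invariant_cob (G : groupType) (V : zmodType) (f : seq G -> V) :
  invariant f -> invariant (cob f).
Proof. by move=> fi g s; rewrite cob_map; apply: eq_cob => w; rewrite fi. Qed.

Lemma shuf_invl (G H : groupType) (V : lmodType R) (f : seq (G * H)%type -> V) y :
  invariant f -> invariant (fun x => shuf f x y).
Proof.
move=> fi g s; rewrite -{1}[y]map_id shuf_map; apply: eq_ev => w.
rewrite -[RHS](fi (g, 1%g)); congr f; apply: eq_map => -[a b].
by apply/eqP; rewrite xpair_eqE /= mul1g !eqxx.
Qed.

Lemma shuf_invr (G H : groupType) (V : lmodType R) (f : seq (G * H)%type -> V) x :
  invariant f -> invariant (shuf f x).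
Proof.
move=> fi g s; rewrite -{1}[x]map_id shuf_map; apply: eq_ev => w.
rewrite -[RHS](fi (1%g, g)); congr f; apply: eq_map => -[a b].
by apply/eqP; rewrite xpair_eqE /= mul1g !eqxx.
Qed.

Lemma ev_inv (G : groupType) (A : Type) (V : lmodType R) (f : seq G -> A -> V) l :
  (forall x, invariant (f^~ x)) -> invariant (fun s => ev (f s) l).
Proof. by move=> fi g s; apply: eq_ev => x; rewrite fi. Qed.

Lemma cross_detected (G H : groupType) p q (F : seq G -> R) (E : seq H -> R) a b :
  (0 < p)%N -> (0 < q)%N -> detected p F a -> detected q E b ->
  detected (p + q) (cross p F E) (crossc a b).
Proof.
move=> p0 q0 [iF cF nF pF sa ca Fa] [iE cE nE pE sb cb Eb]; split.
- move=> [g h] s; rewrite /cross -map_take -map_drop.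
  by congr (_ * _); [rewrite -[RHS](iF g)|rewrite -[RHS](iE h)]; rewrite -!map_comp.
- move=> s sz; rewrite (@eq_cob _ _ _ (cup p (F \o map fst) (E \o map snd))) //.
  rewrite cob_cup ?sz; last by lia.
  rewrite /cup.
  have -> : cob (F \o map fst) (take p.+2 s) = 0.
    by rewrite -(cob_map fst F) cF // size_map size_takel // sz; lia.
  have -> : cob (E \o map snd) (drop p s) = 0.
    by rewrite -(cob_map snd E) cE // size_map size_drop sz; lia.
  by rewrite mul0r !mulr0 addr0.
- move=> s1 [x y] s2; rewrite /cross; have [s1p|ps1] := ltnP (size s1) p.
    rewrite take_cat ltnNge (leqW (ltnW s1p)) /=.
    rewrite subSn ?(ltnW s1p) //= -(subnSK s1p) /= map_cat /= nF; exact: mul0r.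
  rewrite drop_cat; case: ltnP => [|_].
    by rewrite map_cat /= nE mulr0.
  rewrite (_ : (p - size s1)%N = 0); last by apply/eqP; rewrite subn_eq0.
  by rewrite /= (nE [::]) mulr0.
- exact: cross_pattern_bounded.
- by rewrite -[(p + q).+1]/(p.+1 + q).+1.-1 -addnS; exact: of_size_crossc.
- move=> V f fi; rewrite ev_crossc.
  rewrite (@eq_ev_size _ _ _ _ (fun x => cob (fun w => ev (shuf f w) b) x) _ _ sa).
    by apply: ca; apply: ev_inv => y; exact: shuf_invl.
  move=> x sx; rewrite cob_ev.
  rewrite (@eq_ev_size _ _ _ _ (fun y => cob (fun w => shuf f w y) x +
     (-1) ^+ (size x).-1 *: cob (shuf f x) y) _ _ sb).
    by rewrite evD evZ cb ?scaler0 ?addr0 //; exact: shuf_invr.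
  by move=> y sy; rewrite shuf_cob ?sx ?sy.
- rewrite ev_crossc (@eq_ev_size _ _ _ _ (fun x => F x *: (ev (E : _ -> R^o) b : R^o)) _ _ sa).
    rewrite (_ : ev _ a = ev (F : _ -> R^o) a * ev (E : _ -> R^o) b) ?mulf_neq0 //.
    rewrite /ev mulr_suml; apply: eq_bigr => x _; rewrite /GRing.scale /=.
    by rewrite mulrA.
  move=> x sx; rewrite -evZ; apply: (eq_ev_size sb) => y sy.
  by rewrite shuf_cross // sy.
Qed.

Lemma crossc_l1_null (G H : groupType) p q (a : chain R (seq G))
    (b : chain R (seq H)) :
  (0 < p)%N -> (0 < q)%N -> of_size q.+1 b -> cycle b -> l1_null p a ->
  l1_null (p + q) (crossc a b).
Proof.
move=> p0 q0 sb cb na e e0; pose M : R := cnorm b * 2 ^+ (p.+1 + q.+1) + 1.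
have M0 : 0 < M by rewrite ltr_wpDl // mulr_ge0 ?cnorm_ge0 // exprn_ge0.
have [a' [c [sa' sc na' E]]] := na (e / M) (divr_gt0 e0 M0).
exists (crossc a' b), (crossc c b); split.
- by rewrite -[(p + q).+1]/(p.+1 + q).+1.-1 -addnS; exact: of_size_crossc.
- by rewrite -[(p + q).+2]/(p.+2 + q).+1.-1 -addnS; exact: of_size_crossc.
- apply: le_trans (cnorm_crossc sa' sb) _.
  rewrite -mulrA (@le_trans _ _ (cnorm a' * M)) //.
    by rewrite ler_wpM2l ?cnorm_ge0 // lerDl.
  by rewrite -ler_pdivlMr.
move=> V f fi; rewrite !ev_crossc E; last first.
  by apply: ev_inv => y; exact: shuf_invl.
congr (_ + _); apply: (eq_ev_size sc) => x sx; rewrite cob_ev.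
rewrite [RHS](@eq_ev_size _ _ _ _ (fun y => cob (fun w => shuf f w y) x +
     (-1) ^+ (size x).-1 *: cob (shuf f x) y) _ _ sb).
  by rewrite evD evZ cb ?scaler0 ?addr0 //; exact: shuf_invr.
by move=> y sy; rewrite shuf_cob ?sx ?sy.
Qed.

Definition detectable p := exists (G : groupType) (F : seq G -> R) a, detected p F a.

Definition null_detectable p :=
  exists (G : groupType) (F : seq G -> R) a, detected p F a /\ l1_null p a.

Lemma null_detectable_cross p q : (0 < p)%N -> (0 < q)%N ->
  null_detectable p -> detectable q -> null_detectable (p + q).
Proof.
move=> p0 q0 [G [F [a [Fa na]]]] [H [E [b Eb]]].
exists (G * H)%type, (cross p F E), (crossc a b); split.
  exact: cross_detected.
by case: Eb => *; exact: crossc_l1_null.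
Qed.

Lemma null_detectable_dims d : detectable 2 -> null_detectable 3 ->
  d = 3 \/ (5 <= d)%N -> null_detectable d.
Proof.
move=> D2 N3; have N n m : null_detectable n.+1 -> null_detectable (n.+1 + m.*2).
  move=> Nn; elim: m => [|m IH]; first by rewrite addn0.
  by rewrite doubleS -addn2 addnA; exact: null_detectable_cross.
case=> [->//|d5]; have [od|ed] := boolP (odd d).
  by have := N 2 (d - 3)./2 N3; congr null_detectable; move: od d5; lia.
have N6 : null_detectable 6.
  apply: (@null_detectable_cross 3 3) => //.
  by case: N3 => [G [F [a [Fa _]]]]; exists G, F, a.
by have := N 5 (d - 6)./2 N6; congr null_detectable; move: ed d5; lia.
Qed.

End Classes.

(** * Tree cocycles on SL2 *)

(* [Some (negative, odd)] is the class of a nonzero element modulo the positive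
   elements of even degree, and [None] is the class of 0. *)
Definition sclass := option (bool * bool).

Definition smul (a b : sclass) : sclass :=
  if (a, b) is (Some (s, p), Some (s', p')) then Some (s (+) s', p (+) p') else None.

Definition sopp (a : sclass) : sclass :=
  if a is Some (s, p) then Some (~~ s, p) else None.

Definition sall (P : sclass -> bool) :=
  all P [:: None; Some (false, false); Some (true, false);
            Some (false, true); Some (true, true)].

Lemma sallP (P : sclass -> bool) : sall P -> forall a, P a.
Proof. by case/and5P => ? ? ? ? /andP[? _] [[[] []]|]. Qed.

(** If [a_ij] is the class of the determinant of vectors v_i and v_j, this is the class of the
    cyclic product of the three determinants. Rescaling a vector changes the product by a square,
    which is positive of even degree, so only the three lines matter. The sign is the orientation of
    the ideal triangle, the parity that of its centre. *)
Definition tri (a01 a12 a02 : sclass) := smul (smul a01 a12) (sopp a02).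

(* The centres of the four triples of a quadruple in a planar tree: one of the
   three ways of splitting the quadruple into pairs. *)
Definition four_point (t012 t013 t023 t123 : sclass) :=
  [|| (t012 == t123) && (t013 == t023), (t012 == t013) && (t023 == t123) |
      (t012 == sopp t023) && (t013 == sopp t123)].

Definition par (a : sclass) : bool := if a is Some (_, p) then p else false.

Definition mixed (t012 t013 t023 t123 : sclass) :=
  [&& t012 != None, t013 != None, t023 != None, t123 != None &
   ~~ [&& par t012 == par t013, par t012 == par t023 & par t012 == par t123]].

(** The twelve implications say that coincidence of lines is an equivalence relation. The last
    premise is the Pluecker relation a - b + c = 0 at the level of classes: two terms dominate and
    cancel. What is left is a finite check. *)
Lemma four_point_tri a01 a02 a03 a12 a13 a23 :
  let a := smul a01 a23 in let b := smul a02 a13 in let c := smul a03 a12 in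
  (a01 == None) && (a02 == None) ==> (a12 == None) ->
  (a01 == None) && (a03 == None) ==> (a13 == None) ->
  (a02 == None) && (a03 == None) ==> (a23 == None) ->
  (a12 == None) && (a13 == None) ==> (a23 == None) ->
  (a01 == None) && (a12 == None) ==> (a02 == None) ->
  (a01 == None) && (a13 == None) ==> (a03 == None) ->
  (a02 == None) && (a23 == None) ==> (a03 == None) ->
  (a12 == None) && (a23 == None) ==> (a13 == None) ->
  (a02 == None) && (a12 == None) ==> (a01 == None) ->
  (a03 == None) && (a13 == None) ==> (a01 == None) ->
  (a03 == None) && (a23 == None) ==> (a02 == None) ->
  (a13 == None) && (a23 == None) ==> (a12 == None) ->
  [|| (a != None) && (a == b), (b != None) && (b == c),
      (c != None) && (c == sopp a) | [&& a == None, b == None & c == None]] ->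
  four_point (tri a01 a12 a02) (tri a01 a13 a03) (tri a02 a23 a03) (tri a12 a23 a13).
Proof.
pose P a01 a02 a03 a12 a13 a23 :=
  let a := smul a01 a23 in let b := smul a02 a13 in let c := smul a03 a12 in
  ((a01 == None) && (a02 == None) ==> (a12 == None)) ==>
  ((a01 == None) && (a03 == None) ==> (a13 == None)) ==>
  ((a02 == None) && (a03 == None) ==> (a23 == None)) ==>
  ((a12 == None) && (a13 == None) ==> (a23 == None)) ==>
  ((a01 == None) && (a12 == None) ==> (a02 == None)) ==>
  ((a01 == None) && (a13 == None) ==> (a03 == None)) ==>
  ((a02 == None) && (a23 == None) ==> (a03 == None)) ==>
  ((a12 == None) && (a23 == None) ==> (a13 == None)) ==>
  ((a02 == None) && (a12 == None) ==> (a01 == None)) ==>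
  ((a03 == None) && (a13 == None) ==> (a01 == None)) ==>
  ((a03 == None) && (a23 == None) ==> (a02 == None)) ==>
  ((a13 == None) && (a23 == None) ==> (a12 == None)) ==>
  [|| (a != None) && (a == b), (b != None) && (b == c),
      (c != None) && (c == sopp a) | [&& a == None, b == None & c == None]] ==>
  four_point (tri a01 a12 a02) (tri a01 a13 a03) (tri a02 a23 a03) (tri a12 a23 a13).
have : sall (fun a01 => sall (fun a02 => sall (fun a03 => sall (fun a12 =>
  sall (fun a13 => sall (P a01 a02 a03 a12 a13)))))) by vm_compute.
move=> /sallP/(_ a01)/sallP/(_ a02)/sallP/(_ a03)/sallP/(_ a12)/sallP/(_ a13)/sallP/(_ a23).
rewrite /P /=; do 13![move=> /[swap] H; rewrite {}H /=].
by [].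
Qed.

Definition ecoef (a : sclass) : int :=
  if a is Some (s, false) then (-1) ^+ s else 0.
Definition ocoef (a : sclass) : int :=
  if a is Some (s, true) then (-1) ^+ s else 0.

Definition smed (a b : int) : int := if a == b then a else 0.

(** On a quadruple satisfying [four_point] this is nonzero only for the split 01|23 with an even
    centre on the side of 01 and an odd one on the side of 23. It is then the product of the two
    orientations. *)
Definition tree_kappa (t012 t013 t123 : sclass) : int :=
  ocoef t123 * smed (ecoef t012) (ecoef t013).

(** The four-point conditions alone do not suffice. Five points in cyclic order whose consecutive
    triples have even centres and whose other triples have odd ones, all positively oriented,
    satisfy them and violate the identity. All five quadruples are then mixed, which is excluded
    here and ruled out by [no_pentagon]. *)
Lemma tree_kappa_cob t012 t013 t014 t023 t024 t034 t123 t124 t134 t234 :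
  four_point t012 t013 t023 t123 -> four_point t012 t014 t024 t124 ->
  four_point t013 t014 t034 t134 -> four_point t023 t024 t034 t234 ->
  four_point t123 t124 t134 t234 ->
  ~~ [&& mixed t012 t013 t023 t123, mixed t012 t014 t024 t124,
     mixed t013 t014 t034 t134, mixed t023 t024 t034 t234 &
     mixed t123 t124 t134 t234] ->
  tree_kappa t123 t124 t234 - tree_kappa t023 t024 t234 +
  tree_kappa t013 t014 t134 - tree_kappa t012 t014 t124 +
  tree_kappa t012 t013 t123 = ecoef t012 * ocoef t234.
Proof.
pose P t012 t013 t014 t023 t024 t034 t123 t124 t134 t234 :=
  if four_point t023 t024 t034 t234 then if four_point t123 t124 t134 t234 then
  [|| [&& mixed t012 t013 t023 t123, mixed t012 t014 t024 t124,
     mixed t013 t014 t034 t134, mixed t023 t024 t034 t234 &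
     mixed t123 t124 t134 t234] |
  tree_kappa t123 t124 t234 - tree_kappa t023 t024 t234 +
  tree_kappa t013 t014 t134 - tree_kappa t012 t014 t124 +
  tree_kappa t012 t013 t123 == ecoef t012 * ocoef t234] else true else true.
(* Each premise is tested as soon as its classes are fixed, which prunes the enumeration of 5^10
   cases. *)
have : sall (fun t012 => sall (fun t013 => sall (fun t023 => sall (fun t123 =>
  if four_point t012 t013 t023 t123 then
  sall (fun t014 => sall (fun t024 => sall (fun t124 =>
  if four_point t012 t014 t024 t124 then
  sall (fun t034 => sall (fun t134 => if four_point t013 t014 t034 t134 then
    sall (P t012 t013 t014 t023 t024 t034 t123 t124 t134) else true))
  else true))) else true)))).
  by vm_compute.
move=> /sallP/(_ t012)/sallP/(_ t013)/sallP/(_ t023)/sallP/(_ t123) + f1 f2 f3 f4 f5 nm.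
rewrite f1 => /sallP/(_ t014)/sallP/(_ t024)/sallP/(_ t124); rewrite f2.
move=> /sallP/(_ t034)/sallP/(_ t134); rewrite f3 => /sallP/(_ t234).
by rewrite /P f4 f5 (negPf nm) => /eqP.
Qed.

Lemma ecoefN t : ecoef (sopp t) = - ecoef t.
Proof. by case: t => [[[] []]|]. Qed.

Lemma ocoefN t : ocoef (sopp t) = - ocoef t.
Proof. by case: t => [[[] []]|]. Qed.

Lemma four_point_ecoef t012 t013 t023 t123 : four_point t012 t013 t023 t123 ->
  ecoef t123 - ecoef t023 + ecoef t013 - ecoef t012 = 0.
Proof. by case/or3P => /andP[/eqP -> /eqP ->]; rewrite ?ecoefN; ring. Qed.

Lemma four_point_ocoef t012 t013 t023 t123 : four_point t012 t013 t023 t123 ->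
  ocoef t123 - ocoef t023 + ocoef t013 - ocoef t012 = 0.
Proof. by case/or3P => /andP[/eqP -> /eqP ->]; rewrite ?ocoefN; ring. Qed.

Lemma ecoef_le1 t : `|ecoef t| <= 1.
Proof. by case: t => [[[] []]|]. Qed.

Lemma ocoef_le1 t : `|ocoef t| <= 1.
Proof. by case: t => [[[] []]|]. Qed.

Lemma tree_kappa_le1 t t' t'' : `|tree_kappa t t' t''| <= 1.
Proof. by case: t => [[[] []]|]; case: t' => [[[] []]|]; case: t'' => [[[] []]|]. Qed.

Definition cancelling (K : fieldType) (sg deg : K -> int) x y z :=
  [&& x != 0, deg x == deg y, sg x == - sg y & (z == 0) || (deg z <= deg x)].

(* Modelled on rational functions with their degree and their sign at infinity:
   in x + y + z = 0 the two terms of maximal degree have opposite signs. *)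
Record signed_valuation := SignedValuation {
  sv_field :> fieldType;
  sv_sg : sv_field -> int;
  sv_deg : sv_field -> int;
  sv_sg0 : sv_sg 0 = 0;
  sv_sg_sqr : forall x, x != 0 -> sv_sg x * sv_sg x = 1;
  sv_sgM : forall x y, sv_sg (x * y) = sv_sg x * sv_sg y;
  sv_degM : forall x y, x != 0 -> y != 0 -> sv_deg (x * y) = sv_deg x + sv_deg y;
  sv_sgN : forall x, sv_sg (- x) = - sv_sg x;
  sv_degN : forall x, sv_deg (- x) = sv_deg x;
  sv_cancel : forall x y z, x + y + z = 0 ->
    [|| cancelling sv_sg sv_deg x y z, cancelling sv_sg sv_deg y z x,
        cancelling sv_sg sv_deg z x y | [&& x == 0, y == 0 & z == 0]];
  sv_sg2 : sv_sg 2 = 1;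
  sv_deg2 : sv_deg 2 = 0;
  sv_unif : sv_field;
  sv_sg_unif : sv_sg sv_unif = 1;
  sv_deg_unif : sv_deg sv_unif = 1 }.

Section SquareClass.
Variable K : signed_valuation.
Implicit Types x y z : K.
Local Notation cancels := (cancelling (@sv_sg K) (@sv_deg K)).

Lemma sv_sg_eq0 x : (sv_sg x == 0) = (x == 0).
Proof.
apply/eqP/eqP => [x0|->]; last exact: sv_sg0.
by apply/eqP; apply: contra_eqT x0 => /sv_sg_sqr; case: eqP => // ->.
Qed.

Definition rcl (x : K) : sclass :=
  if x == 0 then None else Some (sv_sg x == -1, odd `|sv_deg x|).

Lemma rcl_None x : (rcl x == None) = (x == 0).
Proof. by rewrite /rcl; case: (x == 0). Qed.

Lemma rsg_cases x : x != 0 -> sv_sg x = 1 \/ sv_sg x = -1.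
Proof.
move=> /sv_sg_sqr H.
have : (sv_sg x - 1) * (sv_sg x + 1) = 0 by rewrite mulrDl mulrDr !mulr1 H; ring.
by move=> /eqP; rewrite mulf_eq0 subr_eq0 addr_eq0 => /orP[] /eqP; [left|right].
Qed.

Lemma rclM x y : rcl (x * y) = smul (rcl x) (rcl y).
Proof.
rewrite /rcl mulf_eq0; case: eqVneq => //= x0; case: eqVneq => //= y0.
rewrite sv_sgM (sv_degM x0 y0).
have := rsg_cases x0; have := rsg_cases y0.
move: (sv_sg x) (sv_sg y) (sv_deg x) (sv_deg y) => s s' a b ss' ss; congr (Some (_, _)).
  by case: ss => ->; case: ss' => ->.
lia.
Qed.

Lemma rclN x : rcl (- x) = sopp (rcl x).
Proof.
rewrite /rcl oppr_eq0; case: eqVneq => //= x0; rewrite sv_sgN sv_degN.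
by congr (Some (_, _)); case: (rsg_cases x0) => ->.
Qed.

Lemma cancels_rcl x y z : cancels x y z -> rcl x != None /\ rcl x = rcl (- y).
Proof.
case/and4P => x0 /eqP xy /eqP sxy _; rewrite rcl_None x0; split=> //.
have y0 : y != 0 by move: x0; rewrite -!sv_sg_eq0 sxy oppr_eq0.
by rewrite /rcl oppr_eq0 (negPf x0) (negPf y0) sxy xy sv_sgN sv_degN.
Qed.

Lemma par_rcl x : x != 0 -> par (rcl x) = odd `|sv_deg x|.
Proof. by rewrite /rcl => /negPf ->. Qed.

Lemma tri_neq_None a b c : tri a b c != None ->
  [/\ a != None, b != None, c != None & par (tri a b c) = par a (+) par b (+) par c].
Proof. by case: a b c => [[s p]|] [[s' p']|] [[s'' p'']|]. Qed.

Lemma rcl0 : rcl 0 = None.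
Proof. by rewrite /rcl eqxx. Qed.

Lemma rcl_pos x : sv_sg x = 1 -> rcl x = Some (false, odd `|sv_deg x|).
Proof.
by move=> x1; rewrite /rcl -sv_sg_eq0 x1.
Qed.

End SquareClass.

(** Meant for two centres of different parity. The coincidences among the parities name the split
    into pairs, and the sum of the two degrees along the split is strictly smaller than the other
    two sums. *)
Definition strict_split (p012 p013 p023 p123 : bool)
    (w01 w02 w03 w12 w13 w23 : int) : bool :=
  [|| [&& p012 == p123, p013 == p023, p012 != p013,
          w01 + w23 == w02 + w13 & w03 + w12 < w01 + w23],
      [&& p012 == p013, p023 == p123, p012 != p023,
          w02 + w13 == w03 + w12 & w01 + w23 < w02 + w13] |
      [&& p012 == p023, p013 == p123, p012 != p013,
          w01 + w23 == w03 + w12 & w02 + w13 < w01 + w23]].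

(** Join two of the five points if the other three have an even centre. Each quadruple has two
    centres of either parity, so the graph is 2-regular, hence a pentagon. Added over its five
    rotations, the equalities make the sum of [w] over sides equal to that over diagonals, while the
    inequalities make it strictly smaller. *)
Lemma no_pentagon (p012 p013 p014 p023 p024 p034 p123 p124 p134 p234 : bool)
    (w01 w02 w03 w04 w12 w13 w14 w23 w24 w34 : int) :
  strict_split p012 p013 p023 p123 w01 w02 w03 w12 w13 w23 ->
  strict_split p012 p014 p024 p124 w01 w02 w04 w12 w14 w24 ->
  strict_split p013 p014 p034 p134 w01 w03 w04 w13 w14 w34 ->
  strict_split p023 p024 p034 p234 w02 w03 w04 w23 w24 w34 ->
  strict_split p123 p124 p134 p234 w12 w13 w14 w23 w24 w34 -> False.
Proof.
rewrite /strict_split.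
case: p012; case: p013; case: p023; case: p123 => //= A;
  case: p014; case: p024; case: p124 => //= B;
  case: p034; case: p134 => //= C;
  case: p234 => //= D E; lia.
Qed.

Section SL2.
Variable K : fieldType.

Definition det1 (x : K * K * K * K) : bool :=
  x.1.1.1 * x.2 - x.1.1.2 * x.1.2 == 1.

Definition sl2 := {x | det1 x}.
HB.instance Definition _ := Choice.on sl2.

Implicit Types g h k : sl2.

Lemma sl2_det g : (val g).1.1.1 * (val g).2 - (val g).1.1.2 * (val g).1.2 = 1.
Proof. by apply/eqP; exact: (valP g). Qed.

Definition sl2_mul_val (x y : K * K * K * K) :=
  (x.1.1.1 * y.1.1.1 + x.1.1.2 * y.1.2, x.1.1.1 * y.1.1.2 + x.1.1.2 * y.2,
   x.1.2 * y.1.1.1 + x.2 * y.1.2, x.1.2 * y.1.1.2 + x.2 * y.2).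

Lemma sl2_mul_subproof g h : det1 (sl2_mul_val (val g) (val h)).
Proof.
case: g h => [[[[a b] c] d] /= /eqP g1] [[[[a' b'] c'] d'] /= /eqP h1].
rewrite /det1 /=; apply/eqP.
by transitivity ((a * d - b * c) * (a' * d' - b' * c')); [ring | rewrite g1 h1 mulr1].
Qed.

Definition sl2_mul g h : sl2 := exist _ (sl2_mul_val (val g) (val h)) (sl2_mul_subproof g h).

Lemma sl2_one_subproof : det1 (1, 0, 0, 1).
Proof. by rewrite /det1 /= mulr1 mulr0 subr0. Qed.

Definition sl2_one : sl2 := exist _ (1, 0, 0, 1) sl2_one_subproof.

Lemma sl2_inv_subproof g :
  det1 ((val g).2, - (val g).1.1.2, - (val g).1.2, (val g).1.1.1).
Proof. by rewrite /det1 /=; apply/eqP; rewrite -[RHS](sl2_det g); ring. Qed.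

Definition sl2_inv g : sl2 := exist _ (_, _, _, _) (sl2_inv_subproof g).

Lemma sl2_mulA : associative sl2_mul.
Proof.
move=> g h k; apply: val_inj; rewrite /= /sl2_mul_val /=.
by congr (_, _, _, _); ring.
Qed.

Lemma sl2_mul1 : left_id sl2_one sl2_mul.
Proof.
move=> g; apply: val_inj; case: g => [[[[a b] c] d] /= _].
by rewrite /sl2_mul_val /=; congr (_, _, _, _); ring.
Qed.

Lemma sl2_mulr1 : right_id sl2_one sl2_mul.
Proof.
move=> g; apply: val_inj; case: g => [[[[a b] c] d] /= _].
by rewrite /sl2_mul_val /=; congr (_, _, _, _); ring.
Qed.

Lemma sl2_mulV : left_inverse sl2_one sl2_inv sl2_mul.
Proof.
move=> g; apply: val_inj; have := sl2_det g; rewrite /= /sl2_mul_val /= => g1.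
by congr (_, _, _, _); rewrite -?g1; ring.
Qed.

Lemma sl2_mulrV : right_inverse sl2_one sl2_inv sl2_mul.
Proof.
move=> g; apply: val_inj; have := sl2_det g; rewrite /= /sl2_mul_val /= => g1.
by congr (_, _, _, _); rewrite -?g1; ring.
Qed.

HB.instance Definition _ :=
  isGroup.Build sl2 sl2_mulA sl2_mul1 sl2_mulr1 sl2_mulV sl2_mulrV.

(** The determinant of the first columns. Hence the tree cocycles see [g] only through the line
    spanned by its first column, an end of the tree. *)
Definition wedge g h : K :=
  (val g).1.1.1 * (val h).1.2 - (val g).1.2 * (val h).1.1.1.

Lemma wedge_mul k g h : wedge (k * g)%g (k * h)%g = wedge g h.
Proof.
have E x : val (k * x)%g = sl2_mul_val (val k) (val x) by [].
rewrite -[RHS]mul1r -[1 in RHS](sl2_det k) /wedge !E /=; ring.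
Qed.

Lemma wedgeC g h : wedge h g = - wedge g h.
Proof. by rewrite /wedge; ring. Qed.

Lemma wedgegg g : wedge g g = 0.
Proof. by rewrite /wedge; ring. Qed.

Lemma wedge_plucker g h k l :
  wedge g h * wedge k l + - (wedge g k * wedge h l) + wedge g l * wedge h k = 0.
Proof. by rewrite /wedge; ring. Qed.

Lemma wedge_trans h g k : wedge g h = 0 -> wedge h k = 0 -> wedge g k = 0.
Proof.
move=> gh hk; rewrite -[LHS]mul1r -(sl2_det h) mulrBl.
have -> : (val h).1.1.1 * (val h).2 * wedge g k =
    (val h).2 * ((val g).1.1.1 * wedge h k + (val k).1.1.1 * wedge g h).
  by rewrite /wedge; ring.
have -> : (val h).1.1.2 * (val h).1.2 * wedge g k =
    (val h).1.1.2 * ((val g).1.2 * wedge h k + (val k).1.2 * wedge g h).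
  by rewrite /wedge; ring.
by rewrite gh hk !mulr0 addr0 !mulr0 subr0.
Qed.

End SL2.

Section TreeClass.
Variable K : signed_valuation.
Implicit Types g h k l x : sl2 K.

Definition treeT (g h k : sl2 K) : sclass :=
  tri (rcl (wedge g h)) (rcl (wedge h k)) (rcl (wedge g k)).

Lemma treeT_mul x g h k : treeT (x * g)%g (x * h)%g (x * k)%g = treeT g h k.
Proof. by rewrite /treeT !wedge_mul. Qed.

Lemma rcl_wedge_split g h k l :
  [|| (rcl (wedge g h * wedge k l) != None) &&
        (rcl (wedge g h * wedge k l) == rcl (wedge g k * wedge h l)),
      (rcl (wedge g k * wedge h l) != None) &&
        (rcl (wedge g k * wedge h l) == rcl (wedge g l * wedge h k)),
      (rcl (wedge g l * wedge h k) != None) &&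
        (rcl (wedge g l * wedge h k) == sopp (rcl (wedge g h * wedge k l))) |
      [&& rcl (wedge g h * wedge k l) == None, rcl (wedge g k * wedge h l) == None &
       rcl (wedge g l * wedge h k) == None]].
Proof.
have := sv_cancel (wedge_plucker g h k l).
move: (wedge g h * _) (wedge g k * _) (wedge g l * _) => a b c.
case/or4P => [/cancels_rcl[-> ->]|/cancels_rcl[]|/cancels_rcl[-> ->]|/and3P[a0 b0 c0]].
- by rewrite opprK eqxx.
- rewrite rcl_None oppr_eq0 -rcl_None => b0 /(congr1 sopp).
  by rewrite -!rclN !opprK => <-; rewrite b0 eqxx orbT.
- by rewrite rclN eqxx !orbT.
by rewrite !rcl_None a0 c0 -[b]opprK oppr_eq0 b0 !orbT.
Qed.

Lemma treeT_four g0 g1 g2 g3 :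
  four_point (treeT g0 g1 g2) (treeT g0 g1 g3) (treeT g0 g2 g3) (treeT g1 g2 g3).
Proof.
have wt (a b c : sl2 K) : [/\ (rcl (wedge a b) == None) && (rcl (wedge a c) == None) ==>
      (rcl (wedge b c) == None),
    (rcl (wedge a b) == None) && (rcl (wedge b c) == None) ==>
      (rcl (wedge a c) == None) &
    (rcl (wedge a c) == None) && (rcl (wedge b c) == None) ==>
      (rcl (wedge a b) == None)].
  rewrite !rcl_None; split; apply/implyP => /andP[/eqP u /eqP v]; apply/eqP.
  - by apply: (@wedge_trans _ a) => //; rewrite wedgeC u oppr0.
  - exact: (@wedge_trans _ b).
  - by apply: (@wedge_trans _ c) => //; rewrite wedgeC v oppr0.
have [a1 a2 a3] := wt g0 g1 g2; have [b1 b2 b3] := wt g0 g1 g3.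
have [c1 c2 c3] := wt g0 g2 g3; have [d1 d2 d3] := wt g1 g2 g3.
have := rcl_wedge_split g0 g1 g2 g3; rewrite !rclM.
exact: (four_point_tri a1 b1 c1 d1 a2 b2 c2 d2 a3 b3 c3 d3).
Qed.

Lemma odd_abszD (a b : int) : odd `|a + b| = odd `|a| (+) odd `|b|.
Proof.
have oddB (m n : nat) : odd `|m%:Z - n%:Z| = odd m (+) odd n.
  case: (leqP m n) => [mn|/ltnW mn]; first by rewrite distnEr // oddB // addbC.
  by rewrite distnEl // oddB.
case: a b => m [] n; rewrite ?NegzE.
- by rewrite -PoszD !absz_nat oddD.
- by rewrite oddB abszN !absz_nat.
- by rewrite addrC oddB abszN !absz_nat addbC.
by rewrite -opprD !abszN -PoszD !absz_nat oddD.
Qed.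

Lemma par_treeT g h k : treeT g h k != None ->
  [/\ wedge g h != 0, wedge h k != 0, wedge g k != 0 &
  par (treeT g h k) = odd `|sv_deg (wedge g h) + sv_deg (wedge h k) + sv_deg (wedge g k)|].
Proof.
rewrite /treeT => /tri_neq_None[].
rewrite !rcl_None => gh hk gk ->.
rewrite (par_rcl gh) (par_rcl hk) (par_rcl gk); split=> //.
by rewrite !odd_abszD.
Qed.

(** The parities of two of the centres differ exactly if two terms of the Pluecker relation have
    degrees of different parity. In a mixed quadruple the dominated term therefore cannot reach the
    degree of the dominating ones. *)
Lemma mixed_strict g0 g1 g2 g3 :
  mixed (treeT g0 g1 g2) (treeT g0 g1 g3) (treeT g0 g2 g3) (treeT g1 g2 g3) ->
  strict_split (par (treeT g0 g1 g2)) (par (treeT g0 g1 g3))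
    (par (treeT g0 g2 g3)) (par (treeT g1 g2 g3))
    (sv_deg (wedge g0 g1)) (sv_deg (wedge g0 g2)) (sv_deg (wedge g0 g3))
    (sv_deg (wedge g1 g2)) (sv_deg (wedge g1 g3)) (sv_deg (wedge g2 g3)).
Proof.
case/and5P => /par_treeT[w01 w12 w02 ->] /par_treeT[_ w13 w03 ->].
move=> /par_treeT[_ w23 _ ->] /par_treeT[_ _ _ ->].
have := sv_cancel (wedge_plucker g0 g1 g2 g3).
rewrite /cancelling sv_degN !sv_degM // oppr_eq0 !mulf_eq0.
rewrite (negPf w01) (negPf w02) (negPf w03) (negPf w12) (negPf w13) (negPf w23) /=.
move: (sv_deg (wedge g0 g1)) (sv_deg (wedge g0 g2)) (sv_deg (wedge g0 g3)).
move: (sv_deg (wedge g1 g2)) (sv_deg (wedge g1 g3)) (sv_deg (wedge g2 g3)).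
move=> a12 a13 a23 a01 a02 a03; rewrite /strict_split !odd_abszD orbF.
have lt_odd (a b : int) : a <= b -> odd `|a| != odd `|b| -> a < b.
  by rewrite le_eqVlt => /orP[/eqP ->|//]; rewrite eqxx.
case/or3P => /and3P[/eqP E _ /lt_odd]; rewrite E eqxx;
  move: (congr1 (fun a => odd `|a|) E); rewrite !odd_abszD;
  case: (odd `|a01|) (odd `|a02|) (odd `|a03|) => [] [] [] /=;
  case: (odd `|a12|) (odd `|a13|) (odd `|a23|) => [] [] [] //= _ lt _;
  by rewrite lt // ?orbT.
Qed.

Lemma treeT_not_all_mixed g0 g1 g2 g3 g4 :
  ~~ [&& mixed (treeT g0 g1 g2) (treeT g0 g1 g3) (treeT g0 g2 g3) (treeT g1 g2 g3),
     mixed (treeT g0 g1 g2) (treeT g0 g1 g4) (treeT g0 g2 g4) (treeT g1 g2 g4),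
     mixed (treeT g0 g1 g3) (treeT g0 g1 g4) (treeT g0 g3 g4) (treeT g1 g3 g4),
     mixed (treeT g0 g2 g3) (treeT g0 g2 g4) (treeT g0 g3 g4) (treeT g2 g3 g4) &
     mixed (treeT g1 g2 g3) (treeT g1 g2 g4) (treeT g1 g3 g4) (treeT g2 g3 g4)].
Proof.
apply/negP => /and5P[/mixed_strict A /mixed_strict B /mixed_strict C].
move=> /mixed_strict D /mixed_strict E; exact: no_pentagon A B C D E.
Qed.

Lemma treeT_gg_l g h : treeT g g h = None.
Proof. by rewrite /treeT wedgegg rcl0. Qed.

Lemma treeT_gg_r g h : treeT g h h = None.
Proof. by rewrite /treeT wedgegg rcl0; case: rcl => [[]|]. Qed.

Lemma treeT_gg_m g h : treeT g h g = None.
Proof. by rewrite /treeT wedgegg rcl0; case: rcl => [[s p]|] //; case: rcl => [[]|]. Qed.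

End TreeClass.

(** * The valued field of rational functions *)

Notation ratfun := {fraction {poly rat}}.

Section SignValuation.
Implicit Types (p q n d : {poly rat}) (x y z : ratfun).
Local Notation "p %:F" := (@FracField.tofrac {poly rat} p).

Definition rnum x : {poly rat} := \n_(repr x).
Definition rden x : {poly rat} := \d_(repr x).

Lemma rden_neq0 x : rden x != 0. Proof. exact: denom_ratioP. Qed.

Lemma rden_num x : x * (rden x)%:F = (rnum x)%:F.
Proof.
rewrite -{1}[x]reprK.
rewrite /GRing.mul /= !piE; apply/eqmodP; rewrite /= FracField.equivfE /FracField.mulf.
by rewrite !numden_Ratio ?(oner_eq0, mulf_neq0, denom_ratioP) // !mulr1 mulrC.
Qed.

Opaque rnum rden.

Lemma repr_frac x : x = (rnum x)%:F / (rden x)%:F.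
Proof. by rewrite -rden_num mulfK // tofrac_eq0 rden_neq0. Qed.

(* The sign for the ordering in which X is infinitely large. *)
Definition rsg x : int := sgz (lead_coef (rnum x)) * sgz (lead_coef (rden x)).

Definition rdeg x : int := (size (rnum x))%:Z - (size (rden x))%:Z.

Let sgz2 p : p != 0 -> sgz (lead_coef p) * sgz (lead_coef p) = 1.
Proof. by move=> p0; rewrite mulz_sg lead_coef_eq0 p0. Qed.

Lemma frac_eq n d x : d != 0 -> x = n%:F / d%:F -> n * rden x = rnum x * d.
Proof.
move=> d0 xE; apply/eqP; rewrite -tofrac_eq !tofracM -rden_num mulrAC; apply/eqP.
by congr (_ * _); rewrite xE divfK // tofrac_eq0.
Qed.

Lemma rsg_frac n d : d != 0 ->
  rsg (n%:F / d%:F) = sgz (lead_coef n) * sgz (lead_coef d).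
Proof.
move=> d0; have := @frac_eq n d _ d0 erefl; rewrite /rsg.
move=> /(congr1 (fun p : {poly rat} => sgz (lead_coef p))).
rewrite !lead_coefM !sgzM => E.
have := sgz2 d0; have := sgz2 (rden_neq0 (n%:F / d%:F)).
set b := sgz (lead_coef (rden _)) in E *; set a := sgz (lead_coef (rnum _)) in E *.
set e := sgz (lead_coef d) in E *; set c := sgz (lead_coef n) in E *.
move=> bb ee; have -> : a * b = a * e * (e * b) by rewrite mulrA -[a * e * e]mulrA ee mulr1.
by rewrite -E mulrACA bb mulr1.
Qed.

Lemma rdeg_frac n d : n != 0 -> d != 0 ->
  rdeg (n%:F / d%:F) = (size n)%:Z - (size d)%:Z.
Proof.
move=> n0 d0; have := @frac_eq n d _ d0 erefl; rewrite /rdeg; set r := _ / _ => E.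
have r0 : rnum r != 0.
  by apply: contra_neq (mulf_neq0 n0 (rden_neq0 r)) => r0; rewrite E r0 mul0r.
have e0 := rden_neq0 r; clearbody r.
have := congr1 (fun p : {poly rat} => size p) E; rewrite !size_mul //.
rewrite -!size_poly_gt0 in n0 d0 r0 e0.
move: (size n) (size d) (size (rden r)) (size (rnum r)) n0 d0 e0 r0 => a b c e.
lia.
Qed.

Lemma rsg0 : rsg 0 = 0.
Proof.
have <- : (0%:F / 1%:F : ratfun) = 0 by rewrite tofrac0 mul0r.
by rewrite rsg_frac ?oner_eq0 // lead_coef0 sgz0 mul0r.
Qed.

Lemma rsgM x y : rsg (x * y) = rsg x * rsg y.
Proof.
rewrite [in LHS](repr_frac x) [in LHS](repr_frac y) mulf_div -!tofracM.
rewrite rsg_frac ?mulf_neq0 ?rden_neq0 // !lead_coefM !sgzM /rsg; ring.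
Qed.

Lemma numer_neq0 x : x != 0 -> rnum x != 0.
Proof.
by apply: contra_neq => n0; rewrite (repr_frac x) n0 tofrac0 mul0r.
Qed.

Lemma rdegM x y : x != 0 -> y != 0 -> rdeg (x * y) = rdeg x + rdeg y.
Proof.
move=> /numer_neq0 x0 /numer_neq0 y0.
have dx := rden_neq0 x; have dy := rden_neq0 y.
rewrite [in LHS](repr_frac x) [in LHS](repr_frac y) mulf_div -!tofracM.
rewrite rdeg_frac ?mulf_neq0 // !size_mul // /rdeg.
rewrite -!size_poly_gt0 in x0 y0 dx dy.
move: (size (rnum x)) (size (rnum y)) (size (rden x)) (size (rden y)) x0 y0 dx dy => a b c e.
lia.
Qed.

Lemma rsg_sqr x : x != 0 -> rsg x * rsg x = 1.
Proof.
move=> /numer_neq0 x0; rewrite /rsg mulrACA sgz2 // sgz2 //.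
exact: rden_neq0.
Qed.

Lemma rsg_eq0 x : (rsg x == 0) = (x == 0).
Proof.
apply/eqP/eqP => [x0|->]; last exact: rsg0.
by apply/eqP; apply: contra_eqT x0 => /rsg_sqr; case: eqP => // ->.
Qed.

Lemma rsgN x : rsg (- x) = - rsg x.
Proof.
rewrite {1}(repr_frac x) -mulNr -tofracN rsg_frac ?rden_neq0 //.
by rewrite lead_coefN sgzN mulNr.
Qed.

Lemma rdegN x : rdeg (- x) = rdeg x.
Proof.
have [->|x0] := eqVneq x 0; first by rewrite oppr0.
rewrite {1}(repr_frac x) -mulNr -tofracN rdeg_frac ?rden_neq0 ?oppr_eq0 //.
  by rewrite size_polyN.
exact: numer_neq0.
Qed.

Local Notation cancels := (@cancelling ratfun rsg rdeg).

Lemma sgz_sum3 (a b c : rat) : a + b + c = 0 -> a != 0 ->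
  [|| sgz a == - sgz b, sgz a == - sgz c | sgz b == - sgz c].
Proof.
move=> E a0; case: (sgzP a) a0 E => //; case: (sgzP b) => //; case: (sgzP c) => //= *; lra.
Qed.

(** Compare coefficients in the degree of [p]: they add up to 0 and that of [p] is nonzero, so a
    second polynomial has the same size, and two of the leading coefficients have opposite signs. *)
Lemma poly_cancels p q n : p + q + n = 0 -> p != 0 ->
    (size q <= size p)%N -> (size n <= size p)%N ->
  [|| (size p == size q) && (sgz (lead_coef p) == - sgz (lead_coef q)),
      (size p == size n) && (sgz (lead_coef p) == - sgz (lead_coef n)) |
      [&& size q == size n, size p == size q &
        sgz (lead_coef q) == - sgz (lead_coef n)]].
Proof.
move=> pqn p0 qp np.
pose m := (size p).-1.
have pm : lead_coef p = p`_m by [].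
have cE (r : {poly rat}) : size r = size p -> lead_coef r = r`_m by move=> rp; rewrite lead_coefE rp.
have c0 (r : {poly rat}) : (size r < size p)%N -> r`_m = 0.
  by move=> rp; rewrite nth_default // /m; move: rp; case: (size p).
have E : p`_m + q`_m + n`_m = 0 by rewrite -!coefD pqn coef0.
have p1 : p`_m != 0 by rewrite -pm lead_coef_eq0.
have [qE|qn] := eqVneq (size p) (size q); last first.
  have [nE|nn] := eqVneq (size p) (size n); last first.
    by move: E p1; rewrite (c0 q) ?(c0 n) ?addr0 ?ltn_neqAle 1?eq_sym ?qn ?nn // => ->; rewrite eqxx.
  move: E; rewrite (c0 q) ?addr0 1?ltn_neqAle 1?eq_sym ?qn // => E.
  rewrite /= andbF orbF pm (cE n) // -sgzN; apply/eqP; congr sgz; lra.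
have [nE|nn] := eqVneq (size p) (size n); last first.
  move: E; rewrite (c0 n) ?addr0 1?ltn_neqAle 1?eq_sym ?nn // => E.
  rewrite pm (cE q) // /= -sgzN; apply/orP; left; apply/eqP; congr sgz; lra.
rewrite -qE -nE eqxx /= pm (cE q) // (cE n) //.
exact: sgz_sum3.
Qed.

Lemma frac_cancels (a b n d : {poly rat}) : d != 0 -> a != 0 -> size a = size b ->
  sgz (lead_coef a) = - sgz (lead_coef b) -> (size n <= size a)%N ->
  cancels (a%:F / d%:F) (b%:F / d%:F) (n%:F / d%:F).
Proof.
move=> d0 a0 ab sab na; have b0 : b != 0 by rewrite -size_poly_gt0 -ab size_poly_gt0.
rewrite /cancelling (rdeg_frac a0 d0) (rdeg_frac b0 d0) !rsg_frac // sab ab mulNr !eqxx /=.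
rewrite mulf_neq0 ?invr_eq0 ?tofrac_eq0 //=.
have [->|n0] := eqVneq n 0; first by rewrite tofrac0 mul0r eqxx.
by rewrite rdeg_frac // -ab lerD2r lez_nat na orbT.
Qed.

Lemma cancels_sym x y z : cancels x y z -> cancels y x z.
Proof.
rewrite /cancelling => /and4P[x0 /eqP xy /eqP sxy zx]; apply/and4P; split.
- by move: x0; rewrite -!rsg_eq0 sxy oppr_eq0.
- by rewrite xy.
- by rewrite sxy opprK.
- by rewrite -xy.
Qed.

Lemma ratfun_cancels x y z : x + y + z = 0 ->
  [|| cancels x y z, cancels y z x, cancels z x y | [&& x == 0, y == 0 & z == 0]].
Proof.
move=> xyz; pose d := rden x * rden y * rden z.
have d0 : d != 0 by rewrite !mulf_neq0 ?rden_neq0.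
have fd : d%:F != 0 by rewrite tofrac_eq0.
have [a xE] : exists a : {poly rat}, x = a%:F / d%:F.
  exists (rnum x * (rden y * rden z)); apply: (canRL (mulfK fd)).
  by rewrite /d -mulrA tofracM mulrA rden_num -tofracM.
have [b yE] : exists b : {poly rat}, y = b%:F / d%:F.
  exists (rnum y * (rden x * rden z)); apply: (canRL (mulfK fd)).
  by rewrite /d (mulrC (rden x)) -mulrA tofracM mulrA rden_num -tofracM.
have [c zE] : exists c : {poly rat}, z = c%:F / d%:F.
  exists (rnum z * (rden x * rden y)); apply: (canRL (mulfK fd)).
  by rewrite /d (mulrC (rden x * _)) tofracM mulrA rden_num -tofracM.
move: xyz; rewrite xE yE zE -!mulrDl -!tofracD => /eqP.
rewrite mulf_eq0 invr_eq0 (negPf fd) orbF tofrac_eq0.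
move=> /eqP abc; clearbody d; clear xE yE zE x y z fd.
(* The claim is invariant under cyclic rotation of the three numerators over the common
   denominator. *)
wlog: a b c abc / (size b <= size a)%N && (size c <= size a)%N.
  move=> W; have [ba|ab] := leqP (size b) (size a).
    have [ca|ac] := leqP (size c) (size a); first by apply: W; rewrite ?ba.
    have := W c a b; rewrite (ltnW ac) (leq_trans ba (ltnW ac)) addrAC -addrA addrC.
    rewrite [b + a]addrC abc => /(_ erefl erefl).
    by case/or4P => [->|->|->|/and3P[-> -> ->]]; rewrite ?orbT.
  have [cb|bc] := leqP (size c) (size b).
    have := W b c a; rewrite (ltnW ab) cb [b + c]addrC -addrA addrC [b + a]addrC abc => /(_ erefl erefl).
    by case/or4P => [->|->|->|/and3P[-> -> ->]]; rewrite ?orbT.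
  have := W c a b; rewrite (ltnW bc) (leq_trans (ltnW ab) (ltnW bc)) addrAC -addrA addrC.
  rewrite [b + a]addrC abc => /(_ erefl erefl).
  by case/or4P => [->|->|->|/and3P[-> -> ->]]; rewrite ?orbT.
case/andP=> ba ca; have [a0|a0] := eqVneq a 0.
  move: ba ca; rewrite a0 size_poly0 !leqn0 !size_poly_eq0 => /eqP -> /eqP ->.
  by rewrite tofrac0 mul0r eqxx !orbT.
have := poly_cancels abc a0 ba ca; case/or3P.
- by case/andP => /eqP ab /eqP sab; rewrite frac_cancels.
- case/andP => /eqP ac /eqP sac; apply/or4P; apply: Or43.
  by apply: cancels_sym; rewrite frac_cancels.
- case/and3P => /eqP bc /eqP ab /eqP sbc; apply/or4P; apply: Or42.
  by rewrite frac_cancels ?ab // -size_poly_gt0 -ab size_poly_gt0.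
Qed.

Lemma rsg_ratC (q : rat) : rsg (q%:P)%:F = sgz q.
Proof.
have -> : (q%:P)%:F = (q%:P)%:F / 1%:F by rewrite tofrac1 divr1.
by rewrite rsg_frac ?oner_eq0 // lead_coefC lead_coef1 sgz1 mulr1.
Qed.

Lemma rdeg_ratC (q : rat) : q != 0 -> rdeg (q%:P)%:F = 0.
Proof.
move=> q0; have -> : (q%:P)%:F = (q%:P)%:F / 1%:F by rewrite tofrac1 divr1.
by rewrite rdeg_frac ?oner_eq0 ?polyC_eq0 // size_polyC q0 size_poly1.
Qed.

Lemma rsgX : rsg 'X%:F = 1.
Proof.
have -> : 'X%:F = 'X%:F / 1%:F by rewrite tofrac1 divr1.
by rewrite rsg_frac ?oner_eq0 // lead_coefX lead_coef1 !sgz1.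
Qed.

Lemma rdegX : rdeg 'X%:F = 1.
Proof.
have -> : 'X%:F = 'X%:F / 1%:F by rewrite tofrac1 divr1.
by rewrite rdeg_frac ?oner_eq0 ?polyX_eq0 // size_polyX size_poly1.
Qed.

Lemma rsg2 : rsg 2 = 1.
Proof. by have := rsg_ratC 2; rewrite polyC_natr tofracMn tofrac1. Qed.

Lemma rdeg2 : rdeg 2 = 0.
Proof. by have := @rdeg_ratC 2 isT; rewrite polyC_natr tofracMn tofrac1. Qed.

Definition ratfun_valuation : signed_valuation :=
  SignedValuation rsg0 rsg_sqr rsgM rdegM rsgN rdegN ratfun_cancels rsg2 rdeg2
    rsgX rdegX.

End SignValuation.

(** * The central extension of SL2 *)

Section TreeCocycles.
Variables (K : signed_valuation) (R : realFieldType).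
Implicit Types g h k : sl2 K.

Definition Te g h k : R := (ecoef (treeT g h k))%:~R.
Definition To g h k : R := (ocoef (treeT g h k))%:~R.

Lemma Te_cocycle g0 g1 g2 g3 :
  Te g1 g2 g3 - Te g0 g2 g3 + Te g0 g1 g3 - Te g0 g1 g2 = 0.
Proof.
have := four_point_ecoef (treeT_four g0 g1 g2 g3).
by rewrite /Te -!intrB -intrD -intrB => ->.
Qed.

Lemma To_cocycle g0 g1 g2 g3 :
  To g1 g2 g3 - To g0 g2 g3 + To g0 g1 g3 - To g0 g1 g2 = 0.
Proof.
have := four_point_ocoef (treeT_four g0 g1 g2 g3).
by rewrite /To -!intrB -intrD -intrB => ->.
Qed.

Lemma Te_mul x g h k : Te (x * g)%g (x * h)%g (x * k)%g = Te g h k.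
Proof. by rewrite /Te treeT_mul. Qed.

Lemma To_mul x g h k : To (x * g)%g (x * h)%g (x * k)%g = To g h k.
Proof. by rewrite /To treeT_mul. Qed.

Lemma Te_le1 g h k : `|Te g h k| <= 1.
Proof. by rewrite /Te -intr_norm -[1]/(1%:~R) ler_int ecoef_le1. Qed.

Lemma To_le1 g h k : `|To g h k| <= 1.
Proof. by rewrite /To -intr_norm -[1]/(1%:~R) ler_int ocoef_le1. Qed.

Lemma Te_ggl g h : Te g g h = 0. Proof. by rewrite /Te treeT_gg_l. Qed.
Lemma Te_ggr g h : Te g h h = 0. Proof. by rewrite /Te treeT_gg_r. Qed.
Lemma Te_ggm g h : Te g h g = 0. Proof. by rewrite /Te treeT_gg_m. Qed.
Lemma To_ggl g h : To g g h = 0. Proof. by rewrite /To treeT_gg_l. Qed.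
Lemma To_ggr g h : To g h h = 0. Proof. by rewrite /To treeT_gg_r. Qed.
Lemma To_ggm g h : To g h g = 0. Proof. by rewrite /To treeT_gg_m. Qed.

Definition kappa g0 g1 g2 g3 : R :=
  (tree_kappa (treeT g0 g1 g2) (treeT g0 g1 g3) (treeT g1 g2 g3))%:~R.

Lemma kappa_cob g0 g1 g2 g3 g4 :
  kappa g1 g2 g3 g4 - kappa g0 g2 g3 g4 + kappa g0 g1 g3 g4 - kappa g0 g1 g2 g4
  + kappa g0 g1 g2 g3 = Te g0 g1 g2 * To g2 g3 g4.
Proof.
rewrite /kappa /Te /To -intrM -!intrB -intrD -intrB -intrD; congr (_%:~R).
apply: tree_kappa_cob; try exact: treeT_four.
exact: treeT_not_all_mixed.
Qed.

Lemma kappa_le1 g0 g1 g2 g3 : `|kappa g0 g1 g2 g3| <= 1.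
Proof. by rewrite /kappa -intr_norm -[1]/(1%:~R) ler_int tree_kappa_le1. Qed.

Lemma kappa_mul x g0 g1 g2 g3 :
  kappa (x * g0)%g (x * g1)%g (x * g2)%g (x * g3)%g = kappa g0 g1 g2 g3.
Proof. by rewrite /kappa !treeT_mul. Qed.

Lemma kappa_degenerate01 g h k : kappa g g h k = 0.
Proof. by rewrite /kappa !treeT_gg_l /tree_kappa /smed eqxx mulr0. Qed.

Lemma kappa_degenerate12 g h k : kappa g h h k = 0.
Proof. by rewrite /kappa treeT_gg_l /tree_kappa mul0r. Qed.

Lemma kappa_degenerate23 g h k : kappa g h k k = 0.
Proof. by rewrite /kappa treeT_gg_r /tree_kappa mul0r. Qed.

(* The central extension of sl2 K by R * R with classes Te and To. *)
Definition cext := (sl2 K * R * R)%type.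
HB.instance Definition _ := Choice.on cext.
Implicit Types x y z : cext.

Definition cext_mul x y : cext :=
  ((x.1.1 * y.1.1)%g, x.1.2 + y.1.2 + Te 1%g x.1.1 (x.1.1 * y.1.1)%g,
   x.2 + y.2 + To 1%g x.1.1 (x.1.1 * y.1.1)%g).
Definition cext_one : cext := (1%g, 0, 0).
(** There is no correction term because [Te] and [To] vanish on triples [1, g, 1]. *)
Definition cext_inv x : cext := (x.1.1^-1%g, - x.1.2, - x.2).

Lemma cext_mulA : associative cext_mul.
Proof.
move=> [[g r] s] [[h r'] s'] [[k r''] s'']; rewrite /cext_mul /= mulgA.
have := Te_cocycle 1%g g (g * h)%g (g * h * k)%g.
have := To_cocycle 1%g g (g * h)%g (g * h * k)%g.
have -> : Te g (g * h)%g (g * h * k)%g = Te 1%g h (h * k)%g.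
  by rewrite -(Te_mul g 1%g) mulg1 mulgA.
have -> : To g (g * h)%g (g * h * k)%g = To 1%g h (h * k)%g.
  by rewrite -(To_mul g 1%g) mulg1 mulgA.
by move=> o e; congr (_, _, _); lra.
Qed.

Lemma cext_mul1 : left_id cext_one cext_mul.
Proof. by move=> [[g r] s]; rewrite /cext_mul /= Te_ggl To_ggl mul1g !add0r !addr0. Qed.

Lemma cext_mulr1 : right_id cext_one cext_mul.
Proof. by move=> [[g r] s]; rewrite /cext_mul /= mulg1 Te_ggr To_ggr !addr0. Qed.

Lemma cext_mulV : left_inverse cext_one cext_inv cext_mul.
Proof. by move=> [[g r] s]; rewrite /cext_mul /= mulVg Te_ggm To_ggm !addr0 !addNr. Qed.

Lemma cext_mulrV : right_inverse cext_one cext_inv cext_mul.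
Proof. by move=> [[g r] s]; rewrite /cext_mul /= mulgV Te_ggm To_ggm !addr0 !subrr. Qed.

HB.instance Definition _ :=
  isGroup.Build cext cext_mulA cext_mul1 cext_mulr1 cext_mulV cext_mulrV.

Lemma cext_mulE x y : (x * y)%g = cext_mul x y. Proof. by []. Qed.

Definition theta1 (s : seq cext) : R := if s is [:: x; y] then (x^-1 * y)%g.1.2 else 0.
Definition theta2 (s : seq cext) : R := if s is [:: x; y] then (x^-1 * y)%g.2 else 0.
Definition kap (s : seq cext) : R :=
  if s is [:: x; y; z; t] then kappa x.1.1 y.1.1 z.1.1 t.1.1 else 0.

Lemma inv_prod x y z : (x^-1 * z)%g = (x^-1 * y * (y^-1 * z))%g.
Proof. by rewrite mulgA mulgK. Qed.

Lemma theta1D x y z :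
  theta1 [:: x; z] = theta1 [:: x; y] + theta1 [:: y; z] + Te x.1.1 y.1.1 z.1.1.
Proof.
rewrite /theta1 (inv_prod x y z) [in LHS]cext_mulE [in LHS]/cext_mul.
rewrite -[in RHS](Te_mul x.1.1^-1%g) mulVg; congr (_ + Te _ _ _).
by rewrite !cext_mulE /= -!mulgA mulVKg.
Qed.

Lemma cob_theta1 x y z : cob theta1 [:: x; y; z] = - Te x.1.1 y.1.1 z.1.1.
Proof.
rewrite [LHS](_ : _ = theta1 [:: y; z] - (theta1 [:: x; z] - (theta1 [:: x; y] - 0))) //.
rewrite (theta1D x y z); ring.
Qed.

Lemma theta2D x y z :
  theta2 [:: x; z] = theta2 [:: x; y] + theta2 [:: y; z] + To x.1.1 y.1.1 z.1.1.
Proof.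
rewrite /theta2 (inv_prod x y z) [in LHS]cext_mulE [in LHS]/cext_mul.
rewrite -[in RHS](To_mul x.1.1^-1%g) mulVg; congr (_ + To _ _ _).
by rewrite !cext_mulE /= -!mulgA mulVKg.
Qed.

Lemma cob_theta2 x y z : cob theta2 [:: x; y; z] = - To x.1.1 y.1.1 z.1.1.
Proof.
rewrite [LHS](_ : _ = theta2 [:: y; z] - (theta2 [:: x; z] - (theta2 [:: x; y] - 0))) //.
rewrite (theta2D x y z); ring.
Qed.

Lemma inv_mulK x y z : ((x * y)^-1 * (x * z))%g = (y^-1 * z)%g.
Proof. by rewrite invgM -mulgA mulKg. Qed.

Lemma theta1_inv : invariant theta1.
Proof.
move=> g [|x [|y [|? ?]]] //; by rewrite [map _ _]/= /theta1 inv_mulK.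
Qed.

Lemma theta2_inv : invariant theta2.
Proof.
move=> g [|x [|y [|? ?]]] //; by rewrite [map _ _]/= /theta2 inv_mulK.
Qed.

Lemma kap_inv : invariant kap.
Proof. by move=> g [|x [|y [|z [|t [|? ?]]]]] //; exact: (kappa_mul g.1.1). Qed.

Definition Phi (s : seq cext) : R := cup 1 theta1 (cob theta2) s - kap s.

Lemma Phi_inv : invariant Phi.
Proof.
move=> g s; rewrite /Phi kap_inv /cup -map_take -map_drop theta1_inv.
by rewrite (invariant_cob theta2_inv).
Qed.

Lemma Phi4 x y z t : Phi [:: x; y; z; t] =
  - (x^-1 * y)%g.1.2 * To y.1.1 z.1.1 t.1.1 - kappa x.1.1 y.1.1 z.1.1 t.1.1.
Proof. by rewrite /Phi /cup [take _ _]/= [drop _ _]/= cob_theta2 /theta1 /kap mulrN mulNr. Qed.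

Lemma cob_theta2_size s : size s != 3 -> cob theta2 s = 0.
Proof.
move=> s3; rewrite (@cob_eq_size _ _ _ (fun=> 0)) ?cob0 // => w ws.
by case: w ws => [|x [|y [|z w]]] //= ws; rewrite -ws in s3.
Qed.

Lemma Phi_size s : size s != 4 -> Phi s = 0.
Proof.
move=> s4; rewrite /Phi /cup cob_theta2_size; last by rewrite size_drop; lia.
by rewrite mulr0 sub0r; case: s s4 => [|x [|y [|z [|t [|u s]]]]] //= _; rewrite oppr0.
Qed.

(** The coboundary of the cup product is [cob theta1] times [cob theta2]. The two signs cancel, and
    [kappa_cob] identifies the resulting product of [Te] and [To] with the coboundary of [kap]. *)
Lemma Phi_cocycle : cocycle 3 Phi.
Proof.
move=> [|x0 [|x1 [|x2 [|x3 [|x4 [|? ?]]]]]] // _.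
have := kappa_cob x0.1.1 x1.1.1 x2.1.1 x3.1.1 x4.1.1.
rewrite (cobB (cup 1 theta1 (cob theta2)) kap) cob_cup // /cup.
rewrite [take _ _]/= [drop _ _]/= cob_theta1 cob_theta2 (cob_cob theta2) /=.
by rewrite !mulr0 addr0 mulrNN => <-; ring.
Qed.

Lemma Phi_normalized : normalized Phi.
Proof.
move=> s1 a s2; have [|/Phi_size //] := eqVneq (size (s1 ++ [:: a, a & s2])) 4.
have a1 : (a^-1 * a)%g.1.2 = 0 :> R by rewrite mulVg.
case: s1 => [|x [|y [|z s1]]] //=; last by rewrite size_cat /=; lia.
- case: s2 => [|x [|y [|? ?]]] // _.
  by rewrite Phi4 a1 kappa_degenerate01 !(oppr0, mul0r, addr0).
- case: s2 => [|y [|? ?]] // _.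
  by rewrite Phi4 To_ggl kappa_degenerate12 mulr0 subr0.
- case: s2 => [|? ?] // _.
  by rewrite Phi4 To_ggr kappa_degenerate23 mulr0 subr0.
Qed.

Lemma Phi_pattern_bounded : pattern_bounded 3 Phi.
Proof.
apply: (@secondary_pattern_bounded _ _ _ _ _ 1).
- exact: theta1_inv.
- exact: theta2_inv.
- by move=> [|x [|y [|z [|? ?]]]] // _; rewrite cob_theta1 normrN Te_le1.
- by move=> [|x [|y [|z [|? ?]]]] // _; rewrite cob_theta2 normrN To_le1.
- by move=> [|x [|y [|z [|t [|? ?]]]]] //=; rewrite ?normr0 ?kappa_le1.
Qed.

End TreeCocycles.

(** * The torus cycle of two central elements *)

Section PowerChain.
Variable R : realFieldType.

Definition bounds (G : groupType) (c : chain R (seq G)) (g : G) :=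
  of_size 3 c /\ forall (V : lmodType R) (f : seq G -> V),
    invariant f -> ev (cob f) c = f [:: 1%g; g].

(* A chain of norm n + 1 whose boundary is n [0, 1] - [0, n], up to shifts. *)
Definition powcn n : chain R (seq nat) :=
  [seq (1, [:: 0%N; j; j.+1]) | j <- iota 0 n] ++ [:: (-1, [:: 0%N; 0%N; 0%N])].

Definition shift_invariant (V : Type) (f : seq nat -> V) :=
  forall k s, f [seq (k + n)%N | n <- s] = f s.

Lemma ev_powcn (V : lmodType R) (f : seq nat -> V) n : shift_invariant f ->
  ev (cob f) (powcn n) = n%:R *: f [:: 0%N; 1%N] - f [:: 0%N; n].
Proof.
move=> fi; rewrite /powcn ev_cat ev_seq1 scaleN1r /= subr0 subrr subr0.
elim: n => [|n IH]; first by rewrite ev_nil scale0r.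
rewrite -addn1 iotaD map_cat ev_cat addrAC IH ev_seq1 scale1r /= add0n addn1.
have := fi n [:: 0%N; 1%N]; rewrite /= addn0 addn1 => ->.
rewrite subr0 -[n.+1%:R]natr1 scalerDl scale1r opprB.
by rewrite !addrA (ACl (1*3*5*4*2)) /= addrK.
Qed.

Lemma of_size_powcn n : of_size 3 (powcn n).
Proof.
by rewrite /powcn of_size_cat /= andbT /of_size all_map; apply/allP.
Qed.

Lemma cnorm_powcn n : cnorm (powcn n) = n%:R + 1.
Proof.
rewrite /powcn cnorm_cat /cnorm big_map big_seq1 normrN1; congr (_ + _).
under eq_bigr do rewrite normr1.
by rewrite big_const_seq count_predT size_iota iter_addr addr0.
Qed.

End PowerChain.

Section Torus.
Variables (R : realFieldType) (G : groupType) (z1 z2 : G).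
Hypotheses (z1C : forall g, commute z1 g) (z2C : forall g, commute z2 g).
Implicit Type V : lmodType R.

(** As [z1] is central, left translations of G and shifts of the exponent both become left
    translations. Thus [nat] with its shifts plays the line that covers the circle of [z1]. *)
Definition Lmul (q : nat * G) : G := (z1 ^+ q.1 * q.2)%g.
Definition Rmul (q : G * nat) : G := (q.1 * z2 ^+ q.2)%g.

Definition Lsh V (f : seq G -> V) ns y := shuf (fun w => f (map Lmul w)) ns y.
Definition Rsh V (f : seq G -> V) x ns := shuf (fun w => f (map Rmul w)) x ns.

Lemma expC1 n g : (z1 ^+ n * g = g * z1 ^+ n)%g.
Proof. exact/commute_sym/commuteX/commute_sym/z1C. Qed.

Lemma expC2 n g : (z2 ^+ n * g = g * z2 ^+ n)%g.
Proof. exact/commute_sym/commuteX/commute_sym/z2C. Qed.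

Lemma Lsh_inv V (f : seq G -> V) ns : invariant f -> invariant (Lsh f ns).
Proof.
move=> fi g s; rewrite /Lsh -{1}[ns]map_id shuf_map; apply: eq_ev => w.
rewrite -[RHS](fi g) -!map_comp; congr f; apply: eq_map => -[n x].
by rewrite /= /Lmul /= !mulgA expC1.
Qed.

Lemma Lsh_shift V (f : seq G -> V) y :
  invariant f -> shift_invariant (fun ns => Lsh f ns y).
Proof.
move=> fi k s; rewrite /Lsh -{1}[y]map_id shuf_map; apply: eq_ev => w.
rewrite -[RHS](fi (z1 ^+ k)%g) -!map_comp; congr f; apply: eq_map => -[n x].
by rewrite /= /Lmul /= expgnDr mulgA.
Qed.

Lemma Rsh_inv V (f : seq G -> V) ns : invariant f -> invariant (fun x => Rsh f x ns).
Proof.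
move=> fi g s; rewrite /Rsh -{1}[ns]map_id shuf_map; apply: eq_ev => w.
rewrite -[RHS](fi g) -!map_comp; congr f; apply: eq_map => -[x n].
by rewrite /= /Rmul /= mulgA.
Qed.

Lemma Rsh_shift V (f : seq G -> V) x : invariant f -> shift_invariant (Rsh f x).
Proof.
move=> fi k s; rewrite /Rsh -{1}[x]map_id shuf_map; apply: eq_ev => w.
rewrite -[RHS](fi (z2 ^+ k)%g) -!map_comp; congr f; apply: eq_map => -[y n].
by rewrite /= /Rmul /= expgnDr !mulgA expC2.
Qed.

Lemma Lsh_Rsh V (f : seq G -> V) ns ms :
  Lsh f ns (map (fun n => z2 ^+ n)%g ms) = Rsh f (map (fun n => z1 ^+ n)%g ns) ms.
Proof.
rewrite /Lsh /Rsh -{1}[ns]map_id -{2}[ms]map_id !shuf_map; apply: eq_ev => w.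
by rewrite -!map_comp.
Qed.

Lemma Lsh_cob V (f : seq G -> V) ns y : size ns = 2 \/ size ns = 3 ->
  (1 < size y)%N -> Lsh (cob f) ns y = cob (fun w => Lsh f w y) ns +
    (-1) ^+ (size ns).-1 *: cob (Lsh f ns) y.
Proof.
move=> ns2 y2; rewrite -shuf_cob //; last by case: ns2 => ->.
by apply: eq_ev => w; rewrite cob_map.
Qed.

Lemma Rsh_cob V (f : seq G -> V) x ns : size x = 3 -> (1 < size ns)%N ->
  Rsh (cob f) x ns = cob (fun w => Rsh f w ns) x + cob (Rsh f x) ns.
Proof.
move=> x3 y2; transitivity (shuf (cob (fun w => f (map Rmul w))) x ns).
  by apply: eq_ev => w; rewrite cob_map.
by rewrite shuf_cob ?x3 //= sqrrN expr1n scale1r.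
Qed.

Definition crossL (a : chain R (seq nat)) (b : chain R (seq G)) : chain R (seq G) :=
  [seq (w.1, map Lmul w.2) | w <- crossc a b].
Definition crossR (a : chain R (seq G)) (b : chain R (seq nat)) : chain R (seq G) :=
  [seq (w.1, map Rmul w.2) | w <- crossc a b].

Lemma ev_crossL V (f : seq G -> V) a b :
  ev f (crossL a b) = ev (fun ns => ev (Lsh f ns) b) a.
Proof. by rewrite ev_map ev_crossc. Qed.

Lemma ev_crossR V (f : seq G -> V) a b :
  ev f (crossR a b) = ev (fun x => ev (Rsh f x) b) a.
Proof. by rewrite ev_map ev_crossc. Qed.

Definition torus k (c1 c2 : chain R (seq G)) : chain R (seq G) :=
  crossL [:: (1, [:: 0%N; k])] c2 ++ crossR c1 [:: (1, [:: 0%N; k])].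

Lemma ev_torus V (f : seq G -> V) k c1 c2 :
  ev f (torus k c1 c2) =
    ev (Lsh f [:: 0%N; k]) c2 + ev (fun x => Rsh f x [:: 0%N; k]) c1.
Proof.
rewrite ev_cat ev_crossL ev_crossR ev_seq1 scale1r; congr (_ + _).
by apply: eq_ev => x; rewrite ev_seq1 scale1r.
Qed.

Lemma of_size_torus k c1 c2 : of_size 3 c1 -> of_size 3 c2 -> of_size 4 (torus k c1 c2).
Proof.
move=> s1 s2; rewrite of_size_cat !of_size_map; apply/andP; split.
  exact: (of_size_crossc (m := 2) _ s2).
exact: (of_size_crossc (n := 2) s1).
Qed.

Lemma cnorm_torus k c1 c2 : of_size 3 c1 -> of_size 3 c2 ->
  cnorm (torus k c1 c2) <= (cnorm c1 + cnorm c2) * 2 ^+ 5.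
Proof.
move=> s1 s2; rewrite cnorm_cat !cnorm_map addrC mulrDl; apply: lerD.
  have := @cnorm_crossc R _ _ 3 2 c1 [:: (1, [:: 0%N; k])] s1 isT.
  by rewrite /cnorm big_seq1 normr1 mulr1.
have := @cnorm_crossc R _ _ 2 3 [:: (1, [:: 0%N; k])] c2 isT s2.
by rewrite /cnorm big_seq1 normr1 mul1r.
Qed.

(** Shift invariance makes [0, 1] a cycle, so the two halves have boundaries - [z1] x [z2] and [z1]
    x [z2]. [Lsh_Rsh] says that both products are the same chain. *)
Lemma torus_cycle c1 c2 : bounds c1 z1 -> bounds c2 z2 -> cycle (torus 1 c1 c2).
Proof.
move=> [s1 b1] [s2 b2] V f fi; rewrite ev_torus.
rewrite (@eq_ev_size _ _ _ _ (fun y => - cob (Lsh f [:: 0%N; 1%N]) y) 3 _ s2); last first.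
  move=> y sy; rewrite Lsh_cob ?sy; [|by left|by []].
  rewrite /= expr1 scaleN1r subr0; have := Lsh_shift y fi 1 [:: 0%N] => /= ->.
  by rewrite subrr sub0r.
rewrite evN b2; last exact: Lsh_inv.
rewrite (@eq_ev_size _ _ _ _ (fun x => cob (fun w => Rsh f w [:: 0%N; 1%N]) x) 3 _ s1); last first.
  move=> x sx; rewrite Rsh_cob ?sx //=.
  have := Rsh_shift x fi 1 [:: 0%N] => /= ->.
  by rewrite subr0 subrr addr0.
rewrite b1; last exact: Rsh_inv.
by have := Lsh_Rsh f [:: 0%N; 1%N] [:: 0%N; 1%N]; rewrite /= => ->; rewrite addNr.
Qed.

Lemma map_exp_shift V (f : seq G -> V) z : invariant f -> shift_invariant (fun ns => f [seq (z ^+ n)%g | n <- ns]).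
Proof.
move=> fi k s; rewrite -[RHS](fi (z ^+ k)%g) -!map_comp; congr f.
by apply: eq_map => n; rewrite /= expgnDr.
Qed.

Definition powc z n : chain R (seq G) :=
  [seq (w.1, [seq (z ^+ n)%g | n <- w.2]) | w <- powcn R n].

Lemma of_size_powc z n : of_size 3 (powc z n).
Proof. by rewrite of_size_map of_size_powcn. Qed.

Lemma ev_powc V (f : seq G -> V) z n : invariant f ->
  ev (cob f) (powc z n) = n%:R *: f [:: 1%g; z] - f [:: 1%g; (z ^+ n)%g].
Proof.
move=> fi; have /= <- := ev_powcn n (map_exp_shift z fi).
by rewrite ev_map; apply: eq_ev => w; rewrite /= cob_map.
Qed.

Definition multiple z k (c : chain R (seq G)) : chain R (seq G) :=
  cscale k%:R c ++ cscale (-1) (powc z k).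

Lemma ev_multiple V (f : seq G -> V) z k c :
  ev f (multiple z k c) = k%:R *: ev f c - ev f (powc z k).
Proof. by rewrite ev_cat !ev_scale scaleN1r. Qed.

Lemma bounds_multiple z k c : bounds c z ->
  bounds (multiple z k c) (z ^+ k)%g.
Proof.
move=> [sc bc]; split.
  by rewrite of_size_cat !of_size_scale sc of_size_powc.
by move=> V f fi; rewrite ev_multiple ev_powc // bc // subKr.
Qed.

Lemma cnorm_multiple z k c : (0 < k)%N ->
  cnorm (multiple z k c) <= k%:R * (cnorm c + 2).
Proof.
move=> k0; rewrite cnorm_cat !cnorm_scale normrN1 mul1r cnorm_map cnorm_powcn.
rewrite ger0_norm // mulrDr lerD2l mulrDr mulr1 lerD2l.
by rewrite -[1]/(1%:R) ler_nat.
Qed.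

(** [powcn] is a homology from k [0, 1] to [0, k]. Crossing it with [d2], and k times with [c1],
    exchanges the intervals in both halves; the remaining terms in [powc] are the difference between
    k times [c1] or [c2] and [d1] or [d2]. *)
Lemma torus_homologous V (f : seq G -> V) k c1 c2 :
  bounds c1 z1 -> bounds c2 z2 -> invariant f ->
  let d1 := multiple z1 k c1 in let d2 := multiple z2 k c2 in
  (k%:R * k%:R) *: ev f (torus 1 c1 c2) = ev f (torus k d1 d2) +
    ev (cob f) (crossL (powcn R k) d2 ++ cscale k%:R (crossR c1 (powcn R k))).
Proof.
move=> b1 b2 fi d1 d2.
have [s1 e1] := b1; have [sd2 ed2] := bounds_multiple k b2.
have sp := of_size_powcn R k.
have E1 : ev (cob f) (crossL (powcn R k) d2) =
    k%:R *: ev (Lsh f [:: 0%N; 1%N]) d2 - ev (Lsh f [:: 0%N; k]) d2 +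
    ev (fun x => Rsh f x [:: 0%N; k]) (powc z1 k).
  rewrite ev_crossL (@eq_ev_size _ _ _ _ (fun ns =>
    ev (fun y => cob (fun w => Lsh f w y) ns) d2 + ev (cob (Lsh f ns)) d2) _ _ sp).
    rewrite evD; congr (_ + _).
      rewrite ev_swap -evZ -evB; apply: eq_ev => y.
      by rewrite ev_powcn //; exact: Lsh_shift.
    rewrite [RHS]ev_map; apply: eq_ev => ns; rewrite ed2; last exact: Lsh_inv.
    by rewrite -[RHS]Lsh_Rsh.
  move=> ns sns; rewrite -evD; apply: (eq_ev_size sd2) => y sy.
  by rewrite Lsh_cob ?sy ?sns; [rewrite /= sqrrN expr1n scale1r|right|].
have E2 : ev (cob f) (crossR c1 (powcn R k)) =
    ev (Lsh f [:: 0%N; 1%N]) (powc z2 k) +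
    (k%:R *: ev (fun x => Rsh f x [:: 0%N; 1%N]) c1 -
     ev (fun x => Rsh f x [:: 0%N; k]) c1).
  rewrite ev_crossR (@eq_ev_size _ _ _ _ (fun x =>
    ev (fun ns => cob (fun w => Rsh f w ns) x) (powcn R k) +
    ev (cob (Rsh f x)) (powcn R k)) _ _ s1).
    rewrite evD; congr (_ + _).
      rewrite ev_swap [RHS]ev_map; apply: eq_ev => ns.
      rewrite e1; last exact: Rsh_inv.
      by rewrite /= Lsh_Rsh.
    rewrite -evZ -evB; apply: eq_ev => x.
    by rewrite ev_powcn //; exact: Rsh_shift.
  move=> x sx; rewrite -evD; apply: (eq_ev_size sp) => ns sns.
  by rewrite Rsh_cob ?sx ?sns.
rewrite ev_cat ev_scale E1 E2 !ev_torus !ev_multiple.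
move: (ev _ c2) (ev _ c2) (ev _ c1) (ev _ c1) (ev _ (powc _ _)) (ev _ (powc _ _)) (ev _ (powc _ _)).
move=> a b c e g h i; move: (k%:R *: a - i) => X.
rewrite !(scalerDr, scalerN) !scalerA !addrA.
rewrite [RHS](ACl (1*6*2*10*3*7*5*8*4*9)) /=.
by rewrite subrr add0r subrr add0r addNr add0r addNr add0r.
Qed.

End Torus.

Lemma torus_null (R : archiRealFieldType) (G : groupType) (z1 z2 : G) c1 c2 :
  (forall g, commute z1 g) -> (forall g, commute z2 g) ->
  @bounds R G c1 z1 -> @bounds R G c2 z2 -> l1_null 3 (torus z1 z2 1 c1 c2).
Proof.
(* The 4 is twice the 2 of [cnorm_multiple], and [2 ^+ 5] comes from [cnorm_torus]. The norm is at
   most k M before and M / k after division by k^2. *)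
move=> z1C z2C b1 b2 e e0; pose M := (cnorm c1 + cnorm c2 + 4) * 2 ^+ 5 : R.
have M0 : 0 < M by rewrite mulr_gt0 ?exprn_gt0 // ltr_wpDl // addr_ge0 ?cnorm_ge0.
pose k := (Num.bound (M / e)).+1.
have kM : M <= e * k%:R.
  rewrite mulrC -ler_pdivrMr // ltW // (lt_trans (archi_boundP _)) ?ltr_nat //.
  by rewrite divr_ge0 ?ltW.
have k0 : 0 < k%:R :> R by rewrite ltr0n.
have kn0 : k%:R != 0 :> R by rewrite gt_eqF.
have [sd1 _] := bounds_multiple k b1; have [sd2 _] := bounds_multiple k b2.
exists (cscale (k%:R * k%:R)^-1 (torus z1 z2 k (multiple z1 k c1) (multiple z2 k c2))).
exists (cscale (k%:R * k%:R)^-1 (crossL z1 (powcn R k) (multiple z2 k c2) ++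
  cscale k%:R (crossR z2 c1 (powcn R k)))); split.
- by rewrite of_size_scale of_size_torus.
- rewrite of_size_scale of_size_cat of_size_scale !of_size_map.
  rewrite (of_size_crossc (of_size_powcn R k) sd2) /=.
  exact: (of_size_crossc b1.1 (of_size_powcn R k)).
- rewrite cnorm_scale ger0_norm; last by rewrite invr_ge0 mulr_ge0 // ltW.
  rewrite mulrC ler_pdivrMr ?mulr_gt0 //.
  apply: le_trans (cnorm_torus z1 z2 k sd1 sd2) _.
  apply: (@le_trans _ _ (k%:R * M)); last first.
    by rewrite mulrC mulrA ler_wpM2r // ltW.
  rewrite /M (mulrA k%:R (_ + 4)); apply: ler_wpM2r; first exact: exprn_ge0.
  have := @cnorm_multiple R G z1 k c1 isT; have := @cnorm_multiple R G z2 k c2 isT.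
  move: (cnorm _) (cnorm _) (cnorm _) (cnorm _) => a b c d; nra.
move=> V f fi; rewrite !ev_scale -scalerDr -torus_homologous //.
by rewrite scalerA mulVf ?scale1r // mulf_neq0.
Qed.

(** * Chains bounding the central elements *)

Section Relations.
Variables (R : realFieldType) (G : groupType).

Lemma ev_triangle (V : lmodType R) (f : seq G -> V) a g h : invariant f ->
  ev (cob f) [:: (a, [:: 1%g; g; g * h]%g)] =
  a *: (f [:: 1%g; g] + f [:: 1%g; h] - f [:: 1%g; g * h]%g).
Proof.
move=> fi; rewrite ev_seq1 /= subr0 -[f [:: 1; h]%g](fi g) /= mulg1.
by rewrite opprB addrA [X in X - _]addrC.
Qed.

(* In the real first homology u = u^4 and l = l^4, so u, l and u l vanish. *)
Lemma bounds_relation (u l h : G) :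
  (h * u = u ^+ 4 * h)%g -> (l * h = h * l ^+ 4)%g ->
  exists c : chain R (seq G), bounds c ((u * l) ^+ 6)%g.
Proof.
move=> hu lh; pose tri (a : R) (g k : G) := [:: (a, [:: 1%g; g; g * k]%g)].
(* By the relations with [h], the boundaries of [cu] and [cl] are three times the loops [u] and [l];
   this is [key] below. *)
pose cu := powc R u 4 ++ tri (-1) h u ++ tri 1 (u ^+ 4)%g h.
pose cl := powc R l 4 ++ tri (-1) l h ++ tri 1 h (l ^+ 4)%g.
(* A third of [cu] and [cl] bounds [u] and [l], the triangle passes to [u * l], and [powc] to its
   sixth power. *)
exists (cscale 6 (cscale 3^-1 (cu ++ cl) ++ tri (-1) u l) ++
        cscale (-1) (powc R (u * l)%g 6)).
split.
  by rewrite !of_size_cat !of_size_scale !of_size_cat !of_size_scale !of_size_cat !of_size_powc.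
move=> V f fi; rewrite !(ev_cat, ev_scale, ev_powc _ _ fi, ev_triangle _ _ _ fi) hu lh.
have key (a a4 b t : V) :
    4 *: a - a4 + (-1 *: (b + a - t) + 1 *: (a4 + b - t)) = 3 *: a.
  rewrite scaleN1r scale1r !opprD opprK !addrA (ACl (1*4*2*6*3*7*5*8)) /=.
  by rewrite addrK !subrK -{2}[a]scale1r -scalerBl; congr (_ *: _); ring.
rewrite key [f [:: 1; l]%g + _]addrC [f [:: 1; h]%g + f [:: 1; l ^+ 4]%g]addrC key.
rewrite -scalerDr scalerA mulVf ?pnatr_eq0 // scale1r !scaleN1r subKr subKr.
by [].
Qed.

End Relations.

Section Elements.
Variables (K : signed_valuation) (R : realFieldType) (s : K).
Hypothesis s1 : sv_sg s = 1.

Implicit Types g h k : sl2 K.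

Let s0 : s != 0. Proof. by rewrite -sv_sg_eq0 s1. Qed.
Let two0 : (2 : K) != 0. Proof. by rewrite -sv_sg_eq0 sv_sg2. Qed.

Definition mx2 (a b c d : K) (H : det1 (a, b, c, d)) : sl2 K := exist _ (a, b, c, d) H.

Lemma mx2_mul a b c d H a' b' c' d' H' a'' b'' c'' d'' H'' :
  a * a' + b * c' = a'' -> a * b' + b * d' = b'' ->
  c * a' + d * c' = c'' -> c * b' + d * d' = d'' ->
  (@mx2 a b c d H * @mx2 a' b' c' d' H' = @mx2 a'' b'' c'' d'' H'')%g.
Proof.
by move=> E1 E2 E3 E4; apply: val_inj; rewrite /= /sl2_mul_val /= E1 E2 E3 E4.
Qed.

Lemma wedge_mx2 a b c d H a' b' c' d' H' :
  wedge (@mx2 a b c d H) (@mx2 a' b' c' d' H') = a * c' - c * a'.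
Proof. by []. Qed.

Lemma det_upper (x : K) : det1 (1, x, 0, 1). Proof. by rewrite /det1 /= mulr1 mulr0 subr0. Qed.
Lemma det_lower (x : K) : det1 (1, 0, x, 1). Proof. by rewrite /det1 /= mulr1 mul0r subr0. Qed.
Lemma det_diag : @det1 K (2, 0, 0, 2^-1).
Proof. by rewrite /det1 /= mulr0 subr0 divff. Qed.
Lemma det_w : @det1 K (0, s, - s^-1, 1).
Proof. by rewrite /det1 /= mul0r sub0r mulrN opprK divff. Qed.
Lemma det_w2 : @det1 K (-1, s, - s^-1, 0).
Proof. by rewrite /det1 /= mulr0 sub0r mulrN opprK divff. Qed.
Lemma det_N1 : @det1 K (-1, 0, 0, -1).
Proof. by rewrite /det1 /= mulr0 subr0 mulrNN mulr1. Qed.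

Definition up (x : K) : sl2 K := mx2 (det_upper x).
Definition low (x : K) : sl2 K := mx2 (det_lower x).
Definition diag2 : sl2 K := mx2 det_diag.
Definition rot : sl2 K := mx2 det_w.
Definition rot2 : sl2 K := mx2 det_w2.
Definition sl2N1 : sl2 K := mx2 det_N1.

(** One of [e1] and [e2] is 1 and the other 0, according to the parity of the degree of [s]. *)
Let p := odd `|sv_deg s|.
Let e1 : R := (ecoef (Some (false, p)))%:~R.
Let e2 : R := (ocoef (Some (false, p)))%:~R.

Lemma rcl1 : rcl (1 : K) = Some (false, false).
Proof.
have := rclM (1 : K) 1; have : rcl (1 : K) != None by rewrite rcl_None oner_eq0.
by rewrite mulr1; case: (rcl 1) => [[[] []]|].
Qed.

Lemma rclV : rcl s^-1 = Some (false, p).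
Proof.
have := rclM s s^-1; rewrite divff // rcl1 (rcl_pos s1) -/p.
by case: (rcl s^-1) => [[[] []]|] //=; case: p.
Qed.

Lemma rcl2V : rcl (2 * s^-1) = Some (false, p).
Proof. by rewrite rclM (rcl_pos (sv_sg2 K)) sv_deg2 rclV. Qed.

Lemma treeT1 g h : treeT 1%g g h =
  tri (rcl ((val g).1.2 : K)) (rcl (wedge g h)) (rcl ((val h).1.2 : K)).
Proof. by rewrite /treeT /wedge /= !mul1r !mul0r !subr0. Qed.

Lemma treeT1_Some g h : rcl ((val g).1.2 : K) = Some (true, p) ->
  rcl (wedge g h) = Some (true, p) -> rcl ((val h).1.2 : K) = Some (true, p) ->
  treeT 1%g g h = Some (false, p).
Proof. by rewrite treeT1 => -> -> ->; rewrite /tri /=; case: p. Qed.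

Lemma treeT1_None g h :
  [|| ((val g).1.2 : K) == 0, wedge g h == 0 | ((val h).1.2 : K) == 0] -> treeT 1%g g h = None.
Proof.
have smulN a : smul a None = None by case: a => [[]|].
by rewrite treeT1 -!rcl_None /tri; case/or3P => /eqP ->; rewrite /= ?smulN.
Qed.

Local Notation cx g r t := ((g, r, t) : cext K R).

Lemma cx_mul0 g r t h r' t' k :
  (g * h)%g = k -> [|| ((val g).1.2 : K) == 0, wedge g k == 0 | ((val k).1.2 : K) == 0] ->
  (cx g r t * cx h r' t')%g = cx k (r + r') (t + t').
Proof.
move=> <- /treeT1_None E; rewrite cext_mulE /cext_mul /Te /To /= E /=.
by rewrite !addr0.
Qed.

Lemma cx_mul1 g r t h r' t' k : (g * h)%g = k ->
  rcl ((val g).1.2 : K) = Some (true, p) -> rcl (wedge g k) = Some (true, p) ->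
  rcl ((val k).1.2 : K) = Some (true, p) ->
  (cx g r t * cx h r' t')%g = cx k (r + r' + e1) (t + t' + e2).
Proof.
move=> <- gc gh hc; have E := treeT1_Some gc gh hc.
by rewrite cext_mulE /cext_mul /Te /To /= E.
Qed.

Definition ux : cext K R := cx (up s) 0 0.
(** Squaring a lift of such a lower unipotent adds [e1] and [e2]. With this choice the central part
    is the same for [lx], its square and its fourth power, as the relation [lx_hx] demands. *)
Definition lx : cext K R := cx (low (- s^-1)) (- e1) (- e2).
Definition hx : cext K R := cx diag2 0 0.

Lemma ux4 : (ux ^+ 4)%g = cx (up (4 * s)) 0 0.
Proof.
have ux2 : (ux * ux)%g = cx (up (2 * s)) 0 0.
  rewrite (@cx_mul0 _ _ _ _ _ _ (up (2 * s))) ?eqxx ?addr0 //.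
  by apply: mx2_mul; ring.
rewrite -[4%N]/(2 + 2)%N expgnDr expg2 ux2.
rewrite (@cx_mul0 _ _ _ _ _ _ (up (4 * s))) ?eqxx ?addr0 //.
by apply: mx2_mul; ring.
Qed.

Lemma lx4 : (lx ^+ 4)%g = cx (low (- (4 * s^-1))) (- e1) (- e2).
Proof.
have nV : rcl (- s^-1) = Some (true, p) by rewrite rclN rclV.
have n2V : rcl (- (2 * s^-1)) = Some (true, p) by rewrite rclN rcl2V.
have rcl4 : rcl (- (4 * s^-1)) = Some (true, p).
  by rewrite rclN -[4]/((2 * 2)%:R) natrM -mulrA rclM rcl2V (rcl_pos (sv_sg2 K)) sv_deg2.
have lx2 : (lx * lx)%g = cx (low (- (2 * s^-1))) (- e1) (- e2).
  rewrite (@cx_mul1 _ _ _ _ _ _ (low (- (2 * s^-1)))) //.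
  - by congr (_, _, _); ring.
  - by apply: mx2_mul; ring.
  by rewrite wedge_mx2 [X in rcl X](_ : _ = - s^-1) //; ring.
rewrite -[4%N]/(2 + 2)%N expgnDr expg2 lx2.
rewrite (@cx_mul1 _ _ _ _ _ _ (low (- (4 * s^-1)))) //.
- by congr (_, _, _); ring.
- by apply: mx2_mul; ring.
by rewrite wedge_mx2 [X in rcl X](_ : _ = - (2 * s^-1)) //; ring.
Qed.

Lemma hx_ux : (hx * ux = ux ^+ 4 * hx)%g.
Proof.
have D : @det1 K (2, 2 * s, 0, 2^-1) by rewrite /det1 /= mulr0 subr0 divff.
rewrite ux4 (@cx_mul0 _ _ _ _ _ _ (mx2 D)) ?eqxx //; last by apply: mx2_mul; ring.
rewrite (@cx_mul0 _ _ _ _ _ _ (mx2 D)) ?eqxx //.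
by apply: mx2_mul; field; rewrite ?s0 ?two0.
Qed.

Lemma lx_hx : (lx * hx = hx * lx ^+ 4)%g.
Proof.
have D : @det1 K (2, 0, - (2 * s^-1), 2^-1) by rewrite /det1 /= mul0r subr0 divff.
rewrite lx4 (@cx_mul0 _ _ _ _ _ _ (mx2 D)); last 2 first.
- by apply: mx2_mul; ring.
- by rewrite wedge_mx2 [X in [|| _, X | _]](_ : _ = true) ?orbT //; apply/eqP; ring.
rewrite (@cx_mul0 _ _ _ _ _ _ (mx2 D)) ?eqxx //.
  by congr (_, _, _); ring.
by apply: mx2_mul; field; rewrite ?s0 ?two0.
Qed.

(** The matrix [rot] has third power -1. Only its squaring picks up [e1] and [e2], as the other
    products meet coinciding lines. The central parts of the powers 1, 2, 3, 6 are -1, -1, -2, -4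
    times [e1] and [e2]. *)
Lemma ux_lx6 : ((ux * lx) ^+ 6)%g = cx 1%g (- (4 * e1)) (- (4 * e2)).
Proof.
have nV : rcl (- s^-1) = Some (true, p) by rewrite rclN rclV.
have w1 : (ux * lx)%g = cx rot (- e1) (- e2).
  rewrite (@cx_mul0 _ _ _ _ _ _ rot) ?eqxx //; first by congr (_, _, _); ring.
  by apply: mx2_mul; field; rewrite ?s0 ?two0.
have w2 : (cx rot (- e1) (- e2) ^+ 2)%g = cx rot2 (- e1) (- e2).
  rewrite expg2 (@cx_mul1 _ _ _ _ _ _ rot2) //.
  - by congr (_, _, _); ring.
  - by apply: mx2_mul; field; rewrite ?s0 ?two0.
  by rewrite wedge_mx2 [X in rcl X](_ : _ = - s^-1) //; ring.
have w3 : (cx rot (- e1) (- e2) ^+ 3)%g = cx sl2N1 (- (2 * e1)) (- (2 * e2)).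
  rewrite expgSr w2 (@cx_mul0 _ _ _ _ _ _ sl2N1) ?eqxx ?orbT //.
    by congr (_, _, _); ring.
  by apply: mx2_mul; field; rewrite ?s0 ?two0.
rewrite w1 -[6%N]/(3 + 3)%N expgnDr w3 (@cx_mul0 _ _ _ _ _ _ 1%g) ?eqxx //.
  by congr (_, _, _); ring.
by apply: val_inj; rewrite /= /sl2_mul_val /=; congr (_, _, _, _); ring.
Qed.

Lemma bounds_central : exists c : chain R (seq (cext K R)),
  bounds c (cx 1%g (- (4 * e1)) (- (4 * e2))).
Proof.
by have := bounds_relation R hx_ux lx_hx; rewrite ux_lx6.
Qed.

End Elements.

Section CentralExtensionClasses.
Variables (K : signed_valuation) (R : archiRealFieldType).
Local Notation cx g r t := ((g, r, t) : cext K R).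
Implicit Types x y : cext K R.

Lemma central_mul r t x : (cx 1%g r t * x)%g = cx x.1.1 (r + x.1.2) (t + x.2).
Proof. by case: x => [[g r'] t']; rewrite cext_mulE /cext_mul /= Te_ggl To_ggl mul1g !addr0. Qed.

Lemma mul_central r t x : (x * cx 1%g r t)%g = cx x.1.1 (x.1.2 + r) (x.2 + t).
Proof. by case: x => [[g r'] t']; rewrite cext_mulE /cext_mul /= mulg1 Te_ggr To_ggr !addr0. Qed.

Lemma central_commute r t x : commute (cx 1%g r t) x.
Proof. by rewrite /commute central_mul mul_central addrC [t + _]addrC. Qed.

Lemma exists_even_central : exists c : chain R (seq (cext K R)),
  bounds c (cx 1%g (- 4) 0).
Proof.
have sg1 : sv_sg (1 : K) = 1 by have := sv_sg_sqr (oner_neq0 K); rewrite -sv_sgM mulr1.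
have deg1 : sv_deg (1 : K) = 0.
  apply: (addrI (sv_deg (1 : K))); rewrite addr0 -sv_degM ?oner_neq0 //.
  by rewrite mulr1.
have [c] := bounds_central R sg1; rewrite deg1 /= expr0 mulr1 mulr0 oppr0.
by exists c.
Qed.

Lemma exists_odd_central : exists c : chain R (seq (cext K R)),
  bounds c (cx 1%g 0 (- 4)).
Proof.
have [c] := bounds_central R (sv_sg_unif K).
rewrite sv_deg_unif /= expr0 mulr1 mulr0 oppr0.
by exists c.
Qed.

(** [z] acts trivially on the tree, so [kappa] sees repeated vertices in all three shuffles, and
    [To] does unless the step along [z] comes first. *)
Lemma Phi_Lsh a y0 y1 y2 :
  Lsh (cx 1%g a 0) (@Phi K R : _ -> R^o) [:: 0%N; 1%N] [:: y0; y1; y2] =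
  - (a * To R y0.1.1 y1.1.1 y2.1.1).
Proof.
set z := cx 1%g a 0; rewrite /Lsh /shuf /= !ev_cons ev_nil /=.
have L0 y : Lmul z (0%N, y) = y by rewrite /Lmul expg0 mul1g.
have L1 y : Lmul z (1%N, y) = (z * y)%g by rewrite /Lmul expg1.
rewrite !L0 !L1 !Phi4.
have zE y : (z * y)%g.1.1 = y.1.1 by rewrite central_mul.
have -> : (y0^-1 * (z * y0))%g = z by rewrite central_commute mulKg.
rewrite !zE kappa_degenerate01 kappa_degenerate12 kappa_degenerate23 /=.
rewrite To_ggl To_ggr /GRing.scale /=; ring.
Qed.

(** As in [Phi_Lsh], but the only edge that could contribute has [theta1] equal to 0, since this [z]
    lies in the second central copy. *)
Lemma Phi_Rsh b x0 x1 x2 :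
  Rsh (cx 1%g 0 b) (@Phi K R : _ -> R^o) [:: x0; x1; x2] [:: 0%N; 1%N] = 0.
Proof.
set z := cx 1%g 0 b; rewrite /Rsh /shuf /= !ev_cons ev_nil /=.
have R0 y : Rmul z (y, 0%N) = y by rewrite /Rmul expg0 mulg1.
have R1 y : Rmul z (y, 1%N) = (y * z)%g by rewrite /Rmul expg1.
rewrite !R0 !R1 !Phi4.
have zE y : (y * z)%g.1.1 = y.1.1 by rewrite mul_central.
have -> : (x0^-1 * (x0 * z))%g = z by rewrite mulKg.
rewrite !zE kappa_degenerate01 kappa_degenerate12 kappa_degenerate23 /=.
rewrite To_ggl To_ggr /GRing.scale /=; ring.
Qed.

Lemma ev_Phi_torus a b c1 c2 :
  bounds c1 (cx 1%g a 0) -> bounds c2 (cx 1%g 0 b) ->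
  ev (@Phi K R : _ -> R^o) (torus (cx 1%g a 0) (cx 1%g 0 b) 1 c1 c2) = a * b.
Proof.
move=> [s1 b1] [s2 b2]; rewrite ev_torus.
rewrite [X in _ + X](@eq_ev_size _ _ _ _ (fun=> 0) _ _ s1); last first.
  by move=> [|x0 [|x1 [|x2 [|? ?]]]] // _; rewrite Phi_Rsh.
rewrite [X in _ + X]ev_eq0 ?addr0 //.
rewrite (@eq_ev_size _ _ _ _ (fun w => a *: (cob (@theta2 K R : _ -> R^o) w)) _ _ s2); last first.
  by move=> [|x0 [|x1 [|x2 [|? ?]]]] // _; rewrite Phi_Lsh cob_theta2 /GRing.scale /= mulrN.
rewrite evZ b2 ?theta2_inv //; last exact: theta2_inv.
by rewrite /theta2 invg1 mul1g.
Qed.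

Lemma null_detectable3 : null_detectable R 3.
Proof.
have [c1 b1] := exists_even_central; have [c2 b2] := exists_odd_central.
exists (cext K R), (@Phi K R), (torus (cx 1%g (- 4) 0) (cx 1%g 0 (- 4)) 1 c1 c2).
split; last by apply: torus_null => //; exact: central_commute.
split.
- exact: Phi_inv.
- exact: Phi_cocycle.
- exact: Phi_normalized.
- exact: Phi_pattern_bounded.
- by apply: of_size_torus; [case: b1 | case: b2].
- by apply: torus_cycle => //; exact: central_commute.
by rewrite ev_Phi_torus // mulf_neq0 // oppr_eq0 pnatr_eq0.
Qed.

Definition te (s : seq (sl2 K)) : R := if s is [:: g; h; k] then Te R g h k else 0.

Lemma detectable2 : detectable R 2.
Proof.
have [c [sc bc]] := exists_even_central; pose proj (x : cext K R) : sl2 K := x.1.1.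
have te_le1 s : `|te s| <= 1.
  by case: s => [|g [|h [|k [|? ?]]]] /=; rewrite ?normr0 ?ler01 ?Te_le1.
(* The projection kills the central element, so the image of [c] has the degenerate edge [1; 1] as
   its boundary, which the extra triangle removes. *)
exists (sl2 K), te, ([seq (w.1, map proj w.2) | w <- c] ++ [:: (-1, [:: 1; 1; 1]%g)]).
split.
- by move=> x [|g [|h [|k [|? ?]]]] //=; rewrite Te_mul.
- move=> [|g [|h [|k [|l [|? ?]]]]] // _.
  by have := Te_cocycle R g h k l; rewrite /= => E; rewrite -[RHS]E; ring.
- move=> [|x [|y s1]] a s2 /=.
  + by case: s2 => [|b [|? ?]] //; rewrite Te_ggl.
  + by case: s2 => [|? ?] //; rewrite Te_ggr.
  + by case: s1 => [|? [|? ?]].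
- exact: bounded_pattern_bounded te_le1.
- by rewrite of_size_cat of_size_map sc.
- move=> V f fi; rewrite ev_cat ev_map ev_seq1 scaleN1r /= subr0 subrr subr0.
  rewrite (@eq_ev _ _ _ _ (cob (fun w => f (map proj w)))); last by move=> w; rewrite /= cob_map.
  rewrite bc /= ?subrr //.
  move=> g s; rewrite -[RHS](fi (proj g)) -!map_comp; congr f.
rewrite ev_cat ev_map ev_seq1 /= Te_ggl scaler0 addr0.
rewrite (@eq_ev_size _ _ _ _ (fun s => - cob (@theta1 K R : _ -> R^o) s) _ _ sc); last first.
  by move=> [|x0 [|x1 [|x2 [|? ?]]]] // _; rewrite cob_theta1 opprK.
rewrite evN bc; last exact: theta1_inv.
by rewrite /theta1 invg1 mul1g opprK pnatr_eq0.
Qed.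

End CentralExtensionClasses.

Local Open Scope classical_set_scope.
Local Open Scope ring_scope.

(** * Lifts of maps from simplices *)

Section Simplex.
Variable R : realType.

Lemma nbhs_simplexP n (x : std_simplex R n) (A : set (std_simplex R n)) :
  nbhs x A <-> exists2 r, 0 < r & forall y, `|val x - val y| < r -> A y.
Proof.
split.
  case=> _ [[B oB <-] Bx sBA].
  have : nbhs (set_val x) B by apply: open_nbhs_nbhs; split.
  move=> /nbhs_ballP[r r0 rB]; exists r => // y xy; apply: sBA; apply: rB.
  by rewrite -ball_normE.
case=> r r0 rA.
have xr : nbhs (set_val x) (ball (val x) r) by exact: nbhsx_ballx.
have : nbhs x (set_val @^-1` ball (val x) r).
  exact: (@initial_continuous _ _ (set_val : std_simplex R n -> 'rV[R]_n.+1) x _ xr).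
by apply: filterS => y; rewrite /= -ball_normE => /rA.
Qed.

Lemma entry_le_norm n (v : 'rV[R]_n) i : `|v 0 i| <= `|v|.
Proof.
have /mapP[j jn ->] : `|v 0 i| \in [seq `|v x.1 x.2| | x : 'I_1 * 'I_n].
  by apply/mapP; exists (0, i) => //=; rewrite mem_enum.
by rewrite [leRHS]/Num.Def.normr /= mx_normrE; apply/bigmax_geP; right => /=; exists j.
Qed.

Lemma simplex_entry_ge0 n (x : std_simplex R n) i : 0 <= val x 0 i.
Proof. by have [x0 _] := set_valP x. Qed.

Lemma simplex_entry_le1 n (x : std_simplex R n) i : val x 0 i <= 1.
Proof.
have [x0 <-] := set_valP x; rewrite (bigD1 i) //= lerDl.
by apply: sumr_ge0 => j _; exact: x0.
Qed.

Lemma simplex_dist_le1 n (x y : std_simplex R n) : `|val x - val y| <= 1.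
Proof.
rewrite [leLHS]/Num.Def.normr /= mx_normrE; apply: bigmax_le => // -[i j] _ /=.
rewrite ord1 !mxE.
have := simplex_entry_ge0 x j; have := simplex_entry_le1 x j.
have := simplex_entry_ge0 y j; have := simplex_entry_le1 y j.
by rewrite ler_norml => *; apply/andP; split; lra.
Qed.

Lemma vertex_simplex n (i : 'I_n.+1) : \row_j (j == i)%:R \in std_simplex R n.
Proof.
apply/mem_set; split=> [j|]; first by rewrite mxE ler0n.
by rewrite (bigD1 i) //= mxE eqxx big1 ?addr0 // => j /negPf ji; rewrite mxE ji.
Qed.

Definition vertex n (i : 'I_n.+1) : std_simplex R n :=
  exist _ (\row_j (j == i)%:R) (vertex_simplex i).

Lemma simplex_compact n : compact (std_simplex R n).
Proof.
apply: bounded_closed_compact.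
  exists 1; split=> // e e1 v v1; apply: (le_trans _ (ltW e1)).
  rewrite [leLHS]/Num.Def.normr /= mx_normrE; apply: bigmax_le => // -[i j] _ /=.
  have := simplex_entry_le1 (exist _ v (mem_set v1)) j.
  have := simplex_entry_ge0 (exist _ v (mem_set v1)) j.
  by rewrite ord1 ler_norml /= => v0 vl1; apply/andP; split; lra.
have -> : std_simplex R n = (\bigcap_i [set v : 'rV[R]_n.+1 | 0 <= v 0 i]) `&`
    [set v : 'rV[R]_n.+1 | \sum_i v 0 i = 1].
  by apply/seteqP; split=> v [] v0 v1; split=> // i; [move=> _|]; exact: v0.
apply: closedI.
  apply: closed_bigI => i _.
  apply: (@closed_comp _ _ (fun v : 'rV[R]_n.+1 => v 0 i) [set x | 0 <= x]).
    by move=> v _; exact: coord_continuous.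
  exact: closed_ge.
apply: (@closed_comp _ _ (fun v : 'rV[R]_n.+1 => \sum_i v 0 i) [set x | x = 1]).
  have sum_cont : continuous (fun v : 'rV[R]_n.+1 => \sum_i v 0 i).
    apply: continuous_big => [|i _]; first exact: add_continuous.
    exact: coord_continuous.
  by move=> v _; exact: sum_cont.
exact: closed_eq.
Qed.

Lemma locally_constant (T : Type) (h : R -> T) :
  (forall s, \forall s' \near s, h s' = h s) -> forall a b, h a = h b.
Proof.
move=> hl a b.
have cR : connected [set: R] by apply/connected_intervalP => x y _ _ z _.
have oA (A : set T) : open [set s | A (h s)].
  by rewrite openE => s As; apply: filterS (hl s) => s' /= ->.
suff : [set s | h s = h a] = setT by move=> /seteqP[_ /(_ b I)] /= ->.
apply: cR; first by exists a.
  by exists [set s | h s = h a]; rewrite ?setTI //; exact: (oA [set x | x = h a]).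
exists [set s | h s = h a]; rewrite ?setTI //.
have -> : [set s | h s = h a] = ~` [set s | h s <> h a].
  by apply/seteqP; split=> s /=; [move=> -> []|move=> /contrapT].
by apply: open_closedC; exact: (oA [set x | x <> h a]).
Qed.

(** Extends segments to the whole real line, whose connectedness is used in [locally_constant]. *)
Definition clamp (s : R) : R := Num.max 0 (Num.min 1 s).

Lemma clamp_in s : 0 <= clamp s <= 1.
Proof. by rewrite /clamp /Order.max /Order.min; do !case: ifP; lra. Qed.

Lemma clamp_id s : 0 <= s <= 1 -> clamp s = s.
Proof. by rewrite /clamp /Order.max /Order.min; do !case: ifP; lra. Qed.

Lemma clamp_lip s s' : `|clamp s - clamp s'| <= `|s - s'|.
Proof.
have := ler_norm (s - s'); have := ler_norm (s' - s); rewrite distrC ler_norml.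
rewrite /clamp; move: `|_| => a.
by case: (lerP 1 s) => ?; case: (lerP 1 s') => ?; rewrite ?(max_r ler01);
  case: (lerP 0 s) => ?; case: (lerP 0 s') => ?; lra.
Qed.

Lemma lerp_simplex n (x y : std_simplex R n) s :
  (1 - clamp s) *: val x + clamp s *: val y \in std_simplex R n.
Proof.
have /andP[s0 s1] := clamp_in s; apply/mem_set; split=> [i|].
  by rewrite !mxE addr_ge0 ?mulr_ge0 ?subr_ge0 // simplex_entry_ge0.
have [[_ x1] [_ y1]] := (set_valP x, set_valP y).
under eq_bigr do rewrite !mxE.
by rewrite big_split /= -!mulr_sumr x1 y1 !mulr1 subrK.
Qed.

Definition lerp n (x y : std_simplex R n) s : std_simplex R n :=
  exist _ ((1 - clamp s) *: val x + clamp s *: val y) (lerp_simplex x y s).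

Lemma lerp0 n (x y : std_simplex R n) : lerp x y 0 = x.
Proof.
by apply: val_inj; rewrite /= clamp_id ?lexx ?ler01 // subr0 scale1r scale0r addr0.
Qed.

Lemma lerp1 n (x y : std_simplex R n) : lerp x y 1 = y.
Proof.
by apply: val_inj; rewrite /= clamp_id ?lexx ?ler01 // subrr scale1r scale0r add0r.
Qed.

Lemma lerp_dist n (x y : std_simplex R n) s s' :
  `|val (lerp x y s) - val (lerp x y s')| <= `|s - s'|.
Proof.
have -> : val (lerp x y s) - val (lerp x y s') =
    (clamp s - clamp s') *: (val y - val x).
  by apply/rowP => i; rewrite !mxE; ring.
rewrite normrZ -[leRHS]mulr1; apply: ler_pM => //; first exact: clamp_lip.
exact: simplex_dist_le1.
Qed.

Lemma lerp_dist2 n (x y y' : std_simplex R n) s :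
  `|val (lerp x y s) - val (lerp x y' s)| <= `|val y - val y'|.
Proof.
have -> : val (lerp x y s) - val (lerp x y' s) = clamp s *: (val y - val y').
  by apply/rowP => i; rewrite !mxE; ring.
have /andP[s0 s1] := clamp_in s.
by rewrite normrZ (ger0_norm s0) -[leRHS]mul1r ler_wpM2r.
Qed.

Lemma lerp_ball n (p x y : std_simplex R n) r s :
  `|val p - val x| < r -> `|val p - val y| < r -> `|val p - val (lerp x y s)| < r.
Proof.
move=> px py; have /andP[s0 s1] := clamp_in s.
have -> : val p - val (lerp x y s) =
    (1 - clamp s) *: (val p - val x) + clamp s *: (val p - val y).
  by apply/rowP => i; rewrite !mxE; ring.
apply: le_lt_trans (ler_normD _ _) _; rewrite !normrZ.
rewrite (ger0_norm s0) ger0_norm ?subr_ge0 //.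
move: px py; set a := `|_|; set b := `|_| => ar br.
have : (1 - clamp s) * a + clamp s * b <= Num.max a b by case: (lerP a b) => ?; nra.
by move=> /le_lt_trans; apply; rewrite gt_max ar.
Qed.

Lemma lerp_continuous n (x y : std_simplex R n) : continuous (lerp x y).
Proof.
move=> s A /nbhs_simplexP[r r0 rA]; apply/nbhs_ballP; exists r => // s' /= ss'.
by apply: rA; apply: le_lt_trans (lerp_dist _ _ _ _) _; rewrite -ball_normE in ss'.
Qed.

Lemma simplex_locally_constant n (T : Type) (h : std_simplex R n -> T) :
  (forall x, \forall y \near x, h y = h x) -> forall x y, h x = h y.
Proof.
move=> hl x y; rewrite -[in LHS](lerp0 x y) -[in RHS](lerp1 x y).
apply: (locally_constant (h := h \o lerp x y)) => s.
exact: (@lerp_continuous _ x y s _ (hl _)).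
Qed.

End Simplex.

(* The arrows [T x y a] are the deck transformations carrying the sheet through
   a lift of [x] to the sheet through a lift of a nearby point [y]. *)
Record transport (X : topologicalType) (G : groupType) (T : X -> X -> G -> Prop) := {
  transport_trans : forall x y z a b, T x y a -> T y z b -> T x z (b * a)%g;
  transport_uniq : forall x y a b, T x y a -> T x y b -> a = b;
  transport_near : forall x, \forall y \near x, exists a, T x y a }.

Section Lift.
Variables (R : realType) (X : topologicalType) (G : groupType).
Variables (T : X -> X -> G -> Prop) (tr : transport T).

Definition is_lift n (s : std_simplex R n -> X) (g : std_simplex R n -> G) :=
  forall x, \forall y \near x, T (s x) (s y) (g y * (g x)^-1)%g.

Lemma lift_comp m n (s : std_simplex R n -> X) g
    (u : std_simplex R m -> std_simplex R n) :
  continuous u -> is_lift s g -> is_lift (s \o u) (g \o u).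
Proof. by move=> uc sg x; exact: (uc x _ (sg (u x))). Qed.

Lemma lift_uniq n (s : std_simplex R n -> X) g g' :
  is_lift s g -> is_lift s g' -> exists c, forall x, g' x = (g x * c)%g.
Proof.
move=> sg sg'.
have hl x : \forall y \near x, ((g y)^-1 * g' y = (g x)^-1 * g' x)%g.
  apply: filterS (filterI (sg x) (sg' x)) => y [/(transport_uniq tr) e /e].
  move=> /(congr1 (fun a => a * g' x)%g); rewrite mulgVK => <-.
  by rewrite !mulgA mulVg mul1g.
exists ((g (vertex R 0))^-1 * g' (vertex R 0))%g => x.
by rewrite (simplex_locally_constant hl _ x) mulVKg.
Qed.

Section Existence.
Variables (n : nat) (s : std_simplex R n -> X).
Hypothesis sc : continuous s.
Local Notation D := (std_simplex R n).
Local Notation dist x y := `|val (x : D) - val (y : D)|.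

Lemma lebesgue_number : exists2 r, 0 < r & forall p : D, exists x : D,
  forall q : D, dist p q < r -> exists a, T (s x) (s q) a.
Proof.
have /compact_near_coveringP cK := @simplex_compact R n.
have near_r : \forall r \near 0^'+, std_simplex R n `<=` [set v |
    exists x : D, forall q : D, `|v - val q| < r -> exists a, T (s x) (s q) a].
  apply: cK => v Dv; pose x : D := exist _ v (mem_set Dv).
  have /nbhs_simplexP[r r0 rT] := sc (transport_near tr (s x)).
  have r20 : 0 < r / 2 by rewrite divr_gt0.
  exists (ball v (r / 2), [set e | e < r / 2]).
    split; first exact: nbhsx_ballx.
    exact: nbhs_right_lt.
  move=> [w e] [/= vw er]; exists x => q wq; apply: rT.
  rewrite -ball_normE /= in vw.
  have -> : v - val q = (v - w) + (w - val q) by rewrite addrA subrK.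
  apply: le_lt_trans (ler_normD _ _) _; rewrite (splitr r); lra.
have [r [rT r0]] := filter_ex (filterI near_r (nbhs_right_gt 0)).
exists r => // p; have /rT := set_valP p; exact.
Qed.

(** Multiply transports along the segment from a fixed vertex to [y], cut into [N] short steps. By
    convexity small triangles have trivial holonomy, so the values at nearby end points differ by
    the local transport. *)
Lemma exists_lift : exists g, is_lift s g.
Proof.
have [r r0 /choice[f fT]] := lebesgue_number.
pose loc p q : G := xget 1%g [set a | T (s (f p)) (s q) a].
have locP p q : dist p q < r -> T (s (f p)) (s q) (loc p q).
  by rewrite /loc => /fT[a Ta]; case: xgetP => [b _ /=|/(_ a)].
have loc_trans p q y b : dist p q < r -> dist p y < r -> T (s q) (s y) b ->
    loc p y = (b * loc p q)%g.
  move=> /locP pq /locP py qy.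
  exact: (transport_uniq tr) py (transport_trans tr pq qy).
pose tau p q := (loc p q * (loc p p)^-1)%g.
have dist0 p : dist p p < r by rewrite subrr normr0.
(* Transport between nearby points does not depend on the ball that is used: the comparison [h] of
   the balls of [q] and [p] is locally constant along the segment from [q] to [w], which stays in
   both. *)
have loc_tau p q w : dist p q < r -> dist p w < r -> dist q w < r ->
    (loc p w * (loc p q)^-1)%g = tau q w.
  move=> pq pw qw; pose h t := ((loc q (lerp q w t))^-1 * loc p (lerp q w t))%g.
  have hl t : \forall t' \near t, h t' = h t.
    have nz := sc (transport_near tr (s (lerp q w t))).
    have nt : \forall t' \near t, exists b, T (s (lerp q w t)) (s (lerp q w t')) b.
      exact: (@lerp_continuous _ _ q w t _ nz).
    apply: filterS nt => t' [b Tb]; rewrite /h.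
    rewrite !(loc_trans _ _ _ _ _ _ Tb); do ?[exact: lerp_ball].
    by rewrite invgM -mulgA mulKg.
  have := locally_constant hl 0 1; rewrite /h lerp0 lerp1 /tau => e.
  apply: (@mulgI _ (loc q w)^-1%g); rewrite mulgA -e mulgK mulKg.
  by [].
have tauM p q w : dist p q < r -> dist p w < r -> dist q w < r ->
    (tau q w * tau p q = tau p w)%g.
  by move=> pq pw qw; rewrite -(loc_tau p) // /tau mulgA mulgVK.
(* Segments have length at most 1 in the sup norm, so a step is shorter than r / 2, and a step and a
   rung of the ladder together stay below [r]. *)
pose N := Num.bound (2 / r); pose e := vertex R (0 : 'I_n.+1).
have r20 : 0 < r / 2 by rewrite divr_gt0.
have N0 : 0 < N%:R :> R.
  by apply: le_lt_trans (archi_boundP _); rewrite divr_ge0 // ltW.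
have Nr : N%:R^-1 < r / 2.
  rewrite -[r / 2]invrK ltf_pV2 ?posrE ?invr_gt0 //.
  by rewrite invf_div archi_boundP // divr_ge0 // ltW.
pose x y k := lerp e y (k%:R / N%:R).
have xS y k : dist (x y k) (x y k.+1) < r / 2.
  apply: le_lt_trans (lerp_dist _ _ _ _) _.
  rewrite -mulrBl -natr1 opprD addrA subrr add0r normrM normrN1 mul1r.
  by rewrite ger0_norm // invr_ge0 ltW.
have xN y : x y N = y by rewrite /x divff ?gt_eqF // lerp1.
pose fix hol y k : G :=
  if k is k'.+1 then (tau (x y k') (x y k) * hol y k')%g else 1%g.
(* The steps towards [y] and [y'] form a ladder of small quadrilaterals, each cut by a diagonal into
   two triangles to which [tauM] applies. *)
have ladder y y' k : dist y y' < r / 2 ->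
    hol y' k = (tau (x y k) (x y' k) * hol y k)%g.
  move=> yy'; have x_dist i : dist (x y i) (x y' i) < r / 2.
    exact: le_lt_trans (lerp_dist2 _ _ _ _) yy'.
  have lt_r a : a < r / 2 -> a < r by lra.
  elim: k => [|k IH] /=; first by rewrite /x mul0r !lerp0 /tau mulgV mul1g.
  have diag : dist (x y k) (x y' k.+1) < r.
    have -> : val (x y k) - val (x y' k.+1) =
      (val (x y k) - val (x y' k)) + (val (x y' k) - val (x y' k.+1)).
      by rewrite addrA subrK.
    apply: le_lt_trans (ler_normD _ _) _.
    have := x_dist k; have := xS y' k; lra.
  by rewrite IH [LHS]mulgA [RHS]mulgA !tauM ?diag //; apply: lt_r.
exists (fun y => hol y N) => y.
have near_y : \forall y' \near y, dist y y' < r / 2.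
  by apply/nbhs_simplexP; exists (r / 2).
apply: filterS (filterI near_y (sc (transport_near tr (s y)))) => y' [yy' [b Tb]].
rewrite (ladder _ _ _ yy') mulgK !xN /tau (loc_trans _ _ _ _ _ _ Tb) ?mulgK //.
by apply: lt_trans yy' _; lra.
Qed.

End Existence.
End Lift.

(** * The semi-norm of a cocycle *)

Section AffineMaps.
Variable R : realType.

(** Sends vertex [k] to vertex [u k]; the minimum keeps junk values of [u] inside the target, so
    that every [u] gives a map. *)
Definition aff_row m n (u : nat -> nat) (t : 'rV[R]_m.+1) : 'rV[R]_n.+1 :=
  \row_j \sum_k t 0 k * (minn (u k) n == j)%:R.

Lemma aff_row_simplex m n (u : nat -> nat) (t : std_simplex R m) :
  aff_row n u (val t) \in std_simplex R n.
Proof.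
have [t0 t1] := set_valP t; apply/mem_set; split=> [j|].
  by rewrite mxE sumr_ge0 // => k _; rewrite mulr_ge0.
under eq_bigr do rewrite mxE.
rewrite exchange_big /= -[RHS]t1; apply: eq_bigr => k _.
rewrite -mulr_sumr (bigD1 (inord (minn (u k) n))) //= inordK ?ltnS ?geq_minr //.
rewrite eqxx big1 ?addr0 ?mulr1 // => j ji; case: eqP => // e.
by move: ji; rewrite e inord_val eqxx.
Qed.

Definition aff m n (u : nat -> nat) (t : std_simplex R m) : std_simplex R n :=
  exist _ (aff_row n u (val t)) (aff_row_simplex n u t).

Lemma aff_continuous m n u : continuous (@aff m n u).
Proof.
apply: continuous_comp_initial; apply: mx_continuous => a b.
have -> : (fun x : std_simplex R m => (set_val \o aff n u) x a b) =
    (fun x => \sum_k (fun v : 'rV[R]_m.+1 => v 0 k * (minn (u k) n == b)%:R) (set_val x)).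
  by apply/funext => x; rewrite ord1 mxE.
apply: continuous_big => [|k _]; first exact: add_continuous.
move=> t; apply: (@continuous_comp _ _ _ set_val
  (fun v : 'rV[R]_m.+1 => v 0 k * (minn (u k) n == b)%:R)).
  exact: initial_continuous.
have cc : continuous (fun v : 'rV[R]_m.+1 => v 0 k) by exact: coord_continuous.
exact: (continuousM (cc _) (@cst_continuous _ _ _ _)).
Qed.

HB.instance Definition _ m n u :=
  isContinuous.Build _ _ (@aff m n u) (@aff_continuous m n u).

Lemma aff_comp l m n (u u' : nat -> nat) (t : std_simplex R l) :
  (forall k, (k <= l)%N -> (u' k <= m)%N) ->
  aff n u (aff m u' t) = aff n (u \o u') t.
Proof.
move=> um; apply: val_inj; apply/rowP => j; rewrite !mxE.
under eq_bigr do rewrite mxE mulr_suml.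
rewrite exchange_big /=; apply: eq_bigr => k _.
have uk : (u' k <= m)%N by apply: um; rewrite -ltnS.
rewrite (bigD1 (inord (u' k))) //= inordK // (minn_idPl uk) eqxx mulr1.
rewrite big1 ?addr0 // => i ik; case: eqP => [e|]; last by rewrite mulr0 mul0r.
by move: ik; rewrite e inord_val eqxx.
Qed.

Lemma eq_aff m n (u u' : nat -> nat) (t : std_simplex R m) :
  (forall k, (k <= m)%N -> u k = u' k) -> aff n u t = aff n u' t.
Proof.
move=> uu; apply: val_inj; apply/rowP => j; rewrite !mxE.
by apply: eq_bigr => k _; rewrite uu // -ltnS.
Qed.

Lemma aff_id n (t : std_simplex R n) : aff n id t = t.
Proof.
apply: val_inj; apply/rowP => j; rewrite !mxE (bigD1 j) //=.
rewrite (minn_idPl _) -1?ltnS // eqxx mulr1 big1 ?addr0 // => k kj.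
by rewrite (minn_idPl _) -1?ltnS // (negPf kj : (k == j :> nat) = false) mulr0.
Qed.

Lemma aff_vertex m n (u : nat -> nat) (k : 'I_m.+1) (i : 'I_n.+1) : u k = i :> nat ->
  aff n u (vertex R k) = vertex R i.
Proof.
move=> uk; apply: val_inj; apply/rowP => j; rewrite !mxE (bigD1 k) //=.
rewrite mxE eqxx mul1r uk (minn_idPl _) -1?ltnS // eq_sym big1 ?addr0 // => l.
by move=> /negPf lk; rewrite mxE lk mul0r.
Qed.

Lemma face_aff n (i : 'I_n.+2) (t : std_simplex R n) : face i t = aff n.+1 (bump i) t.
Proof.
apply: val_inj; apply/rowP => j; rewrite !mxE.
have bk (k : 'I_n.+1) : (minn (bump i k) n.+1 == j) = (fintype.lift i k == j).
  by rewrite (minn_idPl _) // -ltnS (ltn_ord (fintype.lift i k)).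
under eq_bigr do rewrite bk; case: unliftP => [k ->|->].
  rewrite (bigD1 k) //= eqxx mulr1 big1 ?addr0 // => l lk.
  by rewrite (inj_eq lift_inj) (negPf lk) mulr0.
by rewrite big1 // => k _; rewrite eq_sym (negPf (neq_lift _ _)) mulr0.
Qed.

End AffineMaps.

Section SingularSimplices.
Variables (R : realType).
Implicit Types X Y : topologicalType.

Definition sing X := {n : nat & sing_simplex R n X}.

Definition sing_of n X (s : sing_simplex R n X) : sing X :=
  Tagged (fun n => sing_simplex R n X) s.

Definition sing_sub X (s : sing X) m (u : nat -> nat) : sing X :=
  sing_of (tagged s \o aff (tag s) u : sing_simplex R m X).

Lemma sing_eqP X n (s t : sing_simplex R n X) : s =1 t ->
  sing_of s = sing_of t.
Proof. by move=> st; congr sing_of; exact/continuousEP. Qed.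

Fact sing_subE X (s : sing X) m u m' u' : (forall k, (k <= m')%N -> (u' k <= m)%N) ->
  sing_sub (@sing_sub X s m u) m' u' = sing_sub s m' (u \o u').
Proof. by move=> um; apply: sing_eqP => t /=; rewrite aff_comp. Qed.

Fact eq_sing_sub X (s : sing X) m u u' : (forall k, (k <= m)%N -> u k = u' k) ->
  sing_sub s m u = sing_sub s m u'.
Proof. by move=> uu; apply: sing_eqP => t /=; rewrite (eq_aff _ _ uu). Qed.

Fact sing_sub_id X (s : sing X) : sing_sub s (tag s) id = s.
Proof. by case: s => n s; apply: sing_eqP => t /=; rewrite aff_id. Qed.

Definition sing_simplices X : simplices :=
  @Simplices (sing X) (fun s => tag s) (@sing_sub X) (fun _ _ _ => erefl)
    (@sing_subE X) (@eq_sing_sub X) (@sing_sub_id X).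

Definition extend n X (a : sing X -> R) : sing_chain R n X -> R^o :=
  fglift (fun s => a (sing_of s) : R^o).
HB.instance Definition _ n X a := GRing.Linear.on (@extend n X a).

Lemma extendU n X (a : sing X -> R) (s : sing_simplex R n X) :
  extend a << s >> = a (sing_of s).
Proof. by rewrite /extend liftU scale1r. Qed.

Lemma extendE n X (a : sing X -> R) (c : sing_chain R n X) :
  extend a c = \sum_(s <- dom c) coeff s c * a (sing_of s).
Proof.
rewrite -[in LHS](freeg_sumE c) linear_sum; apply: eq_bigr => s _.
exact: liftU.
Qed.

Lemma extend_bdU n X (a : sing X -> R) (s : sing_simplex R n.+1 X) :
  extend a (bd << s >>) = scob (U := sing_simplices X) a (sing_of s).
Proof.
rewrite /bd /sing_boundary liftU scale1r linear_sum /scob cob_sum size_iota.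
apply: eq_bigr => i _; rewrite linearZ [LHS]/= extendU; congr (_ * _).
have si : size (del i (iota 0 n.+2)) = n.+1 by rewrite size_del size_iota.
rewrite /restr si; congr a.
apply: sing_eqP => t; rewrite [LHS]/= face_aff; congr (s _); apply: eq_aff => k kn.
rewrite nth_del nth_iota // /bump; rewrite -[sdim _]/n.+1; case: (i <= k)%N; lia.
Qed.

Lemma extend_bd n X (a : sing X -> R) (c : sing_chain R n.+1 X) :
  extend a (bd c) =
  extend (scob (U := sing_simplices X) a) c.
Proof.
apply: (chain_linear_ext (g := @extend n X a \o @bd R n.+1 X)) => s.
by rewrite [RHS]extendU -extend_bdU.
Qed.

End SingularSimplices.

Section LabelSeminorm.
Variables (R : realType) (G : groupType) (n : nat) (F : seq G -> R).
Hypotheses (Finv : invariant F) (Fcocycle : cocycle n.+1 F).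
Hypothesis Fpb : pattern_bounded n.+1 F.
Local Notation d := n.+1.
Implicit Types X Y : topologicalType.

Definition label X (V : sing R X -> seq G) := labelling (U := sing_simplices R X) V.

Lemma label_pullback X Y (f : continuousType X Y) (V : sing R Y -> seq G) :
  label V -> label (fun s => V (sing_of (f \o tagged s : sing_simplex R (tag s) Y))).
Proof.
move=> [V1 V2]; split=> [s|s m u um]; first by rewrite V1.
have [g e] := V2 (sing_of (f \o tagged s : sing_simplex R (tag s) Y)) m u um.
by exists g; rewrite -e; congr V; apply: sing_eqP.
Qed.

(** Keeps the supremum that defines [label_norm] from being taken over the empty set. *)
Lemma label_trivial X : label (fun s : sing R X => nseq (tag s).+1 (1%g : G)).
Proof.
split=> [s|s m u um]; first by rewrite size_nseq.
exists 1%g; apply: (@eq_from_nth _ 1%g) => [|i].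
  by rewrite size_nseq size_map size_iota.
rewrite size_nseq => im; rewrite (nth_map 0%N) ?size_iota // !nth_nseq.
by rewrite im mul1g; case: ifP.
Qed.

Definition pairing X (V : sing R X -> seq G) (h : homology R d X) : R :=
  extend (F \o V) (sing_cycle_val (repr h)).

Lemma pairing_hclass X (V : sing R X -> seq G) z : label V ->
  pairing V (hclass z) = extend (F \o V) (sing_cycle_val z).
Proof.
move=> lV; apply/eqP; rewrite /pairing -subr_eq0 -linearB.
have /hclass_eq[c ->] := hclass_repr (hclass z).
rewrite [X in X == _]/= extend_bd extendE big1 // => s _.
rewrite /scob restr_label_cob ?size_iota //; last first.
  by apply/allP => k; rewrite mem_iota.
rewrite map_nth_iota0 ?take_oversize ?lV.1 //.
by rewrite (Fcocycle (lV.1 (sing_of s))) mulr0.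
Qed.

Lemma pairing_linear X (V : sing R X -> seq G) a h k : label V ->
  pairing V (a *: h + k) = a * pairing V h + pairing V k.
Proof.
move=> lV; rewrite -[h]hclass_repr -[k]hclass_repr -linearP !pairing_hclass //.
exact: linearP.
Qed.

Lemma pairing_map X Y (f : continuousType X Y) (V : sing R Y -> seq G) h : label V ->
  pairing V (homology_map f h) =
  pairing (fun s => V (sing_of (f \o tagged s : sing_simplex R (tag s) Y))) h.
Proof.
move=> lV; rewrite -[h]hclass_repr homology_map_hclass !pairing_hclass //; last first.
  exact: label_pullback.
apply: (chain_linear_ext
  (g := @extend R d Y (F \o V) \o @chain_map R X Y f d)) => s.
rewrite /= /chain_map liftU scale1r !extendU /=; congr (F (V _)).
Qed.

Definition label_norm X (h : homology R d X) : \bar R :=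
  ereal_sup [set `|pairing V h|%:E | V in @label X].

Lemma label_norm_ub X (V : sing R X -> seq G) h : label V ->
  (`|pairing V h|%:E <= label_norm h)%E.
Proof. by move=> lV; apply: ereal_sup_ubound; exists V. Qed.

Lemma label_norm_le X (h : homology R d X) (C : \bar R) :
  (forall V, label V -> `|pairing V h|%:E <= C)%E -> (label_norm h <= C)%E.
Proof. by move=> hC; apply: ge_ereal_sup => _ [V lV <-]; exact: hC. Qed.

Lemma label_norm_ge0 X (h : homology R d X) : (0 <= label_norm h)%E.
Proof. by apply: le_trans (label_norm_ub h (@label_trivial X)); rewrite lee_fin. Qed.

Lemma label_norm_scale X r (h : homology R d X) :
  label_norm (r *: h) = (`|r|%:E * label_norm h)%E.
Proof.
have le s b : (label_norm (s *: b : homology R d X) <= `|s|%:E * label_norm b)%E.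
  apply: label_norm_le => V lV; rewrite -[s *: b]addr0 pairing_linear //.
  have -> : pairing V 0 = 0 :> R.
    by have := pairing_linear 1 0 0 lV; rewrite scaler0 addr0 mul1r; lra.
  by rewrite addr0 normrM EFinM lee_wpmul2l ?lee_fin ?label_norm_ub.
have [->|r0] := eqVneq r 0.
  apply/eqP; rewrite normr0 mul0e eq_le label_norm_ge0 andbT.
  by have := le 0 h; rewrite normr0 mul0e.
apply/eqP; rewrite eq_le le /=.
have rn0 : 0 < `|r| by rewrite normr_gt0.
rewrite -lee_pdivlMl // -normfV.
by rewrite -{1}[h](scalerK r0) le.
Qed.

Lemma label_norm_triangle X (h k : homology R d X) :
  (label_norm (h + k)%R <= label_norm h + label_norm k)%E.
Proof.
apply: label_norm_le => V lV; rewrite -[h]scale1r pairing_linear // mul1r scale1r.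
apply: (@le_trans _ _ (`|pairing V h|%:E + `|pairing V k|%:E)%E).
  by rewrite -EFinD lee_fin ler_normD.
by apply: leeD; exact: label_norm_ub.
Qed.

Lemma label_norm_functorial X Y (f : continuousType X Y) (h : homology R d X) :
  (label_norm (homology_map f h) <= label_norm h)%E.
Proof.
apply: label_norm_le => V lV; rewrite pairing_map //.
by apply: label_norm_ub; exact: label_pullback.
Qed.

Definition label_seminorm : functorial_seminorm R d :=
  FunctorialSeminorm label_norm_ge0 label_norm_scale label_norm_triangle
    label_norm_functorial.

Lemma label_seminorm_finite : finite_fsn label_seminorm.
Proof.
move=> X h; pose z := sing_cycle_val (repr h).
have [C hC] := Fpb (U := sing_simplices R X) [seq sing_of s | s <- dom z].
suff : (label_norm h <= (\sum_(s <- dom z) `|coeff s z| * C)%:E)%E.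
  by move=> /le_lt_trans; apply; rewrite ltry.
apply: label_norm_le => V /hC[psi [chi pc]]; rewrite lee_fin.
have sP s : s \in dom z -> `|psi (sing_of s)| <= C /\ F (V (sing_of s)) =
    psi (sing_of s) + scob (U := sing_simplices R X) chi (sing_of s).
  by move=> sz; apply: pc => //; apply: face_in_self; exact: map_f.
(* The coboundary of [chi] vanishes on the cycle [z]. What remains is bounded by [C], which does not
   depend on [V]. *)
have -> : pairing V h = extend psi z.
  rewrite /pairing -/z; transitivity (extend psi z +
      extend (scob (U := sing_simplices R X) chi) z).
    rewrite !extendE -big_split /=; apply: eq_big_seq => s /sP[_ e].
    by rewrite /= e mulrDr.
  rewrite -extend_bd; have /eqP -> : bd z == 0 := valP (repr h).
  by rewrite linear0 addr0.
rewrite extendE (le_trans (ler_norm_sum _ _ _)) //.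
rewrite !big_seq; apply: ler_sum => s /sP[sC _].
by rewrite normrM ler_wpM2l.
Qed.

End LabelSeminorm.

(** * The space of flags *)

Section LabelOfTransport.
Variables (R : realType) (X : topologicalType) (G : groupType).
Variables (T : X -> X -> G -> Prop) (tr : transport T).

(** Two lifts differ by a right factor, labels may differ by a left one; hence the inverse. *)
Definition lift_label n (g : std_simplex R n -> G) : seq G :=
  [seq (g (vertex R (inord k : 'I_n.+1)))^-1%g | k <- iota 0 n.+1].

Lemma exists_label : exists2 V : sing R X -> seq G, label V &
  forall n (s : sing_simplex R n X) g, is_lift T s g ->
  exists c, V (sing_of s) = [seq (c * x)%g | x <- lift_label g].
Proof.
have lifts (s : sing R X) : exists g, is_lift T (tagged s) g.
  by apply: (exists_lift tr) => x; exact: cts_fun.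
pose gl (s : sing R X) := projT1 (cid (lifts s)).
have glP (s : sing R X) : is_lift T (tagged s) (gl s) := projT2 (cid (lifts s)).
pose V s := lift_label (gl s).
have VP n (s : sing_simplex R n X) g : is_lift T s g ->
    exists c, V (sing_of s) = [seq (c * x)%g | x <- lift_label g].
  move=> sg; have [c gc] := lift_uniq tr sg (glP (sing_of s)).
  exists c^-1%g; rewrite /V /lift_label -map_comp.
  by apply: eq_map => k /=; rewrite gc invgM.
exists V => //; split=> [s|s m u um]; first by rewrite size_map size_iota.
have [c ->] := VP _ _ _ (lift_comp (@aff_continuous R m (tag s) u) (glP s)).
exists c; rewrite /lift_label -map_comp; apply/eq_in_map => k.
rewrite mem_iota /= add0n => km; have uk := um k km; congr (c * _)%g.
rewrite (nth_map 0%N) ?size_iota // nth_iota // add0n; congr (gl s _)^-1%g.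
by apply: aff_vertex; rewrite !inordK.
Qed.

End LabelOfTransport.

Section Selection.
Variable G : groupType.
Implicit Types (P : pred nat) (s : seq G) (m : nat).

Definition sel m P s := [seq nth 1%g s k | k <- iota 0 m & P k].

Lemma eq_sel m P P' s : (forall k, (k < m)%N -> P k = P' k) -> sel m P s = sel m P' s.
Proof.
move=> PP; congr map; apply: eq_in_filter => k; rewrite mem_iota; exact: PP.
Qed.

Lemma sel_mul m P s g : (m <= size s)%N ->
  sel m P [seq (g * x)%g | x <- s] = [seq (g * x)%g | x <- sel m P s].
Proof.
move=> ms; rewrite /sel -map_comp; apply/eq_in_map => k.
rewrite mem_filter mem_iota => /andP[_ /= km].
by rewrite (nth_map 1%g) // (leq_trans km).
Qed.

Lemma sel_del m P s i : (i <= m)%N -> ~~ P i ->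
  sel m.+1 P s = sel m (P \o bump i) (del i s).
Proof.
move=> im Pi; rewrite /sel.
have -> l : map (nth 1%g (del i s)) l = map (nth 1%g s) (map (bump i) l).
  by rewrite -map_comp; apply: eq_map => k; exact: nth_del.
congr map.
transitivity [seq k <- map (bump i) (iota 0 m) | P k]; last by rewrite filter_map.
have -> : map (bump i) (iota 0 m) = iota 0 i ++ iota i.+1 (m - i).
  rewrite -{1}(subnKC im) iotaD map_cat add0n; congr cat.
    by rewrite -[RHS]map_id; apply/eq_in_map => k; rewrite mem_iota /bump; case: leqP; lia.
  rewrite -add1n iotaDl; apply/eq_in_map => k; rewrite mem_iota /bump.
  by case: leqP; lia.
have -> : iota 0 m.+1 = iota 0 i ++ i :: iota i.+1 (m - i).
  by rewrite -[i :: _]/(iota i (m - i).+1) -[in RHS](add0n i) -iotaD; congr iota; lia.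
by rewrite !filter_cat /= (negPf Pi).
Qed.

Lemma sel_size_inj m P P' s : (forall k, (k < m)%N -> P k -> P' k) ->
  size (sel m P s) = size (sel m P' s) -> sel m P s = sel m P' s.
Proof.
move=> PP; rewrite !size_map => e; apply: eq_sel => k km.
have [_ eP] : (size [seq k <- iota 0 m | P k] = size [seq k <- iota 0 m | P' k]) *
    ([seq k <- iota 0 m | P k] =i [seq k <- iota 0 m | P' k]).
  apply: uniq_min_size; rewrite ?e ?filter_uniq ?iota_uniq // => j.
  by rewrite !mem_filter mem_iota => /andP[Pj jm]; rewrite PP.
by have := eP k; rewrite !mem_filter mem_iota km !andbT.
Qed.

End Selection.

Section FlagSpace.
Variable G : groupType.

(* The quotient by G of the poset of flags stands in for the classifying space of G.
   Quotienting is avoided by opening a set only if it is closed under [flag_step],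
   which allows a translation; flags in one orbit are then indistinguishable.
   Translations are free because the members of a flag are told apart by their
   sizes. *)
Record flag := Flag {
  flag_set : set (seq G);
  flag_nonempty : exists A, flag_set A;
  flag_nnil : ~ flag_set [::];
  flag_size_inj : forall A B, flag_set A -> flag_set B -> size A = size B -> A = B }.

HB.instance Definition _ := gen_eqMixin flag.
HB.instance Definition _ := gen_choiceMixin flag.

Lemma flag_eq (D E : flag) : flag_set D = flag_set E -> D = E.
Proof.
case: D E => [D D1 D2 D3] [E E1 E2 E3] /= DE; move: E1 E2 E3; rewrite -DE.
by move=> E1 E2 E3; congr Flag; exact: Prop_irrelevance.
Qed.

Definition flag_step (D E : flag) (g : G) :=
  forall A, flag_set D A -> flag_set E [seq (g * x)%g | x <- A].

Definition flag_open : set_system flag :=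
  [set U | forall D E g, U D -> flag_step D E g -> U E].

Lemma flag_openT : flag_open setT. Proof. by []. Qed.

Lemma flag_openI : setI_closed flag_open.
Proof. by move=> U W oU oW D E g [UD WD] DE; split; [apply: oU DE|apply: oW DE]. Qed.

Lemma flag_open_bigU I (U : I -> set flag) :
  (forall i, flag_open (U i)) -> flag_open (\bigcup_i U i).
Proof. by move=> oU D E g [i _ UD] DE; exists i => //; apply: oU DE. Qed.

HB.instance Definition _ :=
  isOpenTopological.Build flag flag_openT flag_openI flag_open_bigU.

(** Two translates of one list have the same size, so in a flag they agree, and comparing their
    heads determines the translation. The flags reached from [x] by a step form its smallest
    neighbourhood. *)
Lemma flag_transport : transport flag_step.
Proof.
have step_trans x y z a b : flag_step x y a -> flag_step y z b ->
    flag_step x z (b * a)%g.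
  move=> xy yz A /xy/yz; rewrite -map_comp.
  by rewrite (eq_map (g := fun x => (b * a * x)%g)) // => u /=; rewrite mulgA.
have step_id x : flag_step x x 1%g.
  by move=> A; rewrite (eq_map (g := id)) ?map_id // => u; rewrite mul1g.
split=> //.
  move=> x y a b xy xy'; have [A xA] := flag_nonempty x.
  have := flag_size_inj (xy _ xA) (xy' _ xA); rewrite !size_map => /(_ erefl).
  case: A xA => [/flag_nnil//|u A _] [/mulIg + _]; exact.
move=> x; exists [set y | exists a, flag_step x y a]; split=> //.
  by move=> D E g [a xD] DE; exists (g * a)%g; exact: step_trans DE.
by exists 1%g.
Qed.

Lemma near_flag_step (T : topologicalType) (f : T -> flag) (a : T -> T -> G) :
  (forall t, \forall t' \near t, flag_step (f t) (f t') (a t t')) -> continuous f.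
Proof.
move=> fa t A [B [oB Bt BA]]; apply: filterS (fa t) => t' st.
exact/BA/oB/st.
Qed.

End FlagSpace.

(** * Singular simplices of flags with prescribed labels *)

Section StepSimplex.
Variables (R : realType) (G : groupType).
Implicit Types (P : pred nat) (s : seq G) (c : nat -> R).

Definition upper m c P := forall i j, (i < m)%N -> (j < m)%N -> P i ->
  0 < c i /\ (~~ P j -> c j < c i).

Definition positive c : pred nat := fun k => 0 < c k.

(** Chosen among the positive coordinates, so that it does not change when a simplex is restricted
    to a face. *)
Definition base m s c : G := head 1%g (sel m (positive c) s).

(* The sublists of s carried by the superlevel sets of the barycentric coordinates
   c, translated so that they depend on s only up to a left factor. *)
Definition step_set m s c : set (seq G) := [set A | exists P,
  [/\ has P (iota 0 m), upper m c P &
      A = [seq ((base m s c)^-1 * x)%g | x <- sel m P s]]].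

Lemma upper_nested m c P P' : upper m c P -> upper m c P' ->
  (forall k, (k < m)%N -> P k -> P' k) \/ (forall k, (k < m)%N -> P' k -> P k).
Proof.
move=> uP uP'; have [/hasP[i]|/hasPn PP] := boolP (has (fun k => P k && ~~ P' k) (iota 0 m)).
  rewrite mem_iota => /= im /andP[Pi nP'i]; right=> j jm P'j; apply: contraT => nPj.
  have [_ /(_ nPj)] := uP i j im jm Pi; have [_ /(_ nP'i)] := uP' j i jm im P'j.
  by move=> /lt_trans/[apply]; rewrite ltxx.
left=> k km Pk; have := PP k; rewrite mem_iota /= Pk negbK; exact.
Qed.

Lemma step_set_flag m s c : has (positive c) (iota 0 m) -> (forall k, 0 <= c k) ->
  [/\ exists A, step_set m s c A, ~ step_set m s c [::] &
      forall A B, step_set m s c A -> step_set m s c B -> size A = size B -> A = B].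
Proof.
move=> hc c0; split.
- eexists; exists (positive c); split=> //.
  move=> i j _ _ ci; split=> //; rewrite -leNgt => cj; exact: le_lt_trans ci.
- case=> P [hP _ /(congr1 size)]; rewrite !size_map /= size_filter => /esym/eqP.
  by rewrite -leqn0 leqNgt -has_count hP.
move=> _ _ [P [_ uP ->]] [P' [_ uP' ->]]; rewrite !size_map => e; congr map.
by case: (upper_nested uP uP') => PP;
  [apply: sel_size_inj => //|apply/esym/sel_size_inj => //]; rewrite !size_map.
Qed.

Lemma step_set_mul m s c g : (m <= size s)%N -> has (positive c) (iota 0 m) ->
  step_set m [seq (g * x)%g | x <- s] c = step_set m s c.
Proof.
move=> ms hc; have bg : base m [seq (g * x)%g | x <- s] c = (g * base m s c)%g.
  rewrite /base sel_mul //; move: hc; rewrite has_count -size_filter.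
  by rewrite -(size_map (nth 1%g s)) -/(sel m (positive c) s); case: sel.
have e P : [seq ((base m [seq (g * x)%g | x <- s] c)^-1 * x)%g |
      x <- sel m P [seq (g * x)%g | x <- s]] = [seq ((base m s c)^-1 * x)%g | x <- sel m P s].
  rewrite bg sel_mul // -map_comp; apply: eq_map => x /=.
  by rewrite invgM -mulgA mulKg.
by apply/seteqP; split=> A [P [hP uP ->]]; exists P; rewrite e.
Qed.

(* The point with barycentric coordinates [c'] in the [i]-th face has coordinates [c]. *)
Lemma step_set_del m s c c' i : (i <= m)%N -> c i = 0 ->
  (forall k, c' k = c (bump i k)) ->
  step_set m.+1 s c = step_set m (del i s) c'.
Proof.
move=> im ci cc; have nci : ~~ positive c i by rewrite /positive ci ltxx.
have be : base m.+1 s c = base m (del i s) c'.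
  rewrite /base (sel_del _ im) //; congr head; apply: eq_sel => k _.
  by rewrite /= /positive cc.
have bm k : (k < m)%N -> (bump i k < m.+1)%N by rewrite /bump; case: leqP; lia.
apply/seteqP; split=> A [P [hP uP ->]].
  have nPi : ~~ P i.
    have [j] := hasP hP; rewrite mem_iota => /= jm Pj; apply/negP => Pi.
    by have [] := uP i j _ _ Pi; rewrite ?ltnS // ci ltxx.
  exists (P \o bump i); split.
  - have [j] := hasP hP; rewrite mem_iota => /= jm Pj; apply/hasP.
    have ji : i != j by apply: contraNneq nPi => ->.
    exists (unbump i j); last by rewrite /= unbumpK // inE eq_sym.
    by rewrite mem_iota /= /unbump; move: ji jm im; case: ltnP; lia.
  - by move=> j k jm km /= Pj; rewrite !cc; apply: uP; rewrite ?bm.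
  - by rewrite be (sel_del _ im).
pose P' : pred nat := fun k => (k != i) && P (unbump i k).
have P'b k : P' (bump i k) = P k by rewrite /P' bumpK eq_sym neq_bump.
have P'i : ~~ P' i by rewrite /P' eqxx.
exists P'; split.
- have [j] := hasP hP; rewrite mem_iota add0n => jm Pj.
  by apply/hasP; exists (bump i j); rewrite ?P'b // mem_iota /= bm.
- move=> j k; have [-> _ _|ji jm] := eqVneq j i; first by rewrite (negPf P'i).
  have ub l : l != i -> (l < m.+1)%N -> exists2 l', (l' < m)%N & l = bump i l'.
    move=> li lm; exists (unbump i l); last by rewrite unbumpK.
    by rewrite /unbump; move: li lm im; case: ltnP; lia.
  have [j' jm' ->] := ub j ji jm.
  have [-> _|ki km] := eqVneq k i.
    by rewrite P'b -cc => Pj'; have [cj _] := uP _ _ jm' jm' Pj'; rewrite ci.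
  have [k' km' ->] := ub k ki km; rewrite !P'b -!cc; exact: uP.
by rewrite be (sel_del _ im) //; congr map; apply: eq_sel => k _; rewrite /= P'b.
Qed.

Definition coord n (t : std_simplex R n) (k : nat) : R :=
  if (k <= n)%N then val t 0 (inord k) else 0.

Lemma coord_ge0 n (t : std_simplex R n) k : 0 <= coord t k.
Proof. by rewrite /coord; case: ifP => // _; exact: simplex_entry_ge0. Qed.

Lemma coord_positive n (t : std_simplex R n) : has (positive (coord t)) (iota 0 n.+1).
Proof.
have [_ t1] := set_valP t; apply: contraT => /hasPn tn.
have : \sum_i val t 0 i = 0.
  apply: big1 => i _; have := tn i; rewrite mem_iota add0n /= ltn_ord => /(_ isT).
  rewrite /positive -leNgt /coord -ltnS ltn_ord inord_val => ti.
  by apply/eqP; rewrite eq_le ti simplex_entry_ge0.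
by rewrite t1 => /eqP; rewrite oner_eq0.
Qed.

Lemma coord_face n (i : 'I_n.+2) (t : std_simplex R n) k :
  coord t k = coord (face i t) (bump i k).
Proof.
rewrite /coord; have -> : (bump i k <= n.+1)%N = (k <= n)%N.
  by have := ltn_ord i; rewrite /bump; case: leqP; lia.
case: ifP => // kn; rewrite mxE.
have -> : inord (bump i k) = fintype.lift i (inord k : 'I_n.+1).
  by apply: ord_inj; rewrite /= !inordK //; have := ltn_ord i; rewrite /bump; case: leqP; lia.
by rewrite liftK.
Qed.

Lemma coord_face0 n (i : 'I_n.+2) (t : std_simplex R n) : coord (face i t) i = 0.
Proof. by rewrite /coord -ltnS ltn_ord inord_val mxE unlift_none. Qed.

Lemma coord_vertex n (i : 'I_n.+1) k : coord (vertex R i) k = (k == i)%:R.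
Proof.
rewrite /coord; case: leqP => kn.
  by rewrite mxE -val_eqE /= inordK.
by case: eqP => // e; move: kn; rewrite e ltnNge -ltnS ltn_ord.
Qed.

Lemma near_coord_lt n (t : std_simplex R n) i j : coord t j < coord t i ->
  \forall t' \near t, coord t' j < coord t' i.
Proof.
move=> ji; apply/nbhs_simplexP; exists ((coord t i - coord t j) / 2).
  by rewrite divr_gt0 // subr_gt0.
have dist t' k : `|coord t k - coord t' k| <= `|val t - val t'|.
  rewrite /coord; case: ifP => _; last by rewrite subrr normr0.
  by have := entry_le_norm (val t - val t') (inord k); rewrite !mxE.
move=> t' tt'; have := le_lt_trans (dist t' i) tt'; have := le_lt_trans (dist t' j) tt'.
by rewrite !ltr_norml => /andP[? ?] /andP[? ?]; lra.
Qed.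

Lemma near_coord_gt0 n (t : std_simplex R n) i : 0 < coord t i ->
  \forall t' \near t, 0 < coord t' i.
Proof.
have c0 (t' : std_simplex R n) : coord t' n.+1 = 0 by rewrite /coord ltnn.
rewrite -{1}(c0 t) => ti; apply: filterS (near_coord_lt ti) => t'.
by rewrite c0.
Qed.

Definition step_flag n s (t : std_simplex R n) : flag G :=
  let: And3 D1 D2 D3 := step_set_flag s (coord_positive t) (coord_ge0 t) in
  Flag D1 D2 D3.

Lemma step_flagE n s (t : std_simplex R n) :
  flag_set (step_flag s t) = step_set n.+1 s (coord t).
Proof. by rewrite /step_flag; case: step_set_flag. Qed.

Definition sheet n s (t : std_simplex R n) : G := base n.+1 s (coord t).

(** Superlevel sets are given by finitely many strict inequalities and persist at nearby points. So
    the flag can only grow, up to the translation that accounts for the change of [base]. *)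
Lemma step_flag_near n s (t : std_simplex R n) : \forall t' \near t,
  flag_step (step_flag s t) (step_flag s t') ((sheet s t')^-1 * sheet s t)%g.
Proof.
have gt0 i : \forall t' \near t, 0 < coord t i -> 0 < coord t' i.
  have [ti|_] := ltP 0 (coord t i); last by near=> t'.
  by apply: filterS (near_coord_gt0 ti).
have lt i j : \forall t' \near t, coord t j < coord t i -> coord t' j < coord t' i.
  have [ti|_] := ltP (coord t j) (coord t i); last by near=> t'.
  by apply: filterS (near_coord_lt ti).
have near_t : \forall t' \near t, forall i j : 'I_n.+1,
    (0 < coord t i -> 0 < coord t' i) /\ (coord t j < coord t i -> coord t' j < coord t' i).
  have near_ij (i j : 'I_n.+1) := filterI (gt0 i) (lt i j).
  apply: (@filter_forall _ 'I_n.+1 _ (nbhs t)) => i.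
  by apply: (@filter_forall _ 'I_n.+1 _ (nbhs t)) => j; exact: near_ij.
apply: filterS near_t => t' tt' A; rewrite !step_flagE => -[P [hP uP ->]]; exists P.
split=> //.
  move=> i j im jm Pi; have [ci cij] := uP i j im jm Pi.
  have [ci' cij'] := tt' (Ordinal im) (Ordinal jm).
  by split=> [|/cij]; [exact: ci'|exact: cij'].
rewrite -map_comp; apply: eq_map => x /=.
by rewrite -[base _ _ (coord t)]/(sheet s t) -mulgA mulVKg.
Unshelve. all: by end_near.
Qed.

Lemma step_flag_continuous n s : continuous (@step_flag n s).
Proof. exact: near_flag_step (@step_flag_near n s). Qed.

HB.instance Definition _ n s :=
  isContinuous.Build _ _ (@step_flag n s) (@step_flag_continuous n s).

Definition step_simplex n s : sing_simplex R n (flag G) := @step_flag n s.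

Lemma step_lift n s : is_lift (@flag_step G) (@step_flag n s)
  (fun t => (sheet s t)^-1%g).
Proof. by move=> t; apply: filterS (step_flag_near s t) => t'; rewrite invgK. Qed.

Lemma step_simplex_mul n s g : (n < size s)%N ->
  step_simplex n [seq (g * x)%g | x <- s] = step_simplex n s.
Proof.
move=> ns; apply/continuousEP => t; apply: flag_eq.
by rewrite !step_flagE step_set_mul // coord_positive.
Qed.

Lemma face_step_simplex n (i : 'I_n.+2) s :
  face_sing i (step_simplex n.+1 s) = step_simplex n (del i s).
Proof.
apply/continuousEP => t; apply: flag_eq; rewrite /= !step_flagE.
apply: step_set_del; first by rewrite -ltnS.
  exact: coord_face0.
exact: coord_face.
Qed.

Lemma sheet_vertex n s (k : nat) : (k <= n)%N ->
  sheet s (vertex R (inord k : 'I_n.+1)) = nth 1%g s k.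
Proof.
move=> kn; rewrite /sheet /base.
have -> : sel n.+1 (positive (coord (vertex R (inord k : 'I_n.+1)))) s =
    sel n.+1 (pred1 k) s.
  apply: eq_sel => j _; rewrite /positive coord_vertex inordK // ltr0n /=.
  by case: (j == k).
by rewrite /sel filter_pred1_uniq ?iota_uniq // mem_iota.
Qed.

Lemma step_label : exists2 V : sing R (flag G) -> seq G, label V &
  forall n s, size s = n.+1 -> exists g, V (sing_of (step_simplex n s)) =
    [seq (g * x)%g | x <- s].
Proof.
have [V lV VP] := exists_label R (flag_transport G).
exists V => // n s sn; have [g ->] := VP _ _ _ (@step_lift n s); exists g.
congr map; rewrite /lift_label -[RHS](mkseq_nth 1%g) sn; apply/eq_in_map => k.
by rewrite mem_iota => /= kn; rewrite invgK sheet_vertex.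
Qed.

End StepSimplex.

Section StepChains.
Variables (R : realType) (G : groupType).

(** The value 0 on lists of the wrong size makes this an invariant function on all lists, to which
    [cycle] and [l1_null] apply. *)
Definition step_chain n (s : seq G) : sing_chain R n (flag G) :=
  if size s == n.+1 then << step_simplex R n s >> else 0.

Lemma step_chain_inv n : invariant (step_chain n).
Proof.
move=> g s; rewrite /step_chain size_map; case: eqP => // sn.
by rewrite step_simplex_mul ?sn.
Qed.

Lemma bd_step_chain n s : size s = n.+2 ->
  bd (step_chain n.+1 s) = cob (step_chain n) s.
Proof.
move=> sn; rewrite /step_chain sn eqxx /bd /sing_boundary liftU scale1r.
rewrite cob_sum sn; apply: eq_bigr => i _.
by rewrite size_del sn //= eqxx face_step_simplex.
Qed.

Lemma bd_ev_step_chain n (a : chain R (seq G)) : of_size n.+2 a ->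
  bd (ev (step_chain n.+1) a) = ev (cob (step_chain n)) a.
Proof.
move=> sa; rewrite (ev_linear (@bd R n.+1 (flag G))).
by apply: (eq_ev_size sa) => s; exact: bd_step_chain.
Qed.

Lemma l1_step_chain n (a : chain R (seq G)) : l1_chain (ev (step_chain n) a) <= cnorm a.
Proof.
elim: a => [|[r s] a IH].
  by rewrite /ev /cnorm !big_nil /l1_chain dom0 big_nil.
rewrite ev_cons /cnorm big_cons -/(cnorm a).
apply: le_trans (l1_chainD _ _) _; apply: lerD => //.
rewrite l1_chainZ /= -[leRHS]mulr1 ler_wpM2l // /step_chain; case: ifP => _.
  by rewrite /l1_chain domU1 big_seq1 coeffU eqxx mulr1 normr1.
by rewrite /l1_chain dom0 big_nil.
Qed.

Lemma step_cycle_subproof n (a : chain R (seq G)) : of_size n.+2 a -> cycle a ->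
  ev (step_chain n.+1) a \in @is_cycle R n.+1 (flag G).
Proof.
move=> sa ca; rewrite inE bd_ev_step_chain //; apply/eqP/ca.
exact: step_chain_inv.
Qed.

Definition step_cycle n a (sa : of_size n.+2 a) (ca : cycle a) :=
  SingCycle (step_cycle_subproof sa ca).

Lemma l1_step_cycle n a (sa : of_size n.+2 a) (ca : cycle a) :
  l1_null n.+1 a -> l1 (hclass (step_cycle sa ca)) = 0%E.
Proof.
move=> na; apply/eqP; rewrite eq_le l1_ge0 andbT.
apply/lee_addgt0Pr => e e0; rewrite add0e.
have [a' [b [sa' sb ne ab]]] := na e e0.
have zz' := ab _ _ (@step_chain_inv n.+1).
have bd0 : bd (ev (cob (step_chain n.+1)) b) = 0.
  rewrite (ev_linear (@bd R n.+1 (flag G))) -[RHS](ev_eq0 b (f := fun=> 0)) //.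
  apply: (eq_ev_size sb) => s ss /=.
  rewrite (cob_linear (@bd R n.+1 (flag G))) -[RHS](cob_cob (step_chain n) s).
  by apply: cob_eq_size => w; rewrite ss => -[/bd_step_chain].
have cz' : ev (step_chain n.+1) a' \in @is_cycle R n.+1 (flag G).
  have := step_cycle_subproof sa ca; rewrite !inE zz'.
  by rewrite (linearD (@bd R n.+1 (flag G))) [X in _ + X]bd0 addr0.
have -> : hclass (step_cycle sa ca) = hclass (SingCycle cz').
  apply/hclass_eq; exists (ev (step_chain n.+2) b).
  by rewrite bd_ev_step_chain //= zz' addrC addKr.
by apply: le_trans (l1_le _) _; rewrite lee_fin (le_trans (l1_step_chain _ _)).
Qed.

End StepChains.

(** The labelling of [step_label] restores the vertices of every step simplex up to translation, so
    it pairs the step cycle to [ev F a], which is nonzero, while [l1_step_cycle] gives l1-norm 0. *)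
Lemma detected_not_carried (R : realType) (G : groupType) n (F : seq G -> R)
    (a : chain R (seq G)) : detected n.+1 F a -> l1_null n.+1 a ->
  exists N : functorial_seminorm R n.+1,
    finite_fsn N /\ ~ carries (l1_seminorm R n.+1) N.
Proof.
case=> Finv Fc _ Fpb sa ca Fa na.
exists (label_seminorm Finv Fc); split; first exact: label_seminorm_finite.
move=> /(_ _ (hclass (step_cycle sa ca)) (l1_step_cycle sa ca na)) N0.
have [V lV VJ] := step_label R G.
have : pairing F V (hclass (step_cycle sa ca)) = ev (F : _ -> R^o) a.
  rewrite (pairing_hclass Finv Fc) //= (ev_linear (@extend R n.+1 (flag G) (F \o V))).
  apply: (eq_ev_size sa) => s ss; rewrite /= /step_chain ss eqxx extendU /=.
  by have [g ->] := VJ _ _ ss; rewrite Finv.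
have := label_norm_ub F (hclass (step_cycle sa ca)) lV.
rewrite -[label_norm _ _]/(label_seminorm Finv Fc _ _) N0 lee_fin normr_le0.
by move=> /eqP -> e; rewrite -e eqxx in Fa.
Qed.

Local Close Scope ring_scope.

Theorem theorem1p2 (R : realType) (d : nat) (hd : d = 3 \/ 5 <= d) :
  exists N : functorial_seminorm R d,
    finite_fsn N /\ ~ carries (l1_seminorm R d) N.
Proof.
have [G [F [a [Fa a0]]]] := null_detectable_dims (detectable2 ratfun_valuation R)
  (null_detectable3 ratfun_valuation R) hd.
by case: d hd Fa a0 => [[]//|n _]; exact: detected_not_carried.
Qed.
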